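(* Let $n\ge 2$, $K\ge1$, and let $f=(f_1,\ldots,f_n)$ be a harmonic $K$-quasiregular mapping of $\mathbf{B}^n$ into $\mathbb{R}^n$. If there is an index $k\in\{1,\ldots,n\}$ such that $f_k\in\mathbb{H}^p(\mathbf{B}^n,\mathbb{R})$ for some $p>p_0=1$, then $f\in\mathbb{H}^p(\mathbf{B}^n,\mathbb{R}^n)$. Furthermore, the constant $p_0=1$ is sharp, that is, for no constant $p_0<1$ does this implication hold for all such $n,K,f,k$ and all $p>p_0$. Moreover, the following estimates hold. ($\mathscr{A}_1$) For $p\in(1,2]$, if $f_k\in\mathbb{H}^p(\mathbf{B}^n,\mathbb{R})$ for some $k\in\{1,\ldots,n\}$, then for $r\in[0,1)$, $$M_p^p(r,f)\le|f(0)|^p+\left(\frac{1+(n-1)K^2}{p-1}\right)\left(M_p^p(r,f_k)-|f_k(0)|^p\right).$$ ($\mathscr{A}_2$) For $p\in(2,\infty)$, there is a positive constant $\tau_1=\tau_1(n,p,K)$, depending only on $n,p,K$, such that if $f_k\in\mathbb{H}^p(\mathbf{B}^n,\mathbb{R})$ for some $k\in\{1,\ldots,n\}$, then $$\|f\|_p^2\le|f(0)|^2+\tau_1\|f_k\|_p^2.$$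
   Context: $\mathbf{B}^n$ is the open unit ball of $\mathbb{R}^n$, $\mathbf{S}^{n-1}$ its boundary, $d\sigma$ the normalized surface measure on $\mathbf{S}^{n-1}$, and $|\cdot|$ the Euclidean norm. Hardy type space: for $p\in(0,\infty)$, $m\ge1$, $\mathbb{H}^p(\mathbf{B}^n,\mathbb{R}^m)$ is the set of measurable $f:\mathbf{B}^n\to\mathbb{R}^m$ such that $M_p(r,f)=\left(\int_{\mathbf{S}^{n-1}}|f(r\zeta)|^p\,d\sigma(\zeta)\right)^{1/p}$ exists for all $r\in[0,1)$ and $\|f\|_p=\sup_{0<r<1}M_p(r,f)<\infty$. $M_p^p(r,f)$ means $(M_p(r,f))^p$. Quasiregular: a continuous $f:\Omega\subset\mathbb{R}^n\to\mathbb{R}^n$ is $K$-quasiregular ($K\ge1$ a constant) if $f\in W^1_{n,\mathrm{loc}}(\Omega)$ (the distributional first partial derivatives of the coordinates of $f$ are locally in $L^n(\Omega)$) and $|f'(x)|^n\le K J_f(x)$ for almost every $x\in\Omega$, where $|f'(x)|$ is the operator norm of the derivative and $J_f$ is the Jacobian determinant. A harmonic $K$-quasiregular mapping $f=(f_1,\ldots,f_n):\mathbf{B}^n\to\mathbb{R}^n$ is a $K$-quasiregular mapping each of whose coordinate functions $f_j$ is harmonic ($C^2$ with $\Delta f_j=0$). *)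

(* Defs.v *)
From HB Require Import structures.
From mathcomp Require Import all_boot all_order all_algebra.
From mathcomp Require Import all_classical all_reals all_analysis.
From mathcomp Require Import measurable_realfun.

Set Implicit Arguments.
Unset Strict Implicit.
Unset Printing Implicit Defensive.
Import Order.TTheory GRing.Theory Num.Theory.
Import numFieldNormedType.Exports.

Local Open Scope classical_set_scope.
Local Open Scope ring_scope.

(* 'rV[R]_n carries the product sigma-algebra, generated by the coordinates
   (as n.-tuple R does in the library); it is the Borel sigma-algebra of R^n. *)
Definition rV_display : measure_display -> measure_display.
Proof. exact. Qed.

Section measurable_rV.
Context d (T : measurableType d) (n : nat).

Let coor : 'I_n -> 'rV[T]_n -> T := fun i x => x ord0 i.

Let rV_set0 : g_sigma_preimage coor set0.
Proof. exact: sigma_algebra0. Qed.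

Let rV_setC A : g_sigma_preimage coor A -> g_sigma_preimage coor (~` A).
Proof. exact: sigma_algebraC. Qed.

Let rV_bigcup (F : (set 'rV[T]_n)^nat) :
  (forall i, g_sigma_preimage coor (F i)) ->
  g_sigma_preimage coor (\bigcup_i (F i)).
Proof. exact: sigma_algebra_bigcup. Qed.

HB.instance Definition _ := @isMeasurable.Build (rV_display d)
  'rV[T]_n (g_sigma_preimage coor) rV_set0 rV_setC rV_bigcup.

End measurable_rV.


Section measurable_rV_theory.
Context d (T : measurableType d).

Lemma measurable_rV_coord n (i : 'I_n) :
  measurable_fun [set: 'rV[T]_n] (fun x : 'rV[T]_n => x ord0 i).
Proof.
move=> _ Y mY; rewrite setTI; apply: sub_sigma_algebra => /=.
rewrite -bigcup_seq/=; exists i => /=; first by rewrite mem_index_enum.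
by exists Y => //; rewrite setTI.
Qed.

Lemma measurable_fun_rVP d1 (T1 : measurableType d1) n (f : T1 -> 'rV[T]_n) :
  measurable_fun [set: T1] f <->
  forall i, measurable_fun [set: T1] (fun t => f t ord0 i).
Proof.
pose g (i : 'I_n) (x : 'rV[T]_n) := x ord0 i.
split=> [mf i|mf].
  exact: (measurableT_comp (measurable_rV_coord i) mf).
have := @g_sigma_preimage_comp _ T n _ g _ f => /= gE _ A mA.
rewrite setTI.
have : g_sigma_preimage (fun i => g i \o f) (f @^-1` A).
  by rewrite gE; exists A => //; rewrite setTI.
apply: smallest_sub; first exact: sigma_algebra_measurable.
move=> B; rewrite -bigcup_seq => -[i _ [C mC <-]].
exact: mf.
Qed.

End measurable_rV_theory.

Section euclidean.
Context {R : realType}.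

(* The library norm `|x| on 'rV[R]_n is the sup norm; it has the same topology
   as the Euclidean norm. *)
Definition enorm n (x : 'rV[R]_n) : R := Num.sqrt (\sum_(i < n) x ord0 i ^+ 2).

Definition unit_ball n : set 'rV[R]_n := [set x | enorm x < 1].

Definition unit_sphere n : set 'rV[R]_n := [set x | enorm x = 1].

Lemma measurable_enorm n : measurable_fun setT (@enorm n).
Proof.
apply: (@measurableT_comp _ _ _ _ _ _ (@Num.sqrt R)).
  by apply: continuous_measurable_fun; exact: sqrt_continuous.
apply: measurable_sum => i; apply: measurable_funX.
exact: measurable_rV_coord.
Qed.

Lemma measurable_unit_ball n : measurable (@unit_ball n).
Proof.
rewrite (_ : @unit_ball n = setT `&` @enorm n @^-1` `]-oo, 1[%classic).
  by apply: measurable_enorm => //; exact: measurable_itv.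
by apply/seteqP; split => x; rewrite /unit_ball /= in_itv /= ?setTI // => -[].
Qed.

End euclidean.
Arguments unit_ball R n : clear implicits.
Arguments unit_sphere R n : clear implicits.

Definition image_measure d1 d2 (T1 : measurableType d1) (T2 : measurableType d2)
    (R : realType) (mu : {measure set T1 -> \bar R}) (f : T1 -> T2)
    (mf : measurable_fun setT f) : {measure set T2 -> \bar R} :=
  measure_function_pushforward__canonical__measure_function_Measure mu mf.

Section lebesgue_rV.
Context {R : realType}.

Definition rV_cons n (xt : 'rV[R]_n * R) : 'rV[R]_n.+1 :=
  row_mx (xt.2%:M : 'rV[R]_1) xt.1.

Lemma measurable_rV_cons n : measurable_fun setT (@rV_cons n).
Proof.
apply/measurable_fun_rVP => i.
case: (@splitP 1 n i) => j ij.
- rewrite (_ : (fun _ => _) = snd); first exact: measurable_snd.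
  apply/funext => t; rewrite /rV_cons (_ : i = lshift n j); last exact: val_inj.
  by rewrite (@row_mxEl _ 1 1 n) mxE (ord1 j) eqxx mulr1n.
- rewrite (_ : (fun _ => _) = (fun x : 'rV[R]_n => x ord0 j) \o fst).
    exact: (measurableT_comp (measurable_rV_coord j) measurable_fst).
  apply/funext => t; rewrite /rV_cons (_ : i = rshift 1 j); last exact: val_inj.
  by rewrite (@row_mxEr _ 1 1 n).
Qed.

Fixpoint lebesgue_rV n : {measure set 'rV[R]_n -> \bar R} :=
  match n with
  | 0 => dirac (0 : 'rV[R]_0)
  | n'.+1 => image_measure
      (lebesgue_rV n' \x @lebesgue_measure R)%E (@measurable_rV_cons n')
  end.

Definition radial_proj n (x : 'rV[R]_n) : 'rV[R]_n := (enorm x)^-1 *: x.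

Lemma measurable_radial_proj n : measurable_fun setT (@radial_proj n).
Proof.
apply/measurable_fun_rVP => i; rewrite /radial_proj.
under eq_fun do rewrite mxE.
apply: measurable_funM; last exact: measurable_rV_coord.
rewrite (_ : (fun t => _) = (fun t : 'rV[R]_n => enorm t `^ (-1))).
  apply: (measurableT_comp (measurable_powR (-1)) (@measurable_enorm R n)).
by apply/funext => t; rewrite powR_inv1// sqrtr_ge0.
Qed.

(* Normalized surface measure, via polar coordinates: the measure of A is the
   proportion of the volume of the ball lying in the cone over A. It is
   concentrated on the sphere for n > 0. The second argument of mnormalize is
   only a default value for null or infinite measures. *)
Definition surface_measure n : probability 'rV[R]_n R :=
  mnormalize
    (image_measure (mrestr (lebesgue_rV n) (@measurable_unit_ball R n))
      (@measurable_radial_proj n))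
    (dirac (0 : 'rV[R]_n)).

End lebesgue_rV.
Arguments lebesgue_rV R n : clear implicits.
Arguments surface_measure R n : clear implicits.

Section hardy.
Context {R : realType} {n m : nat}.
Local Open Scope ereal_scope.
Implicit Types (p r : R) (f : 'rV[R]_n -> 'rV[R]_m).

Definition Mp p r f : \bar R :=
  (\int[surface_measure R n]_(z in unit_sphere R n)
     (enorm (f (r *: z)%R) `^ p)%:E) `^ p^-1.

Definition hardy_norm p f : \bar R :=
  ereal_sup [set Mp p r f | r in `]0%R, 1%R[%classic].

Definition hardy p f : Prop :=
  [/\ measurable_fun (unit_ball R n) f,
      (forall r, (0 <= r < 1)%R ->
        (surface_measure R n).-integrable (unit_sphere R n)
          (fun z => (enorm (f (r *: z)%R) `^ p)%:E)) &
      hardy_norm p f < +oo].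

End hardy.

(* R-valued functions are seen as R^1-valued ones in hardy and Mp. *)
Definition coord_fun (R : realType) n m (f : 'rV[R]_n -> 'rV[R]_m) (k : 'I_m) :
    'rV[R]_n -> 'rV[R]_1 :=
  fun x => (f x ord0 k)%:M.

Section sobolev.
Context {R : realType} {n : nat}.
Implicit Types (Om : set 'rV[R]_n) (u g : 'rV[R]_n -> R).

Definition partial (i : 'I_n) u : 'rV[R]_n -> R := 'D_(delta_mx ord0 i) u.

(* Meant for open Om: continuity and derivatives are taken in R^n. *)
Fixpoint class_C (k : nat) Om u : Prop :=
  (forall x, Om x -> {for x, continuous u}) /\
  match k with
  | 0 => True
  | k'.+1 => forall i : 'I_n,
      (forall x, Om x -> derivable u x (delta_mx ord0 i)) /\
      class_C k' Om (partial i u)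
  end.

Definition harmonic Om u : Prop :=
  class_C 2 Om u /\
  forall x, Om x -> \sum_(i < n) partial i (partial i u) x = 0.

Definition test_function Om u : Prop :=
  let supp := closure [set x | u x != 0] in
  [/\ forall k, class_C k setT u, compact supp & supp `<=` Om].

Definition weak_partial Om (i : 'I_n) u g : Prop :=
  forall phi, test_function Om phi ->
    \int[lebesgue_rV R n]_(x in Om) (u x * partial i phi x) =
    - \int[lebesgue_rV R n]_(x in Om) (g x * phi x).

Definition locally_Lp (p : R) Om u : Prop :=
  measurable_fun Om u /\
  forall A, compact A -> A `<=` Om ->
    (lebesgue_rV R n).-integrable A (fun x => (`|u x| `^ p)%:E).

End sobolev.

Section quasiregular.
Context {R : realType} {n : nat}.
Implicit Types (Om : set 'rV[R]_n) (K : R) (f : 'rV[R]_n -> 'rV[R]_n).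

(* operator norm for the Euclidean norm; matrices act on row vectors *)
Definition opnorm (A : 'M[R]_n) : R :=
  sup [set enorm (v *m A) | v in [set v : 'rV[R]_n | enorm v <= 1]].

(* Df x i j is the weak partial derivative of f_j along the i-th axis (the
   convention of the library's jacobian). *)
Definition quasiregular K Om f : Prop :=
  (forall x, Om x -> {for x, continuous f}) /\
  exists Df : 'rV[R]_n -> 'M[R]_n,
    (forall i j : 'I_n,
       locally_Lp n%:R Om (fun x => Df x i j) /\
       weak_partial Om i (fun x => f x ord0 j) (fun x => Df x i j)) /\
    {ae lebesgue_rV R n, forall x, Om x -> opnorm (Df x) ^+ n <= K * \det (Df x)}.

Definition harmonic_quasiregular K f : Prop :=
  quasiregular K (unit_ball R n) f /\
  forall j : 'I_n, harmonic (unit_ball R n) (fun x => f x ord0 j).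

End quasiregular.

Definition hardy_transfer (R : realType) (p0 : R) : Prop :=
  forall (n : nat) (K : R) (f : 'rV[R]_n -> 'rV[R]_n) (k : 'I_n) (p : R),
    (2 <= n)%N -> 1 <= K -> harmonic_quasiregular K f ->
    0 < p -> p0 < p ->
    hardy p (coord_fun f k) -> hardy p f.

(* Main.v *)
Require Import Defs.
From HB Require Import structures.
From mathcomp Require Import all_boot all_order all_algebra.
From mathcomp Require Import all_classical all_reals all_analysis.
From mathcomp Require Import measurable_realfun perm ring lra.

Set Implicit Arguments.
Unset Strict Implicit.
Unset Printing Implicit Defensive.
Import Order.TTheory GRing.Theory Num.Theory.
Import numFieldNormedType.Exports.
Local Open Scope classical_set_scope.
Local Open Scope ring_scope.

(** A harmonic function has its classical partial derivatives as weak ones, so the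
    distortion inequality holds pointwise, and it bounds each column of the derivative
    by any other: |grad f_j| <= K |grad f_k|. With L = 1 + (n-1) K^2 this gives
    sum_j |grad f_j|^2 <= L |grad f_k|^2.

    Put p = 2q, a = f_k^2 + e and s = |f|^2 + e with e > 0. For q <= 1 the function
    L/(p-1) a^q - s^q is subharmonic; for q > 1 so is A a^q + B a s^(q-1) - s^q, for
    constants A and B depending on n, p, K. The sub-mean value property on spheres and
    e -> 0 give (A1) in the first case. In the second, Hoelder's inequality bounds the
    mean of a s^(q-1) by al sg^(q-1), where al and sg are the L^q means of a and s;
    dividing by sg^(q-1) leaves sg <= s(0) + (A+B) al, which is (A2).

    For sharpness take p = 1 and f = (1+z)/(1-z) in the plane: its real part is a
    positive harmonic function, so all its means are 1, while the means of
    |Im f| = 2|y|/|1-z|^2 diverge logarithmically. *)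

(** * Lebesgue measure on row vectors *)

Section measure_rV.
Context {R : realType}.

(** The number e > 0 keeps a and s away from 0, where t^q is not smooth. For q <= 1 one has s^(q-1)
    <= a^(q-1), so the Laplacian of a^q dominates that of s^q pointwise. For q > 1 this breaks down
    where a is much smaller than s, for instance near zeros of f_k. The mixed function a s^(q-1)
    repairs it, because its Laplacian contains 2 |grad f_k|^2 s^(q-1), with the right power of s.

    The surface measure is the radial image of the volume of the ball, so means over spheres are
    integrals over the ball, and the sub-mean value property comes from integrating a divergence
    over balls. Quasiregularity speaks of weak derivatives; smooth bumps are built in order to show
    that these agree almost everywhere with the classical ones, and continuity then turns the
    distortion inequality into one at every point. *)

Definition rV_box n (A : 'I_n -> set R) : set 'rV[R]_n :=
  [set x | forall i, A i (x ord0 i)].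

Lemma measurable_rV_box n (A : 'I_n -> set R) :
  (forall i, measurable (A i)) -> measurable (rV_box A).
Proof.
move=> mA.
rewrite (_ : rV_box A = \bigcap_(i in [set: 'I_n])
    (setT `&` (fun x : 'rV[R]_n => x ord0 i) @^-1` A i)).
  apply: fin_bigcap_measurable => [|i _]; first exact: finite_finset.
  exact: measurable_rV_coord.
apply/seteqP; split=> x /= h i; first by split.
by have [] := h i I.
Qed.

(** The sigma-algebra is generated by the coordinates, so an open set is written as the union of the
    boxes with rational centre and radius that it contains, of which there are countably many. *)
Lemma open_measurable_rV n (U : set 'rV[R]_n) : open U -> measurable U.
Proof.
move=> oU.
pose bx (q : 'rV[rat]_n * rat) : set 'rV[R]_n := rV_box (fun i =>
  `]ratr (q.1 ord0 i) - ratr q.2, ratr (q.1 ord0 i) + ratr q.2[%classic).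
rewrite (_ : U = \bigcup_q (if `[< bx q `<=` U >] then bx q else set0)).
  apply: countable_bigcupT_measurable => [|q]; first exact: countableP.
  by case: ifP => // _; apply: measurable_rV_box => i; exact: measurable_itv.
apply/seteqP; split=> [x Ux|x [q _]]; last first.
  by case: ifPn => // /asboolP + ?; exact.
have /nbhs_ballP[e /= e0 xeU] : nbhs x U by exact: open_nbhs_nbhs.
have [r] : exists r : rat, ratr r \in `]0, e / 2[%R.
  by apply: rat_in_itvoo; rewrite divr_gt0.
rewrite in_itv/= => /andP[r0 re].
have /choice[q qE] : forall i : 'I_n, exists q : rat,
    ratr q \in `]x ord0 i - ratr r, x ord0 i + ratr r[%R.
  by move=> i; apply: rat_in_itvoo; rewrite ltrD2l gt0_cp.
exists (\row_i q i, r) => //; rewrite ifT.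
  by move=> i /=; have := qE i; rewrite mxE !in_itv/=; lra.
apply/asboolP => y yq; apply: xeU; split => // i j.
rewrite (ord1 i) /ball/= ltr_norml.
by have := qE j; have := yq j; rewrite /= mxE !in_itv/=; lra.
Qed.

Lemma continuous_open_measurable_rV n (U : set 'rV[R]_n) (f : 'rV[R]_n -> R) :
  open U -> (forall x, U x -> {for x, continuous f}) -> measurable_fun U f.
Proof.
move=> oU cf; move=> mU; apply: (measurability _ (RGenOpens.measurableE R)) => //.
move=> _ [_ [a [b ->] <-]]; apply: open_measurable_rV.
rewrite openE => x [Ux fx]; rewrite /interior.
apply: filterI; first exact: open_nbhs_nbhs.
apply: cf => //; apply: open_nbhs_nbhs; split => //; exact: interval_open.
Qed.

(** A named set function to which the sigma-finite structure required by Fubini can be attached,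
    [lebesgue_rV] being a recursively defined bundled measure. *)
Definition leb n : set 'rV[R]_n -> \bar R := lebesgue_rV R n.
Arguments leb n : clear implicits.
HB.instance Definition _ n := Measure.copy (leb n) (lebesgue_rV R n).

Lemma leb_box n (A : 'I_n -> set R) : (forall i, measurable (A i)) ->
  leb n (rV_box A) =
  (\prod_(i < n) lebesgue_measure (A i))%E.
Proof.
rewrite /leb; elim: n A => [|n IH] A mA.
  by rewrite big_ord0/= diracE mem_set// => -[].
rewrite big_ord_recl /= /pushforward.
rewrite (_ : _ @^-1` _ = rV_box (fun i => A (lift ord0 i)) `*` A ord0).
  rewrite product_measure1E; [|exact: (measurable_rV_box (fun i => mA _))|exact: mA].
  by rewrite muleC IH.
apply/seteqP; split=> -[x t] /=.
  move=> h; split=> [i|].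
    have := h (lift ord0 i); rewrite /rV_cons.
    rewrite (_ : lift ord0 i = rshift 1 i); last exact: val_inj.
    by rewrite (@row_mxEr _ 1 1 n).
  have := h ord0; rewrite /rV_cons.
  rewrite (_ : ord0 = lshift n (ord0 : 'I_1)); last exact: val_inj.
  by rewrite (@row_mxEl _ 1 1 n) mxE eqxx mulr1n.
move=> [h1 h2] i; rewrite /rV_cons; case: (unliftP ord0 i) => [j|] ->.
  rewrite (_ : lift ord0 j = rshift 1 j); last exact: val_inj.
  rewrite (@row_mxEr _ 1 1 n)//= (_ : rshift 1 j = lift ord0 j) //.
  exact: val_inj.
rewrite (_ : ord0 = lshift n (ord0 : 'I_1)); last exact: val_inj.
rewrite (@row_mxEl _ 1 1 n) mxE eqxx mulr1n//=.
by rewrite (_ : lshift n (ord0 : 'I_1) = ord0)//; exact: val_inj.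
Qed.

Definition cube n (c : R) : set 'rV[R]_n :=
  rV_box (fun=> `[- c, c]%classic).

Lemma measurable_cube n c : measurable (@cube n c).
Proof. by apply: measurable_rV_box. Qed.

Lemma leb_cube_lty n c : (leb n (cube c) < +oo)%E.
Proof.
rewrite leb_box//.
have [r ->] : exists r : R,
  (\prod_(i < n) lebesgue_measure `[(- c)%R, c]%classic)%E = r%:E; last first.
  exact: ltry.
elim: n => [|n [r IH]]; first by rewrite big_ord0; exists 1.
rewrite big_ord_recr/= IH lebesgue_measure_itv/=.
by case: ifP => _; [exists (r * (c - - c)) | exists (r * 0)].
Qed.

Lemma sigma_finite_leb n : sigma_finite setT (leb n).
Proof.
exists (fun k => cube k%:R).
  apply/seteqP; split => // x _; exists (Num.truncn `|x|).+1 => // i /=.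
  rewrite in_itv/= -ler_norml.
  apply: (@le_trans _ _ `|x|).
    rewrite [leRHS]/Num.norm/= mx_normrE.
    by apply: le_trans (le_bigmax _ _ (ord0, i)).
  by apply/ltW; exact: truncnS_gt.
by move=> k; split; [exact: measurable_cube | exact: leb_cube_lty].
Qed.

HB.instance Definition _ n :=
  @Measure_isSigmaFinite.Build _ _ _ (leb n) (sigma_finite_leb n).

Lemma ler_coord n (x : 'rV[R]_n) i : `|x ord0 i| <= `|x|.
Proof.
rewrite [leRHS]/Num.norm/= mx_normrE.
by apply: le_trans (le_bigmax _ _ (ord0, i)).
Qed.

Lemma rV_consE0 n (x : 'rV[R]_n) t : rV_cons (x, t) ord0 ord0 = t.
Proof.
rewrite /rV_cons (_ : (ord0 : 'I_n.+1) = lshift n (ord0 : 'I_1)); last exact: val_inj.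
by rewrite (@row_mxEl _ 1 1 n) mxE eqxx mulr1n.
Qed.

Lemma rV_consE n (x : 'rV[R]_n) t i : rV_cons (x, t) ord0 (lift ord0 i) = x ord0 i.
Proof.
rewrite /rV_cons (_ : lift ord0 i = rshift 1 i); last exact: val_inj.
by rewrite (@row_mxEr _ 1 1 n).
Qed.

Definition setc n (x : 'rV[R]_n) (i : 'I_n) (t : R) : 'rV[R]_n :=
  \row_j if j == i then t else x ord0 j.

(** A class of integrable functions that is stable under fixing the coordinate split off by
    [rV_cons], as inductions on the dimension require. *)
Definition bsupp n (F : 'rV[R]_n -> R) (c M : R) :=
  [/\ measurable_fun setT F, forall x : 'rV[R]_n, `|F x| <= M &
    forall (x : 'rV[R]_n) i, c < `|x ord0 i| -> F x = 0].

Lemma bsupp_integrable n (F : 'rV[R]_n -> R) c M : bsupp F c M ->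
  (leb n).-integrable setT (EFin \o F).
Proof.
move=> [mF FM Fc]; have M0 : 0 <= M by apply: le_trans (FM 0).
apply/integrableP; split; first exact/measurable_EFinP.
apply: (@le_lt_trans _ _ (\int[leb n]_(x in cube c) (cst M%:E x))%E).
  rewrite -[X in (X <= _)%E](_ : (\int[leb n]_(x in cube c) `|(F x)%:E| = _)%E).
    apply: ge0_le_integral => //; first exact: measurable_cube.
    - by apply: measurable_funTS; apply/measurable_EFinP; exact: measurableT_comp.
    - by move=> x _; rewrite lee_fin.
  rewrite integral_mkcond; apply: eq_integral => x _; rewrite patchE.
  case: ifPn => // /negP xc; rewrite /= (_ : F x = 0) ?normr0//.
  apply: contrapT => Fx; apply: xc; rewrite inE => i /=.
  rewrite in_itv/= -ler_norml leNgt; apply/negP => /(Fc x i).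
  exact: Fx.
rewrite integral_cst//; last exact: measurable_cube.
by rewrite lte_mul_pinfty// ?lee_fin//; exact: leb_cube_lty.
Qed.

Lemma leb_S n :
  leb n.+1 = pushforward (leb n \x @lebesgue_measure R)%E (@rV_cons R n).
Proof. by []. Qed.

Lemma ge0_integral_leb_S n (f : 'rV[R]_n.+1 -> \bar R) :
  measurable_fun setT f -> (forall x, 0 <= f x)%E ->
  (\int[leb n.+1]_x f x =
   \int[leb n \x @lebesgue_measure R]_z f (rV_cons z))%E.
Proof.
move=> mf f0; rewrite leb_S ge0_integral_pushforward//.
exact: measurable_rV_cons.
Qed.

Lemma integrable_leb_S n (f : 'rV[R]_n.+1 -> \bar R) :
  (leb n.+1).-integrable setT f ->
  (leb n \x @lebesgue_measure R)%E.-integrable setT (f \o @rV_cons R n).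
Proof.
move=> /integrableP[mf intf]; apply/integrableP; split.
  by apply: measurableT_comp => //; exact: measurable_rV_cons.
by move: intf; rewrite ge0_integral_leb_S//; exact: measurableT_comp.
Qed.

Lemma integral_leb_S n (f : 'rV[R]_n.+1 -> \bar R) :
  (leb n.+1).-integrable setT f ->
  (\int[leb n.+1]_x f x =
   \int[leb n \x @lebesgue_measure R]_z f (rV_cons z))%E.
Proof.
move=> intf; rewrite leb_S integral_pushforward//.
- exact: measurable_rV_cons.
- exact: measurable_int intf.
- exact: integrable_leb_S.
Qed.

Lemma bsupp_slice n (F : 'rV[R]_n.+1 -> R) c M t :
  bsupp F c M -> bsupp (fun x : 'rV[R]_n => F (rV_cons (x, t))) c M.
Proof.
move=> [mF FM Fc]; split => [|x|x i cx].
- apply: (measurableT_comp mF).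
  by apply: measurableT_comp; [exact: measurable_rV_cons|exact: measurable_pair2].
- exact: FM.
- by apply: (Fc _ (lift ord0 i)); rewrite rV_consE.
Qed.

Lemma setc_lift n (x : 'rV[R]_n) t i s :
  setc (rV_cons (x, t)) (lift ord0 i) s = rV_cons (setc x i s, t).
Proof.
apply/rowP => j; rewrite mxE; case: (unliftP ord0 j) => [k|] ->.
  by rewrite !rV_consE mxE (inj_eq lift_inj).
by rewrite !rV_consE0 (negbTE (neq_lift _ _)).
Qed.

Lemma setc_ord0 n (x : 'rV[R]_n) t s :
  setc (rV_cons (x, t)) ord0 s = rV_cons (x, s).
Proof.
apply/rowP => j; rewrite mxE; case: (unliftP ord0 j) => [k|] ->.
  by rewrite !rV_consE eq_sym (negbTE (neq_lift _ _)).
by rewrite eqxx rV_consE0.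
Qed.

(** Fubini in direction i. The measure splits off coordinate 0 only, so the induction peels
    coordinates until i is the one that is split off. *)
Lemma integral_slices0 n (i : 'I_n) (F : 'rV[R]_n -> R) c M : bsupp F c M ->
  (forall x, \int[@lebesgue_measure R]_t (F (setc x i t))%:E = 0)%E ->
  (\int[leb n]_x (F x)%:E = 0)%E.
Proof.
elim: n i F => [[]//|n IH] i F bF h.
have iF := integrable_leb_S (bsupp_integrable bF).
rewrite (integral_leb_S (bsupp_integrable bF)).
case: (unliftP ord0 i) h => [j|] -> h.
  rewrite -(integral21_prod_meas1 iF) integral0_eq// => t _.
  apply: (IH j); first exact: bsupp_slice bF.
  by move=> x; rewrite -[RHS](h (rV_cons (x, t))); under [RHS]eq_integral do
    rewrite setc_lift.
rewrite -(integral12_prod_meas1 iF) integral0_eq// => x _.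
by rewrite -[RHS](h (rV_cons (x, 0))); under [RHS]eq_integral do
  rewrite setc_ord0.
Qed.

Lemma integral_deriv (g g' : R -> R) (a b : R) : a < b ->
  (forall t, a <= t <= b -> is_derive t 1 g (g' t)) ->
  (forall t, a <= t <= b -> {for t, continuous g'}) ->
  (\int[@lebesgue_measure R]_(t in `]a, b[) (g' t)%:E = (g b - g a)%:E)%E.
Proof.
move=> ab dg cg.
have cg' : {within `[a, b], continuous g'}.
  apply: continuous_in_subspaceT => t; rewrite inE/= in_itv/=; exact: cg.
have cgt t : a <= t <= b -> {for t, continuous g}.
  move=> /dg[+ _] => /derivable1_diffP; exact: differentiable_continuous.
rewrite -(@integral_itv_bndoo _ _ _ _ true false).
  rewrite (@continuous_FTC2 _ g' g)//.
    split=> [t||]; rewrite ?in_itv/=.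
    - by case/andP => at_ tb; have [] := dg t _; rewrite ?(ltW at_) ?ltW.
    - by apply/cvg_at_right_filter/cgt; rewrite lexx ltW.
    - by apply/cvg_at_left_filter/cgt; rewrite lexx ltW.
  move=> t; rewrite in_itv/= => /andP[at_ tb]; rewrite derive1E.
  have dgt : is_derive t 1 g (g' t) by apply: dg; rewrite !ltW.
  by rewrite derive_val.
apply/measurable_EFinP; apply: (@measurable_funS _ _ _ _ `[a, b]%classic) => //.
  by move=> t /=; rewrite !in_itv/= => /andP[/ltW -> /ltW ->].
exact: subspace_continuous_measurable_fun.
Qed.

End measure_rV.
Arguments leb {R} n _.

(** * Differential calculus on row vectors *)

Section calculus.
Context {R : realType}.

Section rules.
Context {V : normedModType R}.
Implicit Types (f g : V -> R) (x v : V).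

Lemma is_derive_add f g x v a b : is_derive x v f a -> is_derive x v g b ->
  is_derive x v (fun y => f y + g y) (a + b).
Proof. exact: is_deriveD. Qed.

Lemma is_derive_opp f x v a : is_derive x v f a ->
  is_derive x v (fun y => - f y) (- a).
Proof. exact: is_deriveN. Qed.

Lemma is_derive_mul f g x v a b : is_derive x v f a -> is_derive x v g b ->
  is_derive x v (fun y => f y * g y) (a * g x + f x * b).
Proof.
move=> fa gb; apply: (is_derive_eq (is_deriveM fa gb)).
by rewrite addrC [a * _]mulrC.
Qed.

Lemma is_derive_scale (k : R) f x v a : is_derive x v f a ->
  is_derive x v (fun y => k * f y) (k * a).
Proof. exact: is_deriveZ. Qed.

Lemma is_derive_bigsum (I : Type) (r : seq I) (f : I -> V -> R) x v (a : I -> R) :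
  (forall i, is_derive x v (f i) (a i)) ->
  is_derive x v (fun y => \sum_(i <- r) f i y) (\sum_(i <- r) a i).
Proof.
move=> h; elim: r => [|i r IH].
  rewrite big_nil (_ : (fun y => _) = cst 0); first exact: is_derive_cst.
  by apply/funext => y; rewrite big_nil.
rewrite big_cons (_ : (fun y => _) = (fun y => f i y + \sum_(j <- r) f j y)).
  exact: is_derive_add.
by apply/funext => y; rewrite big_cons.
Qed.

(** The bridge to calculus in one variable: chain rule, mean value theorem and fundamental theorem
    are all applied to restrictions to a line, at an arbitrary parameter s. *)
Lemma derivable_line f x v (y : V) (s : R) : x = y + s *: v ->
  forall d, is_derive x v f d <->
    is_derive s 1 (fun t : R => f (y + t *: v)) d.
Proof.
move=> -> d.
have E : (fun h : R => h^-1 *: (((fun t : R => f (y + t *: v)) \o shift s) (h *: 1)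
                    - f (y + s *: v)))
    = (fun h : R => h^-1 *: ((f \o shift (y + s *: v)) (h *: v)
                    - f (y + s *: v))).
  apply/funext => h /=; congr (_ *: (f _ - _)).
  by rewrite /shift/= scalerDl addrCA [h *: 1]mulr1.
split=> -[df dE]; split.
- by rewrite /derivable E.
- by rewrite -dE /derive E.
- by rewrite /derivable -E.
- by rewrite -dE /derive -E.
Qed.

Lemma is_derive_comp1 (h : R -> R) f x v a b :
  is_derive (f x) 1 h a -> is_derive x v f b ->
  is_derive x v (fun y => h (f y)) (a * b).
Proof.
move=> ha fb; have x0 : x = x + 0 *: v by rewrite scale0r addr0.
apply/(derivable_line (fun y => h (f y)) x0).
apply: (is_derive1_comp (f := h)); first by rewrite /= -x0.
exact/(derivable_line f x0).
Qed.

Lemma continuous_bigsum (I : Type) (r : seq I) (f : I -> V -> R) x :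
  (forall i, {for x, continuous (f i)}) ->
  {for x, continuous (fun y => \sum_(i <- r) f i y)}.
Proof.
move=> h; elim: r => [|i r IH].
  rewrite (_ : (fun y => _) = cst 0); first exact: cst_continuous.
  by apply/funext => y; rewrite big_nil.
rewrite (_ : (fun y => _) = (fun y => f i y + \sum_(j <- r) f j y)).
  exact: continuousD.
by apply/funext => y; rewrite big_cons.
Qed.

End rules.

Lemma is_derive_continuous1 (g : R -> R) (t d : R) : is_derive t 1 g d ->
  {for t, continuous g}.
Proof.
by move=> [+ _] => /derivable1_diffP; exact: differentiable_continuous.
Qed.

Lemma mvt_bound (g g' : R -> R) (t m e : R) : 0 <= t ->
  (forall s, 0 <= s <= t -> is_derive s 1 g (g' s)) ->
  (forall s, 0 <= s <= t -> `|g' s - m| <= e) ->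
  `|g t - g 0 - t * m| <= e * t.
Proof.
move=> t0 dg ge.
have [||c cI] := @MVT_segment R g g' 0 t t0.
- move=> s; rewrite in_itv/= => /andP[s0 st]; apply: dg; rewrite !ltW//.
- apply: continuous_in_subspaceT => s; rewrite inE/= in_itv/= => st.
  exact: is_derive_continuous1 (dg _ st).
rewrite subr0 => ->; rewrite mulrC -mulrBr normrM (ger0_norm t0) mulrC.
by rewrite ler_wpM2r// ge//; move: cI; rewrite in_itv.
Qed.

Context {n : nat}.
Implicit Types (x y v : 'rV[R]_n).

Local Notation e_ i := (delta_mx ord0 i : 'rV[R]_n).

Lemma enorm_ge0 x : 0 <= enorm x. Proof. exact: sqrtr_ge0. Qed.

Lemma sumsq_ge0 x : 0 <= \sum_(i < n) x ord0 i ^+ 2.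
Proof. by apply: sumr_ge0 => i _; rewrite sqr_ge0. Qed.

Lemma enorm_sqr x : enorm x ^+ 2 = \sum_(i < n) x ord0 i ^+ 2.
Proof. by rewrite sqr_sqrtr// sumsq_ge0. Qed.

Lemma ler_coord_enorm x i : `|x ord0 i| <= enorm x.
Proof.
rewrite -sqrtr_sqr ler_sqrt// ?sumsq_ge0// (bigD1 i)//= lerDl.
by apply: sumr_ge0 => j _; rewrite sqr_ge0.
Qed.

Lemma ler_norm_enorm x : `|x| <= enorm x.
Proof.
rewrite [leLHS]/Num.norm/= mx_normrE; apply: bigmax_le; first exact: enorm_ge0.
by move=> [i j] _ /=; rewrite (ord1 i); exact: ler_coord_enorm.
Qed.

Lemma enormZ (s : R) x : enorm (s *: x) = `|s| * enorm x.
Proof.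
rewrite /enorm -sqrtr_sqr -sqrtrM ?sqr_ge0// mulr_sumr; congr Num.sqrt.
by apply: eq_bigr => i _; rewrite mxE exprMn.
Qed.

Lemma enorm0 : enorm (0 : 'rV[R]_n) = 0.
Proof. by rewrite /enorm big1 ?sqrtr0// => i _; rewrite mxE expr0n. Qed.

Lemma enorm_eq0 x : enorm x = 0 -> x = 0.
Proof.
move=> x0; apply/rowP => i; rewrite mxE; apply/eqP; rewrite -normr_le0 -x0.
exact: ler_coord_enorm.
Qed.

Lemma continuous_coord i x : {for x, continuous (fun y => y ord0 i)}.
Proof. exact: coord_continuous. Qed.

Lemma continuous_sumsq x :
  {for x, continuous (fun y => \sum_(i < n) y ord0 i ^+ 2)}.
Proof.
apply: continuous_bigsum => i.
by apply: (@continuous_comp _ _ _ (fun y : 'rV[R]_n => y ord0 i) (fun t => t ^+ 2));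
  [exact: continuous_coord|exact: exprn_continuous].
Qed.

Lemma continuous_enorm : continuous (@enorm R n).
Proof.
move=> x; apply: (continuous_comp (f := fun y => \sum_(i < n) y ord0 i ^+ 2)).
  exact: continuous_sumsq.
exact: sqrt_continuous.
Qed.

Definition eball (c : R) : set 'rV[R]_n := [set x | enorm x < c].

Lemma open_eball c : open (eball c).
Proof.
rewrite (_ : eball c = @enorm R n @^-1` `]-oo, c[%classic).
  by apply: open_comp => [x _|]; [exact: continuous_enorm|exact: interval_open].
by apply/seteqP; split => x; rewrite /= in_itv.
Qed.

Lemma measurable_eball c : measurable (eball c).
Proof. by apply: open_measurable_rV; exact: open_eball. Qed.

Lemma compact_cball c : compact [set x : 'rV[R]_n | enorm x <= c].
Proof.
apply: bounded_closed_compact.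
  exists c; split; first exact: num_real.
  by move=> k ck x /= xc; apply: le_trans (ler_norm_enorm x) _; lra.
rewrite (_ : mkset _ = @enorm R n @^-1` `]-oo, c]%classic).
  apply: closed_comp => [x _|]; first exact: continuous_enorm.
  exact: interval_closed.
by apply/seteqP; split => x; rewrite /= in_itv.
Qed.

Lemma norm_delta i : `|e_ i| = 1.
Proof.
apply/eqP; rewrite eq_le; apply/andP; split.
  rewrite [leLHS]/Num.norm/= mx_normrE; apply: bigmax_le => // -[k j] _ /=.
  by rewrite mxE; case: (_ && _); rewrite ?normr1 ?normr0.
by rewrite -[leLHS]normr1 (_ : 1 = e_ i ord0 i) ?ler_coord// mxE !eqxx.
Qed.

Lemma is_derive_coord i v x : is_derive x v (fun y => y ord0 i) (v ord0 i).
Proof.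
have x0 : x = x + 0 *: v by rewrite scale0r addr0.
apply/(derivable_line _ x0).
rewrite (_ : (fun t => _) = (fun t : R => x ord0 i + v ord0 i * t)).
  rewrite -[X in is_derive _ _ _ X]add0r; apply: is_derive_add.
  rewrite -[X in is_derive _ _ _ X]mulr1; apply: is_derive_scale.
by apply/funext => t; rewrite !mxE mulrC.
Qed.

Section C1.
Variables (Om : set 'rV[R]_n) (H : 'rV[R]_n -> R) (DH : 'I_n -> 'rV[R]_n -> R).
Hypothesis oOm : open Om.
Hypothesis dH : forall i x, Om x -> is_derive x (e_ i) H (DH i x).
Hypothesis cDH : forall i x, Om x -> {for x, continuous (DH i)}.

(** Mean value theorem along one axis. The doubled |t| pays for negative t: the step is then taken
    from y + t e_i back to y, and its starting point may be farther from x by |t|. *)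
Lemma C1_step x (e d : R) : (forall y, `|x - y| < d -> Om y) ->
  (forall i y, `|x - y| < d -> `|DH i y - DH i x| <= e) ->
  forall i y t, `|x - y| + `|t| *+ 2 < d ->
  `|H (y + t *: e_ i) - H y - t * DH i x| <= e * `|t|.
Proof.
move=> dOm de i.
have pos y t : 0 <= t -> `|x - y| + `|t| < d ->
    `|H (y + t *: e_ i) - H y - t * DH i x| <= e * `|t|.
  move=> t0; rewrite (ger0_norm t0) => yt.
  have yin s : 0 <= s <= t -> `|x - (y + s *: e_ i)| < d.
    move=> /andP[s0 st]; rewrite opprD addrA.
    apply: le_lt_trans (ler_normB _ _) _.
    by rewrite normrZ norm_delta mulr1 (ger0_norm s0); lra.
  have := @mvt_bound (fun s => H (y + s *: e_ i)) (fun s => DH i (y + s *: e_ i))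
    t (DH i x) e t0.
  rewrite /= scale0r addr0; apply => s sI.
    by apply/(derivable_line H erefl); apply/dH/dOm/yin.
  exact/de/yin.
move=> y t yt; have n0 := normr_ge0 t.
have [t0|t0] := leP 0 t; first by apply: pos => //; lra.
have := pos (y + t *: e_ i) (- t); rewrite scaleNr addrK normrN.
have -> : `|H y - H (y + t *: e_ i) - - t * DH i x| =
    `|H (y + t *: e_ i) - H y - t * DH i x|.
  by rewrite -[LHS]normrN; congr `|_|; ring.
apply; first lra.
have : `|x - (y + t *: e_ i)| <= `|x - y| + `|t|.
  rewrite opprD addrA; apply: le_trans (ler_normB _ _) _.
  by rewrite normrZ norm_delta mulr1.
lra.
Qed.

Lemma C1_seq x (e d : R) : (forall y, `|x - y| < d -> Om y) ->
  (forall i y, `|x - y| < d -> `|DH i y - DH i x| <= e) ->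
  forall (w : 'I_n -> R) (r : seq 'I_n) y,
  `|x - y| + (\sum_(i <- r) `|w i|) *+ 2 < d ->
  `|H (y + \sum_(i <- r) w i *: e_ i) - H y - \sum_(i <- r) w i * DH i x|
    <= e * \sum_(i <- r) `|w i|.
Proof.
move=> dOm de w; elim=> [|i r IH] y.
  by rewrite !big_nil addr0 subrr subr0 normr0 mulr0.
rewrite !big_cons => yd.
have s0 : 0 <= \sum_(j <- r) `|w j| by apply: sumr_ge0.
have n0 := normr_ge0 (w i).
have h1 : `|H (y + w i *: e_ i) - H y - w i * DH i x| <= e * `|w i|.
  by apply: (C1_step dOm de); lra.
have : `|x - (y + w i *: e_ i)| <= `|x - y| + `|w i|.
  rewrite opprD addrA; apply: le_trans (ler_normB _ _) _.
  by rewrite normrZ norm_delta mulr1.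
move=> h2; have h3 := IH (y + w i *: e_ i) ltac:(lra).
rewrite addrA.
set A := H _ in h3 *; set B := H (y + _) in h1 h3 *.
rewrite (_ : A - H y - _ = (A - B - \sum_(j <- r) w j * DH j x) +
   (B - H y - w i * DH i x)); last by ring.
by apply: le_trans (ler_normD _ _) _; rewrite mulrDr addrC lerD.
Qed.

(** The displacement h v is made one axis at a time, each step being controlled by continuity of the
    partials. It serves to differentiate along rays, whereas the hypotheses know coordinate
    directions only. *)
Lemma is_derive_C1 x v : Om x ->
  is_derive x v H (\sum_(i < n) v ord0 i * DH i x).
Proof.
move=> Omx; set L := \sum_(i < n) _.
suff cvgL : h^-1 *: ((H \o shift x) (h *: v) - H x) @[h --> 0^'] --> L.
  by split; [apply: cvgP cvgL|exact: cvg_lim cvgL].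
apply/cvgrPdist_le => /= e e0.
(* The summand 1 keeps e / S positive when v = 0. *)
pose S := 1 + \sum_(i < n) `|v ord0 i|.
have S1 : 1 <= S by rewrite lerDl; apply: sumr_ge0.
have eS : 0 < e / S by rewrite divr_gt0//; lra.
have [d d0 dP] : exists2 d, 0 < d & forall y, `|x - y| < d ->
    Om y /\ forall i, `|DH i y - DH i x| <= e / S.
  have : \forall y \near x, Om y /\ forall i, `|DH i y - DH i x| <= e / S.
    apply: filterI; first exact: open_nbhs_nbhs.
    apply: (@filter_forall _ 'I_n (fun i y => `|DH i y - DH i x| <= e / S) (nbhs x) _) => i.
    by have /cvgrPdist_le/(_ _ eS) := @cDH i x Omx; under eq_near do rewrite distrC.
  move=> /nbhs_ballP[d /= d0 h]; exists d => // y xy.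
  by apply: h; rewrite mx_norm_ball.
near=> h.
have h0 : h != 0 by near: h; exact: nbhs_dnbhs_neq.
have hd : `|h| * (S *+ 2) < d.
  rewrite -ltr_pdivlMr; last lra.
  near: h; apply: dnbhs0_lt; rewrite divr_gt0//; lra.
have := C1_seq (e := e / S) (d := d) (fun y h => (dP y h).1)
  (fun i y h => (dP y h).2 i) (w := fun i => h * v ord0 i) (r := index_enum 'I_n)
  (y := x).
rewrite subrr normr0 add0r.
have -> : \sum_(i < n) `|h * v ord0 i| = `|h| * (S - 1).
  rewrite /S [1 + _]addrC addrK mulr_sumr; apply: eq_bigr => i _.
  by rewrite normrM.
have -> : \sum_(i < n) (h * v ord0 i) *: e_ i = h *: v.
  rewrite [v in RHS]row_sum_delta scaler_sumr; apply: eq_bigr => i _.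
  by rewrite scalerA.
have -> : \sum_(i < n) h * v ord0 i * DH i x = h * L.
  by rewrite /L mulr_sumr; apply: eq_bigr => i _; rewrite mulrA.
have hn : 0 < `|h| by rewrite normr_gt0.
move=> /(_ _)/wrap[].
  by apply: le_lt_trans hd; rewrite -mulrnAr ler_wpM2l//; lra.
rewrite /shift/= [x + _]addrC => le1.
rewrite distrC (_ : h^-1 *: _ - L = h^-1 * (H (h *: v + x) - H x - h * L)).
  rewrite normrM normfV ler_pdivrMl//; apply: le_trans le1 _.
  rewrite mulrCA ler_pM2l// -mulrA ler_piMr//; first exact: ltW.
  by rewrite mulrC ler_pdivrMr; lra.
by rewrite mulrBr mulrA mulVf// mul1r.
Unshelve. all: by end_near. Qed.

End C1.
End calculus.
Arguments eball {R} n _.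

(** * Smooth functions with nonnegative Laplacian *)

Section smv.
Context {R : realType}.

Lemma bsupp_ball n (g : 'rV[R]_n -> R) c : 0 <= c ->
  (forall x, enorm x <= c -> {for x, continuous g}) ->
  exists M, bsupp (fun x => if enorm x < c then g x else 0) c M.
Proof.
move=> c0 cg.
have [M gM] : exists M, forall x, enorm x <= c -> `|g x| <= M.
  have [|||z _ zP] := @compact_EVT_max _ R (fun x => `|g x|)
     [set x : 'rV[R]_n | enorm x <= c].
  - by exists 0; rewrite /= enorm0.
  - exact: compact_cball.
  - apply: continuous_in_subspaceT => x; rewrite inE/= => xc.
    by apply: (continuous_comp (f := g)); [exact: cg|exact: norm_continuous].
  by exists `|g z| => x xc; apply: zP; rewrite inE.
exists M; split.
- rewrite (_ : (fun x => _) = g \_ (eball n c)).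
    apply/(measurable_restrictT _ (measurable_eball c)).
    apply: continuous_open_measurable_rV; first exact: open_eball.
    by move=> x xc; apply: cg; exact: ltW.
  apply/funext => x; rewrite patchE; case: ifPn => h; first by rewrite mem_set.
  by rewrite memNset// => h'; rewrite h' in h.
- move=> x; case: ifPn => [/ltW|_]; first exact: gM.
  by rewrite normr0; apply: le_trans (gM 0 _); rewrite ?enorm0.
- move=> x i cx; case: ifPn => // xc; exfalso.
  by have := ler_coord_enorm x i; lra.
Qed.

Lemma bsuppD n (f g : 'rV[R]_n -> R) c M N : bsupp f c M -> bsupp g c N ->
  bsupp (fun x => f x + g x) c (M + N).
Proof.
move=> [mf fM fc] [mg gN gc]; split.
- exact: measurable_funD.
- by move=> x; apply: le_trans (ler_normD _ _) _; apply: lerD.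
- by move=> x i cx; rewrite (fc _ _ cx) (gc _ _ cx) addr0.
Qed.

Lemma bsuppZ n (f : 'rV[R]_n -> R) c M k : bsupp f c M ->
  bsupp (fun x => k * f x) c (`|k| * M).
Proof.
move=> [mf fM fc]; split.
- exact: measurable_funM.
- by move=> x; rewrite normrM ler_wpM2l.
- by move=> x i cx; rewrite (fc _ _ cx) mulr0.
Qed.

Lemma bsupp_sum (I : Type) (r : seq I) n (f : I -> 'rV[R]_n -> R) c :
  (forall i, exists M, bsupp (f i) c M) ->
  exists M, bsupp (fun x => \sum_(i <- r) f i x) c M.
Proof.
move=> h; elim: r => [|i r [N IH]].
  exists 0; rewrite (_ : (fun x => _) = cst 0); last first.
    by apply/funext => x; rewrite big_nil.
  by split => //= x; rewrite normr0.
have [M fM] := h i; exists (M + N).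
rewrite (_ : (fun x => _) = (fun x => f i x + \sum_(j <- r) f j x)).
  exact: bsuppD.
by apply/funext => x; rewrite big_cons.
Qed.

Lemma integral_bsupp_sum (I : Type) (r : seq I) n (f : I -> 'rV[R]_n -> R) c :
  (forall i, exists M, bsupp (f i) c M) ->
  (\int[leb n]_x (\sum_(i <- r) f i x)%:E =
   \sum_(i <- r) \int[leb n]_x (f i x)%:E)%E.
Proof.
move=> h; elim: r => [|i r IH].
  by rewrite big_nil; under eq_integral do rewrite big_nil; rewrite integral0.
rewrite big_cons -IH.
under eq_integral do rewrite big_cons EFinD.
have [M fM] := h i; have [N sN] := bsupp_sum r h.
rewrite integralD//; first exact: bsupp_integrable fM.
exact: bsupp_integrable sN.
Qed.

Lemma sumsq_setc n (x : 'rV[R]_n) i t :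
  \sum_(j < n) setc x i t ord0 j ^+ 2 = t ^+ 2 + \sum_(j < n | j != i) x ord0 j ^+ 2.
Proof.
rewrite (bigD1 i)//= mxE eqxx; congr (_ + _).
by apply: eq_bigr => j ji; rewrite mxE (negbTE ji).
Qed.

Lemma enorm_lt n (x : 'rV[R]_n) c : 0 <= c ->
  (enorm x < c) = (\sum_(i < n) x ord0 i ^+ 2 < c ^+ 2).
Proof. by move=> c0; rewrite -enorm_sqr ltr_sqr// nnegrE ?enorm_ge0. Qed.

Lemma enorm_le n (x : 'rV[R]_n) c : 0 <= c ->
  (enorm x <= c) = (\sum_(i < n) x ord0 i ^+ 2 <= c ^+ 2).
Proof. by move=> c0; rewrite -enorm_sqr ler_sqr// nnegrE ?enorm_ge0. Qed.

Lemma setcE n (x : 'rV[R]_n) i t :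
  setc x i t = setc x i 0 + t *: delta_mx ord0 i.
Proof.
apply/rowP => j; rewrite !mxE eqxx/=; case: eqP => _ /=.
  by rewrite mulr1 add0r.
by rewrite mulr0 addr0.
Qed.

Lemma continuous_setc n (x : 'rV[R]_n) i (f : 'rV[R]_n -> R) t :
  {for setc x i t, continuous f} -> {for t, continuous (fun t => f (setc x i t))}.
Proof.
move=> cf; apply: (@continuous_comp _ _ _ (fun t => setc x i t) f) => //.
rewrite (_ : setc x i = fun t => setc x i 0 + t *: delta_mx ord0 i).
  apply: cvgD; first exact: cvg_cst.
  by apply: cvgZr_tmp; exact: cvg_id.
by apply/funext => s; rewrite setcE.
Qed.

Lemma is_derive_setc n (x : 'rV[R]_n) i (f : 'rV[R]_n -> R) t d :
  is_derive (setc x i t) (delta_mx ord0 i) f d ->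
  is_derive t 1 (fun t => f (setc x i t)) d.
Proof.
move=> df; rewrite (_ : (fun t => _) = (fun t => f (setc x i 0 + t *: delta_mx ord0 i))).
  exact/(derivable_line f (setcE _ _ _)).
by apply/funext => s; rewrite -setcE.
Qed.

(* The integral over each chord of the ball vanishes by the fundamental theorem
   of calculus. *)
Lemma integral_ball_partial0 n (i : 'I_n) (g g' : 'rV[R]_n -> R) c : 0 < c ->
  (forall x, enorm x <= c -> is_derive x (delta_mx ord0 i) g (g' x)) ->
  (forall x, enorm x <= c -> {for x, continuous g'}) ->
  (forall x, enorm x = c -> g x = 0) ->
  (\int[leb n]_x (if enorm x < c then g' x else 0)%:E = 0)%E.
Proof.
move=> c0 dg cg g0.
have [M bF] := bsupp_ball (ltW c0) cg.
apply: (integral_slices0 (i := i) bF) => x.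
pose m := \sum_(j < n | j != i) x ord0 j ^+ 2.
have m0 : 0 <= m by apply: sumr_ge0 => j _; rewrite sqr_ge0.
have [mc|cm] := ltP m (c ^+ 2); last first.
  have out t : (enorm (setc x i t) < c) = false.
    rewrite enorm_lt ?ltW// sumsq_setc -/m; apply/negbTE; rewrite -leNgt.
    by have := sqr_ge0 t; lra.
  by rewrite integral0_eq// => t _; rewrite out.
pose l := Num.sqrt (c ^+ 2 - m).
have l0 : 0 < l by rewrite sqrtr_gt0; lra.
have l2 : l ^+ 2 = c ^+ 2 - m by rewrite sqr_sqrtr; lra.
have inI t : (enorm (setc x i t) < c) = (t \in `]- l, l[%R).
  rewrite enorm_lt ?ltW// sumsq_setc -/m in_itv/= -ltr_norml.
  by rewrite -ltrBrDr -l2 -[t ^+ 2]real_normK ?num_real// ltr_sqr ?nnegrE// ltW.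
have inC t : (- l <= t <= l) -> enorm (setc x i t) <= c.
  rewrite (enorm_le _ (ltW c0)) sumsq_setc -/m -ler_norml => tl.
  by rewrite -lerBrDr -l2 -[t ^+ 2]real_normK ?num_real// ler_sqr ?nnegrE// ltW.
have onS t : t ^+ 2 = l ^+ 2 -> g (setc x i t) = 0.
  move=> tl; apply: g0; rewrite /enorm sumsq_setc -/m tl l2 subrK.
  by rewrite sqrtr_sqr ger0_norm// ltW.
transitivity (\int[lebesgue_measure]_(t in `](- l)%R, l%R[) (g' (setc x i t))%:E)%E.
  rewrite [RHS]integral_mkcond; apply: eq_integral => t _.
  by rewrite patchE inI mem_setE; case: ifP.
rewrite -[RHS](_ : (g (setc x i l) - g (setc x i (- l)))%:E = 0%E); last first.
  by rewrite !onS ?sqrrN// subrr.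
apply: (@integral_deriv _ (fun t => g (setc x i t))) => [|t /inC tc|t /inC tc].
- lra.
- by apply: is_derive_setc; exact: dg.
- by apply: continuous_setc; exact: cg.
Qed.

Lemma is_derive_scale_arg n (f : 'rV[R]_n -> R) (s : R) x v (d : R) :
  is_derive (s *: x) v f d -> is_derive x v (fun y => f (s *: y)) (s * d).
Proof.
move=> df; have x0 : x = x + 0 *: v by rewrite scale0r addr0.
apply/(derivable_line (fun y => f (s *: y)) x0).
rewrite (_ : (fun t => _) = (fun u => f (s *: x + u *: v)) \o (fun t => s * t)).
  rewrite mulrC; apply: is_derive1_comp.
    by apply/(derivable_line f _) => //; rewrite mulr0 scale0r addr0.
  by rewrite -[X in is_derive _ _ _ X]mulr1; exact: is_derive_scale.
by apply/funext => t /=; rewrite scalerDr scalerA.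
Qed.

Lemma continuous_scale_arg n (f : 'rV[R]_n -> R) (s : R) x :
  {for s *: x, continuous f} ->
  {for x, continuous (fun y : 'rV[R]_n => f (s *: y))}.
Proof.
move=> cf.
apply: (@cvg_comp _ _ _ (fun y : 'rV[R]_n => s *: y) f (nbhs x) (nbhs (s *: x))).
  exact: scaler_continuous.
exact: cf.
Qed.

Lemma is_derive_sumsq n (x : 'rV[R]_n) i :
  is_derive x (delta_mx ord0 i) (fun y => \sum_(j < n) y ord0 j ^+ 2)
    (2 * x ord0 i).
Proof.
have h : is_derive x (delta_mx ord0 i : 'rV[R]_n)
    (fun y => \sum_(j < n) y ord0 j ^+ 2) (\sum_(j < n)
    ((delta_mx ord0 i : 'rV[R]_n) ord0 j * x ord0 j +
     x ord0 j * (delta_mx ord0 i : 'rV[R]_n) ord0 j)).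
  apply: is_derive_bigsum => j.
  by apply: is_derive_mul; exact: is_derive_coord.
apply: (is_derive_eq h).
rewrite (bigD1 i)//= big1 ?addr0 => [|j ji].
  by rewrite mxE !eqxx mul1r mulr1 mulrDl mul1r.
by rewrite mxE (negbTE ji) mul0r mulr0 addr0.
Qed.

(* Only the second derivatives entering the Laplacian are recorded. *)
Definition C2 n (Om : set 'rV[R]_n) (H : 'rV[R]_n -> R)
    (DH D2H : 'I_n -> 'rV[R]_n -> R) :=
  [/\ forall x, Om x -> {for x, continuous H},
      forall i x, Om x -> is_derive x (delta_mx ord0 i) H (DH i x),
      forall i x, Om x -> {for x, continuous (DH i)},
      forall i x, Om x -> is_derive x (delta_mx ord0 i) (DH i) (D2H i x) &
      forall i x, Om x -> {for x, continuous (D2H i)}].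

Section submean.
Variables (n : nat) (H : 'rV[R]_n -> R) (DH D2H : 'I_n -> 'rV[R]_n -> R).
Hypothesis C2H : C2 (eball n 1) H DH D2H.
Hypothesis lapH : forall x, eball n 1 x -> 0 <= \sum_i D2H i x.

(* Integrate the divergence of [(c^2 - |x|^2) grad H (s x)] over the ball of radius c. *)
Lemma integral_radial_ge0 c s : 0 < c -> 0 < s -> s * c < 1 ->
  (0 <= \int[leb n]_x
    (if enorm x < c then \sum_i x ord0 i * DH i (s *: x) else 0)%:E)%E.
Proof.
move=> c0 s0 sc1; have [cH dH cDH dDH cD2H] := C2H.
have inB x : enorm x <= c -> eball n 1 (s *: x).
  move=> xc; rewrite /eball/= enormZ gtr0_norm//.
  by apply: le_lt_trans sc1; rewrite ler_pM2l.
pose q (x : 'rV[R]_n) := c ^+ 2 - \sum_(j < n) x ord0 j ^+ 2.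
pose g i (x : 'rV[R]_n) := q x * DH i (s *: x).
pose g' i (x : 'rV[R]_n) := - (2 * x ord0 i) * DH i (s *: x) + q x * (s * D2H i (s *: x)).
have cq x : {for x, continuous q}.
  apply: continuousB; first exact: cst_continuous.
  exact: continuous_sumsq.
have cDHs i x : enorm x <= c -> {for x, continuous (fun x : 'rV[R]_n => DH i (s *: x))}.
  by move=> xc; apply: continuous_scale_arg; apply: cDH; exact: inB.
have cD2Hs i x : enorm x <= c -> {for x, continuous (fun x : 'rV[R]_n => D2H i (s *: x))}.
  by move=> xc; apply: continuous_scale_arg; apply: cD2H; exact: inB.
have cg' i x : enorm x <= c -> {for x, continuous (g' i)}.
  move=> xc; apply: continuousD; apply: continuousM; try exact: cq; try exact: cDHs.
    apply: continuousN; apply: continuousM; first exact: cst_continuous.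
    exact: continuous_coord.
  by apply: continuousM; [exact: cst_continuous|exact: cD2Hs].
have int0 i : (\int[leb n]_x (if enorm x < c then g' i x else 0)%:E = 0)%E.
  apply: (@integral_ball_partial0 _ i (g i)) => // x xc.
  - rewrite /g' -[X in X * DH _ _]add0r; apply: is_derive_mul.
      by apply: is_derive_add; apply: is_derive_opp; exact: is_derive_sumsq.
    by apply: is_derive_scale_arg; apply: dDH; exact: inB.
  - exact: cg'.
  - by rewrite /g /q -enorm_sqr xc subrr mul0r.
pose F i (x : 'rV[R]_n) := if enorm x < c then g' i x else 0.
have bF i : exists M, bsupp (F i) c M.
  by apply: bsupp_ball; [exact: ltW|exact: cg'].
pose A (x : 'rV[R]_n) := if enorm x < c then \sum_i x ord0 i * DH i (s *: x) else 0.
pose B (x : 'rV[R]_n) := if enorm x < c then q x * (s * \sum_i D2H i (s *: x)) else 0.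
have [MB bB] : exists M, bsupp B c M.
  apply: bsupp_ball; [exact: ltW|move=> x xc].
  apply: continuousM; first exact: cq.
  apply: continuousM; first exact: cst_continuous.
  by apply: continuous_bigsum => i; exact: cD2Hs.
have [MF bSF] := bsupp_sum (index_enum 'I_n) bF.
(* The divergence [\sum_i F i x] equals -2 x.grad H(s x) + q(x) s Lap H(s x) in the ball; this
   solves it for the radial term. Its integral vanishes, and what remains is nonnegative. *)
have AE x : A x = 2^-1 * B x + - 2^-1 * \sum_i F i x.
  rewrite /A /B /F; case: ifPn => _; last by rewrite big1// !mulr0 addr0.
  rewrite /g' big_split/= -[in X in _ + X]mulr_sumr -[in X in _ + X]mulr_sumr.
  under [X in _ * (X + _)]eq_bigr do rewrite mulNr -mulrA.
  rewrite sumrN -mulr_sumr.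
  by set a := \sum_(i < n) _ * _; set b := \sum_(i < n) _; lra.
have iB := bsupp_integrable (bsuppZ 2^-1 bB).
have iF := bsupp_integrable (bsuppZ (- 2^-1) bSF).
rewrite (_ : (\int[leb n]_x _ = \int[leb n]_x (A x)%:E)%E)//.
under eq_integral do rewrite AE EFinD.
rewrite integralD//.
under [X in (_ + X)%E]eq_integral do rewrite EFinM.
rewrite integralZl//; last exact: bsupp_integrable bSF.
rewrite (integral_bsupp_sum _ bF) big1 => [|i _]; last exact: int0.
rewrite mule0 adde0.
apply: integral_ge0 => x _; rewrite lee_fin mulr_ge0// /B.
case: ifPn => // xc; rewrite mulr_ge0//.
  by rewrite subr_ge0 -enorm_le ?ltW.
by rewrite mulr_ge0 ?(ltW s0)//; apply: lapH; apply: inB; exact: ltW.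
Qed.

(** For x != 0, H(r x/|x|) - H(0) is the integral of x.grad H(s x) over 0 < s < r/|x|. After
    exchanging the integrals, the x that occur for a given s fill the ball of radius min(1, r/s),
    where [integral_radial_ge0] applies. *)
Lemma submean_leb r : 0 < r < 1 ->
  (0 <= \int[leb n]_x
     (if enorm x < 1 then H (r *: radial_proj x) - H 0 else 0)%:E)%E.
Proof.
move=> /andP[r0 r1]; have [cH dH cDH dDH cD2H] := C2H.
(* Cutting the gradient off at |y| < r makes it bounded and measurable on the whole space, and the
   condition |s x| < r encodes the upper limit s < r/|x|. *)
pose G i (y : 'rV[R]_n) := if enorm y < r then DH i y else 0.
have bG i : exists M, bsupp (G i) r M.
  apply: bsupp_ball => [|x xr]; first exact: ltW.
  by apply: cDH; rewrite /eball/=; lra.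
pose K (z : 'rV[R]_n * R) := if (0 < z.2) && (enorm z.1 < 1) then
   \sum_i z.1 ord0 i * G i (z.2 *: z.1) else 0.
have mK : measurable_fun setT K.
  apply: measurable_fun_ifT => //.
    apply: measurable_and; apply: measurable_fun_ltr => //.
    by apply: measurableT_comp; [exact: measurable_enorm|exact: measurable_fst].
  apply: measurable_sum => i; apply: measurable_funM.
    by apply: (measurableT_comp (measurable_rV_coord i)); exact: measurable_fst.
  have [M [mG _ _]] := bG i; apply: (measurableT_comp mG).
  apply/measurable_fun_rVP => j; under eq_fun do rewrite mxE.
  apply: measurable_funM => //.
  by apply: (measurableT_comp (measurable_rV_coord j)); exact: measurable_fst.
have /choice[M bGM] := bG.
pose C := \sum_i M i.
have M0 i : 0 <= M i by have [_ h _] := bGM i; exact: le_trans (h 0).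
have C0 : 0 <= C by apply: sumr_ge0.
have KE x s : 0 < s -> enorm x < 1 -> 0 < enorm x ->
    K (x, s) = if s < r / enorm x then \sum_i x ord0 i * DH i (s *: x) else 0.
  move=> s0 x1 x0; rewrite /K/= s0 x1/= /G enormZ gtr0_norm// ltr_pdivlMr//.
  by case: ifPn => // _; rewrite big1// => i _; rewrite mulr0.
have K0 x s : enorm x = 0 -> K (x, s) = 0.
  move=> /enorm_eq0 ->; rewrite /K/=; case: ifP => // _.
  by rewrite big1// => i _; rewrite mxE mul0r.
have KS x s : s <= 0 -> K (x, s) = 0 by rewrite /K/= leNgt => /negbTE ->.
have KO x s : ~~ (enorm x < 1) -> K (x, s) = 0.
  by rewrite /K/= => /negbTE ->; rewrite andbF.
have iK : (leb n \x @lebesgue_measure R)%E.-integrable setT (EFin \o K).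
  apply/integrable12ltyP; first exact/measurable_EFinP.
  (* For fixed x the integrand is at most C |x| on an interval of length r/|x|. The product C r does
     not depend on x, so the long intervals near the origin do no harm. *)
  apply: (@le_lt_trans _ _ (\int[leb n]_x (\1_(eball n 1) x * (C * r))%:E)%E).
    apply: ge0_le_integral => //.
    - by move=> x _; exact: integral_ge0.
    - apply: (@measurable_fun_fubini_tonelli_F _ _ _ _ _ (@lebesgue_measure R)
        (fun z => `|(K z)%:E|%E)) => //.
      by apply: measurableT_comp => //; exact/measurable_EFinP.
    - apply/measurable_EFinP; apply: measurable_funM => //.
      by apply: measurable_indic; exact: measurable_eball.
    move=> x _; rewrite indicE.
    have [x1|x1] := boolP (enorm x < 1); last first.
      rewrite integral0_eq => [|s _]; last by rewrite /= KO// normr0.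
      by rewrite lee_fin !mulr_ge0// ltW.
    rewrite mem_set//= mul1r.
    have := enorm_ge0 x; rewrite le_eqVlt => /predU1P[/esym x0|x0].
      rewrite integral0_eq => [|s _]; last by rewrite K0// normr0.
      by rewrite lee_fin !mulr_ge0// ltW.
    apply: (@le_trans _ _ (\int[lebesgue_measure]_(s in `]0%R, (r / enorm x)%R[)
       (C * enorm x)%:E)%E).
      rewrite [leRHS]integral_mkcond; apply: ge0_le_integral => //.
      - apply/measurable_EFinP; apply: measurableT_comp => //.
        by apply: (measurableT_comp mK); exact: measurable_pair1.
      - by apply/(measurable_restrictT _ (measurable_itv _)); exact: measurable_cst.
      move=> s _; rewrite patchE mem_setE in_itv/=.
      have [s0|s0] := ltP 0 s; last by rewrite KS// normr0.
      rewrite KE//; case: ifPn => sr /=; last by rewrite normr0.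
      rewrite lee_fin mulrC mulr_sumr.
      apply: le_trans (ler_norm_sum _ _ _) _; apply: ler_sum => i _.
      rewrite normrM ler_pM// ?ler_coord_enorm//.
      have [_ h _] := bGM i; apply: le_trans (h (s *: x)).
      by rewrite /G enormZ (gtr0_norm s0) -ltr_pdivlMr// sr.
    rewrite integral_cst//= lebesgue_measure_itv/= lte_fin divr_gt0// oppr0 adde0.
    by rewrite -EFinM lee_fin -mulrA [enorm x * _]mulrC divfK// gt_eqF.
  under eq_integral do rewrite EFinM.
  rewrite ge0_integralZr//.
  - rewrite integral_indic//; last exact: measurable_eball.
    rewrite setIT lte_mul_pinfty//.
      rewrite ge0_fin_numE//; apply: le_lt_trans (leb_cube_lty n 1).
      apply: le_measure; rewrite ?inE; [exact: measurable_eball|exact: measurable_cube|].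
      move=> x x1 i /=; rewrite in_itv/= -ler_norml.
      by apply: le_trans (ler_coord_enorm x i) _; exact: ltW.
    exact: ltry.
  - apply/measurable_EFinP; apply: measurable_indic; exact: measurable_eball.
  - by rewrite lee_fin mulr_ge0// ltW.
have := Fubini iK.
rewrite (_ : (\int[leb n]_x _)%E = (\int[leb n]_x
     (if (enorm x < 1)%R then H (r *: radial_proj x) - H 0 else 0)%:E)%E).
  move=> ->; apply: integral_ge0 => s _.
  have [s0|s0] := leP s 0.
    by rewrite integral0_eq// => x _ /=; rewrite KS.
  (* For this s, the conditions |x| < 1 and |s x| < r together mean |x| < c; moreover s c <= r <
     1. *)
  pose c := Num.min 1 (r / s).
  rewrite (_ : (\int[leb n]_x _)%E = (\int[leb n]_x
    (if (enorm x < c)%R then \sum_i x ord0 i * DH i (s *: x) else 0)%:E)%E).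
    apply: integral_radial_ge0 => //.
      by rewrite lt_min ltr01 divr_gt0.
    apply: le_lt_trans r1; rewrite -ler_pdivlMl// mulrC.
    by rewrite /c ge_min lexx orbT.
  apply: eq_integral => x _ /=; congr EFin; rewrite /c lt_min.
  have [x1|x1] := boolP (enorm x < 1); last by rewrite KO.
  have := enorm_ge0 x; rewrite le_eqVlt => /predU1P[/esym x0|x0].
    rewrite K0//= x0 divr_gt0// (enorm_eq0 x0) big1// => i _.
    by rewrite mxE mul0r.
  by rewrite KE//= ltr_pdivlMr// ltr_pdivlMr// mulrC.
apply: eq_integral => x _ /=.
have [x1|x1] := boolP (enorm x < 1); last first.
  by rewrite integral0_eq// => s _; rewrite KO.
have := enorm_ge0 x; rewrite le_eqVlt => /predU1P[/esym x0|x0].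
  rewrite integral0_eq => [|s _]; last by rewrite K0.
  by rewrite /radial_proj (enorm_eq0 x0) !scaler0 subrr.
transitivity (\int[lebesgue_measure]_(s in `]0%R, (r / enorm x)%R[)
    (\sum_i x ord0 i * DH i (s *: x))%:E)%E.
  rewrite [RHS]integral_mkcond; apply: eq_integral => s _.
  rewrite patchE mem_setE in_itv/=.
  have [s0|s0] := ltP 0 s; last by rewrite KS.
  by rewrite KE//=; case: ifP.
have inB s : 0 <= s <= r / enorm x -> eball n 1 (s *: x).
  move=> /andP[s0]; rewrite ler_pdivlMr// /eball/= enormZ ger0_norm// => sx.
  exact: le_lt_trans sx r1.
rewrite /radial_proj scalerA -[in H 0](scale0r x).
apply: (@integral_deriv _ (fun s => H (s *: x))).
- by rewrite divr_gt0.
- move=> s /inB sB.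
  have := is_derive_C1 (@open_eball _ _ 1) dH cDH x sB.
  move=> /(derivable_line H (y := 0) (s := s) _ _).1.
  by rewrite add0r => /(_ erefl); under eq_fun do rewrite add0r.
- move=> s /inB sB; apply: continuous_bigsum => i.
  apply: continuousM; first exact: cst_continuous.
  apply: (@continuous_comp _ _ _ (fun s : R => s *: x) (DH i)).
    by apply: cvgZr_tmp; exact: cvg_id.
  exact: cDH.
Qed.

End submean.
End smv.

(** * Spherical means *)

Section surface.
Context {R : realType}.

Lemma ge0_integral_mrestr d (T : measurableType d) (mu : {measure set T -> \bar R})
    (B : set T) (mB : measurable B) (D : set T) (f : T -> \bar R) :
  measurable D -> measurable_fun D f -> (forall x, D x -> 0 <= f x)%E ->
  (\int[mrestr mu mB]_(x in D) f x = \int[mu]_(x in D `&` B) f x)%E.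
Proof.
move=> mD mf f0.
rewrite (@ge0_negligible_integral _ _ _ _ D (~` B))//.
- rewrite setDE setCK; apply: eq_measure_integral => A mA AB.
  by change (mu (A `&` B) = mu A); rewrite setIidl// => x /AB [].
- exact: measurableC.
- by change (mu (~` B `&` B) = 0%E); rewrite setICl measure0.
Qed.

Lemma leb_itv_box n (a b : 'I_n -> R) : (forall i, a i < b i) ->
  leb n (rV_box (fun i => `]a i, b i[%classic)) =
  (\prod_(i < n) (b i - a i))%:E.
Proof.
move=> ab; rewrite leb_box//.
transitivity (\prod_(i < n) (b i - a i)%:E)%E.
  by apply: eq_bigr => i _; rewrite lebesgue_measure_itv/= lte_fin ab.
elim: n a b {ab} => [|n IH] a b; first by rewrite !big_ord0.
by rewrite !big_ord_recr/= IH.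
Qed.

Lemma box_nbhs n (x : 'rV[R]_n) U : nbhs x U -> exists2 d, 0 < d &
  forall y : 'rV[R]_n, (forall i, `|x ord0 i - y ord0 i| < d) -> U y.
Proof.
move=> /nbhs_ballP[d /= d0 h]; exists d => // y xy; apply: h.
by split => // i j; rewrite (ord1 i) /ball/=.
Qed.

Lemma open_leb_gt0 n (U : set 'rV[R]_n) x : open U -> U x -> (0 < leb n U)%E.
Proof.
move=> oU Ux; have [d d0 dU] : exists2 d, 0 < d &
    forall y : 'rV[R]_n, (forall i, `|x ord0 i - y ord0 i| < d) -> U y.
  by apply: box_nbhs; exact: open_nbhs_nbhs.
pose a i := x ord0 i - d; pose b i := x ord0 i + d.
have ab i : a i < b i by rewrite /a /b; lra.
apply: (@lt_le_trans _ _ (leb n (rV_box (fun i => `]a i, b i[%classic)))).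
  rewrite leb_itv_box// lte_fin prodr_gt0// => i _; rewrite /a /b; lra.
apply: le_measure; rewrite ?inE.
- exact: measurable_rV_box.
- exact: open_measurable_rV.
move=> y yab; apply: dU => i; rewrite ltr_norml.
by have := yab i; rewrite /= in_itv/= /a /b; lra.
Qed.

Lemma leb_unit_ball_gt0 n : (0 < leb n (unit_ball R n))%E.
Proof.
apply: (open_leb_gt0 (x := 0)); first exact: (@open_eball R n 1).
by rewrite /unit_ball/= enorm0.
Qed.

Lemma leb_unit_ball_lty n : (leb n (unit_ball R n) < +oo)%E.
Proof.
apply: le_lt_trans (leb_cube_lty n 1).
apply: le_measure; rewrite ?inE; [exact: measurable_unit_ball|exact: measurable_cube|].
move=> x x1 i /=; rewrite in_itv/= -ler_norml.
by apply: le_trans (ler_coord_enorm x i) _; exact: ltW.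
Qed.

Lemma leb_set1 n : (0 < n)%N -> leb n [set (0 : 'rV[R]_n)] = 0%E.
Proof.
case: n => // n _.
rewrite (_ : [set 0] = rV_box (fun=> [set 0])); last first.
  apply/seteqP; split=> [_ -> i /=|x x0]; first by rewrite mxE.
  by apply/rowP => i; rewrite mxE; exact: x0.
by rewrite leb_box// big_ord_recl/= lebesgue_measure_set1 mul0e.
Qed.

Lemma enorm_radial_proj n (x : 'rV[R]_n) : x != 0 -> enorm (radial_proj x) = 1.
Proof.
move=> x0; have e0 : 0 < enorm x.
  rewrite lt_neqAle enorm_ge0 andbT eq_sym.
  by apply: contra x0 => /eqP/enorm_eq0 ->.
by rewrite enormZ ger0_norm ?invr_ge0 ?ltW// mulVf ?gt_eqF.
Qed.

Lemma radial_proj0 n : radial_proj (0 : 'rV[R]_n) = 0.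
Proof. by rewrite /radial_proj scaler0. Qed.

Lemma measurable_unit_sphere n : measurable (unit_sphere R n).
Proof.
rewrite (_ : unit_sphere R n = setT `&` @enorm R n @^-1` [set 1]).
  exact: measurable_enorm.
by rewrite setTI.
Qed.

Definition vol_ball n : R := fine (leb n (unit_ball R n)).

Lemma vol_ball_gt0 n : 0 < vol_ball n.
Proof. by rewrite fine_gt0// leb_unit_ball_gt0 leb_unit_ball_lty. Qed.

Lemma vol_ballV_ge0 n : 0 <= (vol_ball n)^-1.
Proof. by rewrite invr_ge0 ltW// vol_ball_gt0. Qed.

(** The ball has positive finite volume, so [mnormalize] does not fall back on its default. The
    origin is the only point of the ball not projected to the sphere, and it is null because n >
    0. *)
Lemma ge0_integral_surface n (g : 'rV[R]_n -> \bar R) : (0 < n)%N ->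
  measurable_fun setT g -> (forall z, 0 <= g z)%E ->
  (\int[surface_measure R n]_(z in unit_sphere R n) g z =
   (vol_ball n)^-1%:E * \int[leb n]_(x in unit_ball R n) g (radial_proj x))%E.
Proof.
move=> n0 mg g0.
pose mu := image_measure (mrestr (lebesgue_rV R n) (@measurable_unit_ball R n))
      (@measurable_radial_proj R n).
have muT : mu setT = leb n (unit_ball R n).
  by rewrite /mu/= /pushforward/= /mrestr/= preimage_setT setTI.
have k0 : 0 <= (vol_ball n)^-1 by rewrite invr_ge0 ltW// vol_ball_gt0.
transitivity (\int[mscale (NngNum k0) mu]_(z in unit_sphere R n) g z)%E.
  apply: eq_measure_integral => A mA _.
  rewrite /surface_measure /= /mnormalize -/mu muT.
  rewrite gt_eqF ?leb_unit_ball_gt0//= lt_eqF ?leb_unit_ball_lty//=.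
  by rewrite /mscale/= muleC.
rewrite ge0_integral_mscale//; last 2 first.
  exact: measurable_unit_sphere.
  exact: measurable_funTS.
congr (_ * _)%E.
have msg : measurable (@radial_proj R n @^-1` unit_sphere R n).
  rewrite -[X in measurable X]setTI; apply: measurable_radial_proj => //.
  exact: measurable_unit_sphere.
have mgr : measurable_fun setT (g \o @radial_proj R n).
  by apply: measurableT_comp => //; exact: measurable_radial_proj.
transitivity (\int[mrestr (leb n) (@measurable_unit_ball R n)]_(x in
     @radial_proj R n @^-1` unit_sphere R n) (g \o @radial_proj R n) x)%E.
  rewrite -ge0_integral_pushforward//.
  - exact: measurable_radial_proj.
  - exact: measurable_unit_sphere.
  - exact: measurable_funTS.
rewrite ge0_integral_mrestr; [|exact: msg|exact: measurable_funTS mgr|by move=> *; exact: g0].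
rewrite [RHS](@ge0_negligible_integral _ _ _ _ _ [set (0 : 'rV[R]_n)]); last first.
- exact: leb_set1.
- by move=> *; exact: g0.
- exact: measurable_funTS mgr.
- exact: measurable_unit_ball.
- rewrite (_ : [set (0 : 'rV[R]_n)] = rV_box (fun=> [set 0])); first exact: measurable_rV_box.
  apply/seteqP; split=> [_ -> i /=|x x0]; first by rewrite mxE.
  by apply/rowP => i; rewrite mxE; exact: x0.
rewrite (_ : _ `&` _ = unit_ball R n `\` [set (0 : 'rV[R]_n)])//.
apply/seteqP; split=> x /= [].
  move=> xS xB; split=> // x0; move: xS.
  by rewrite x0 radial_proj0 /unit_sphere/= enorm0 => /eqP; rewrite eq_sym oner_eq0.
by move=> xB /eqP x0; split => //; exact: enorm_radial_proj.
Qed.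

(* The mean of g over the sphere of radius r, the surface measure being the image
   of the uniform measure on the ball under the radial projection. *)
Definition smean n (r : R) (g : 'rV[R]_n -> R) : R :=
  (vol_ball n)^-1 * \int[leb n]_(x in unit_ball R n) g (r *: radial_proj x).

(** Nothing is known of g outside the ball. The cutoff supplies a globally measurable function that
    can be composed with scaling and radial projection. *)
Lemma measurable_cutoff n (g : 'rV[R]_n -> R) :
  (forall x, unit_ball R n x -> {for x, continuous g}) ->
  measurable_fun setT (fun x => if enorm x < 1 then g x else 0).
Proof.
move=> cg; rewrite (_ : (fun x => _) = g \_ (unit_ball R n)).
  apply/(measurable_restrictT _ (measurable_eball 1)).
  by apply: continuous_open_measurable_rV => //; exact: open_eball.
apply/funext => x; rewrite patchE; case: ifPn => h; first by rewrite mem_set.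
by rewrite memNset// => h'; rewrite h' in h.
Qed.

Lemma enorm_radial_proj_le n (x : 'rV[R]_n) : enorm (radial_proj x) <= 1.
Proof.
have [->|x0] := eqVneq x 0; first by rewrite radial_proj0 enorm0.
by rewrite enorm_radial_proj.
Qed.

Lemma scale_radial_ball n (r : R) (x : 'rV[R]_n) : 0 <= r < 1 ->
  enorm (r *: radial_proj x) < 1.
Proof.
move=> /andP[r0 r1]; rewrite enormZ ger0_norm//.
by apply: le_lt_trans r1; rewrite ler_piMr// enorm_radial_proj_le.
Qed.

Lemma measurable_scale n (r : R) : measurable_fun setT (fun x : 'rV[R]_n => r *: x).
Proof.
apply/measurable_fun_rVP => i; under eq_fun do rewrite mxE.
by apply: measurable_funM => //; exact: measurable_rV_coord.
Qed.

Lemma measurable_scale_radial n (g : 'rV[R]_n -> R) r : 0 <= r < 1 ->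
  (forall x, unit_ball R n x -> {for x, continuous g}) ->
  measurable_fun setT (fun x => g (r *: radial_proj x)).
Proof.
move=> r01 cg.
rewrite (_ : (fun x => _) = (fun x => if enorm x < 1 then g x else 0) \o
   ((fun x => r *: x) \o @radial_proj R n)).
  apply: measurableT_comp; first exact: measurable_cutoff.
  by apply: measurableT_comp; [exact: measurable_scale|exact: measurable_radial_proj].
by apply/funext => x /=; rewrite scale_radial_ball.
Qed.

Lemma bounded_closed_ball n (g : 'rV[R]_n -> R) r : 0 <= r < 1 ->
  (forall x, unit_ball R n x -> {for x, continuous g}) ->
  exists M, forall x, enorm x <= r -> `|g x| <= M.
Proof.
move=> /andP[r0 r1] cg.
have [|||z _ zP] := @compact_EVT_max _ R (fun x => `|g x|)
     [set x : 'rV[R]_n | enorm x <= r].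
- by exists 0; rewrite /= enorm0.
- exact: compact_cball.
- apply: continuous_in_subspaceT => x; rewrite inE/= => xc.
  apply: (continuous_comp (f := g)); last exact: norm_continuous.
  by apply: cg; exact: le_lt_trans r1.
by exists `|g z| => x xc; apply: zP; rewrite inE.
Qed.

Lemma integrable_scale_radial n (g : 'rV[R]_n -> R) r : 0 <= r < 1 ->
  (forall x, unit_ball R n x -> {for x, continuous g}) ->
  (leb n).-integrable (unit_ball R n) (fun x => (g (r *: radial_proj x))%:E).
Proof.
move=> r01 cg; have [M gM] := bounded_closed_ball r01 cg.
have mB := @measurable_unit_ball R n.
apply: measurable_bounded_integrable => //.
- exact: leb_unit_ball_lty.
- by apply: measurable_funTS; exact: measurable_scale_radial.
exists M; split; first exact: num_real.
move=> y My x _ /=; apply: le_trans (ltW My); apply: gM.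
rewrite enormZ ger0_norm; last by case/andP: r01.
by rewrite ler_piMr ?enorm_radial_proj_le//; case/andP: r01.
Qed.

Section mean.
Variables (n : nat) (r : R).
Hypothesis r01 : 0 <= r < 1.
Implicit Types g h : 'rV[R]_n -> R.
Local Notation contB g := (forall x, unit_ball R n x -> {for x, continuous g}).

Let mB := @measurable_unit_ball R n.
Let iB g (cg : contB g) := integrable_scale_radial r01 cg.

Lemma smeanD g h : contB g -> contB h ->
  smean r (fun x => g x + h x) = smean r g + smean r h.
Proof. by move=> cg ch; rewrite /smean (RintegralD mB (iB cg) (iB ch)) mulrDr. Qed.

Lemma smeanZ k g : contB g -> smean r (fun x => k * g x) = k * smean r g.
Proof. by move=> cg; rewrite /smean (RintegralZl k mB (iB cg)) mulrCA. Qed.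

Lemma smean_cst k : smean r (fun _ : 'rV[R]_n => k) = k.
Proof.
rewrite /smean Rintegral_cst// -/(vol_ball n) mulrCA mulVf ?mulr1//.
by rewrite gt_eqF// vol_ball_gt0.
Qed.

Lemma smean_le g h : contB g -> contB h ->
  (forall x, unit_ball R n x -> g x <= h x) -> smean r g <= smean r h.
Proof.
move=> cg ch gh; rewrite /smean ler_wpM2l ?vol_ballV_ge0//.
apply: le_Rintegral => //; [exact: iB|exact: iB|move=> x _].
by apply: gh; exact: scale_radial_ball.
Qed.

Lemma smean_ge0 g : (forall x, unit_ball R n x -> 0 <= g x) -> 0 <= smean r g.
Proof.
move=> g0; rewrite /smean mulr_ge0 ?vol_ballV_ge0//.
by apply: Rintegral_ge0 => x _; apply: g0; exact: scale_radial_ball.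
Qed.

Lemma integral_surface_smean g : (0 < n)%N -> contB g ->
  (forall x, unit_ball R n x -> 0 <= g x) ->
  (\int[surface_measure R n]_(z in unit_sphere R n) (g (r *: z))%:E =
   (smean r g)%:E)%E.
Proof.
move=> n0 cg g0.
pose G z := if enorm (r *: z) < 1 then g (r *: z) else 0.
transitivity (\int[surface_measure R n]_(z in unit_sphere R n) (G z)%:E)%E.
  apply: eq_integral => z; rewrite inE => z1; rewrite /G enormZ z1 mulr1.
  by rewrite ger0_norm; case/andP: r01 => // _ ->.
rewrite (@ge0_integral_surface n (EFin \o G))//.
- rewrite /smean EFinM; congr (_ * _)%E.
  rewrite /Rintegral fineK; last exact: integrable_fin_num (iB cg).
  by apply: eq_integral => x _; rewrite /= /G scale_radial_ball.
- apply/measurable_EFinP; apply: (measurableT_comp (measurable_cutoff cg)).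
  exact: measurable_scale.
- by move=> z; rewrite lee_fin /G; case: ifP => // ?; exact: g0.
Qed.

Lemma integrable_surface g : (0 < n)%N -> contB g ->
  (forall x, unit_ball R n x -> 0 <= g x) ->
  (surface_measure R n).-integrable (unit_sphere R n) (fun z => (g (r *: z))%:E).
Proof.
move=> n0 cg g0.
have mS := @measurable_unit_sphere n.
have gE z : unit_sphere R n z -> unit_ball R n (r *: z).
  move=> z1; rewrite /unit_ball/= enormZ z1 mulr1.
  by rewrite ger0_norm; case/andP: r01.
apply/integrableP; split.
  apply/measurable_EFinP.
  apply: (@eq_measurable_fun _ _ _ _ (unit_sphere R n)
    (fun z : 'rV[R]_n => if enorm (r *: z) < 1 then g (r *: z) else 0)).
    by move=> z; rewrite inE => /gE; rewrite /unit_ball/= => ->.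
  apply: measurable_funTS; apply: (measurableT_comp (measurable_cutoff cg)).
  exact: measurable_scale.
rewrite (_ : (\int[_]_(_ in _) _)%E = (smean r g)%:E) ?ltry//.
rewrite -integral_surface_smean//; apply: eq_integral => z; rewrite inE => /gE z1.
by rewrite gee0_abs// lee_fin g0.
Qed.

End mean.

Lemma submean n (H : 'rV[R]_n -> R) DH D2H r : 0 <= r < 1 ->
  C2 (unit_ball R n) H DH D2H ->
  (forall x, unit_ball R n x -> 0 <= \sum_i D2H i x) ->
  H 0 <= smean r H.
Proof.
move=> r01 c2H lapH; have cH : forall x, unit_ball R n x -> {for x, continuous H}.
  by case: c2H.
rewrite -subr_ge0 -[H 0 in X in 0 <= X](@smean_cst n r) -mulN1r -smeanZ//; last first.
  by move=> x _; exact: cst_continuous.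
rewrite -smeanD//; last by move=> x _; exact: cst_continuous.
rewrite /smean mulr_ge0 ?vol_ballV_ge0//.
case/andP: r01; rewrite le_eqVlt => /predU1P[<- _|r0 r1].
  by apply: Rintegral_ge0 => x _; rewrite scale0r mulN1r subrr.
rewrite fine_ge0// integral_mkcond.
have := @submean_leb R n H DH D2H c2H lapH r.
rewrite r0 r1 => /(_ isT); congr (_ <= _)%E.
apply: eq_integral => x _; rewrite patchE; case: ifPn => h.
  by rewrite mem_set// mulN1r.
by rewrite memNset// => h'; rewrite h' in h.
Qed.

End surface.

(** * Operator norm and determinant *)

Section linalg.
Context {R : realType}.

Lemma cauchy_schwarz (I : finType) (a b : I -> R) :
  (\sum_i a i * b i) ^+ 2 <= (\sum_i a i ^+ 2) * (\sum_i b i ^+ 2).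
Proof.
set A := \sum_i a i ^+ 2; set B := \sum_i b i ^+ 2; set C := \sum_i _ * _.
have A0 : 0 <= A by apply: sumr_ge0 => i _; exact: sqr_ge0.
have : 0 <= B by apply: sumr_ge0 => i _; exact: sqr_ge0.
rewrite le_eqVlt => /predU1P[B0|B0].
  rewrite (_ : C = 0) ?expr0n ?mulr_ge0// -?B0//.
  rewrite /C big1// => i _.
  have /psumr_eq0P : B = 0 by rewrite -B0.
  move=> /(_ (fun i _ => sqr_ge0 _) i isT)/eqP.
  by rewrite sqrf_eq0 => /eqP ->; rewrite mulr0.
have sqE x y : \sum_i (x * a i - y * b i) ^+ 2 =
    x ^+ 2 * A - 2 * x * y * C + y ^+ 2 * B.
  rewrite /A /B /C !mulr_sumr -sumrB -big_split/=.
  by apply: eq_bigr => i _; ring.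
have : 0 <= \sum_i (B * a i - C * b i) ^+ 2.
  by apply: sumr_ge0 => i _; exact: sqr_ge0.
rewrite sqE (_ : _ + _ = B * (A * B - C ^+ 2)); last by ring.
by rewrite pmulr_rge0// subr_ge0.
Qed.

Lemma dot_le_enorm n (a b : 'rV[R]_n) :
  \sum_i a ord0 i * b ord0 i <= enorm a * enorm b.
Proof.
apply: le_trans (ler_norm _) _.
rewrite -ler_sqr ?nnegrE ?mulr_ge0 ?enorm_ge0//.
by rewrite real_normK ?num_real// exprMn !enorm_sqr cauchy_schwarz.
Qed.

(** The Frobenius norm works. Boundedness is what makes the [sup] in [opnorm] an actual upper
    bound. *)
Lemma enorm_mulmx_bounded n (A : 'M[R]_n) :
  exists2 C, 0 <= C & forall w : 'rV[R]_n, enorm (w *m A) <= C * enorm w.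
Proof.
exists (Num.sqrt (\sum_j \sum_i A i j ^+ 2)); first exact: sqrtr_ge0.
move=> w; rewrite -ler_sqr ?nnegrE ?mulr_ge0 ?enorm_ge0 ?sqrtr_ge0//.
rewrite exprMn !enorm_sqr sqr_sqrtr; last first.
  by apply: sumr_ge0 => j _; apply: sumr_ge0 => i _; exact: sqr_ge0.
rewrite mulr_suml; apply: ler_sum => j _; rewrite mxE mulrC.
by apply: cauchy_schwarz.
Qed.

Lemma opnorm_ge0 n (A : 'M[R]_n) : 0 <= opnorm A.
Proof.
have [C C0 AC] := enorm_mulmx_bounded A.
apply: ub_le_sup; last by exists 0; rewrite /= ?mul0mx enorm0.
exists C => _ [v /= v1 <-]; apply: le_trans (AC _) _.
by rewrite ler_piMr.
Qed.

Lemma enorm_mulmx_opnorm n (A : 'M[R]_n) (w : 'rV[R]_n) :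
  enorm (w *m A) <= opnorm A * enorm w.
Proof.
have := enorm_ge0 w; rewrite le_eqVlt => /predU1P[/esym w0|w0].
  by rewrite (enorm_eq0 w0) mul0mx enorm0 mulr0.
have [C C0 AC] := enorm_mulmx_bounded A.
rewrite -ler_pdivrMr//.
have -> : enorm (w *m A) / enorm w = enorm (((enorm w)^-1 *: w) *m A).
  by rewrite -scalemxAl enormZ ger0_norm ?invr_ge0 ?ltW// mulrC.
apply: ub_le_sup.
  exists C => _ [v /= v1 <-]; apply: le_trans (AC _) _.
  by rewrite ler_piMr.
exists ((enorm w)^-1 *: w) => //=.
by rewrite enormZ ger0_norm ?invr_ge0 ?enorm_ge0// mulVf ?gt_eqF.
Qed.

Lemma opnorm_le n (A : 'M[R]_n) M : 0 <= M ->
  (forall w : 'rV[R]_n, enorm (w *m A) <= M * enorm w) -> opnorm A <= M.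
Proof.
move=> M0 AM; apply: ge_sup.
  by exists (enorm (0 *m A)); exists 0 => //=; rewrite enorm0.
move=> _ [v /= v1 <-]; apply: le_trans (AM _) _.
by rewrite ler_piMr.
Qed.

(** Taking m-th roots and letting m grow: if d > P > 0, Bernoulli's inequality makes (d/P)^m grow at
    least linearly, past N. The case P = 0 is settled by m = 1. *)
Lemma le_of_expr_le (d P N : R) : 0 <= d -> 0 <= P ->
  (forall m, d ^+ m <= N * P ^+ m) -> d <= P.
Proof.
move=> d0 P0 h; rewrite leNgt; apply/negP => Pd.
have N1 : 1 <= N by have := h 0%N; rewrite !expr0 mulr1.
move: P0; rewrite le_eqVlt => /predU1P[P0|P0].
  by have := h 1%N; rewrite !expr1 -P0 mulr0 => h1; move: Pd; rewrite -P0; lra.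
pose q := d / P.
have q1 : 0 < q - 1 by rewrite subr_gt0 ltr_pdivlMr// mul1r.
have bern m : 1 + m%:R * (q - 1) <= q ^+ m.
  elim: m => [|m IH]; first by rewrite mul0r addr0 expr0.
  rewrite exprS -natr1.
  have : q * (1 + m%:R * (q - 1)) <= q * q ^+ m by rewrite ler_pM2l//; lra.
  have : 0 <= m%:R * (q - 1) ^+ 2 by rewrite mulr_ge0// sqr_ge0.
  by nra.
have qN m : q ^+ m <= N.
  by rewrite expr_div_n ler_pdivrMr ?exprn_gt0// h.
have [m Nm] : exists m, N < m%:R * (q - 1).
  exists (Num.truncn (N / (q - 1))).+1.
  by rewrite -ltr_pdivrMr// truncnS_gt.
by have := bern m; have := qN m; lra.
Qed.

Lemma enorm_row_le n (T : 'M[R]_n) M (i : 'I_n) :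
  (forall w : 'rV[R]_n, enorm (w *m T) <= M * enorm w) -> enorm (row i T) <= M.
Proof.
move=> h; rewrite rowE; apply: le_trans (h _) _.
rewrite /enorm (bigD1 i)//= big1 => [|j ji].
  by rewrite mxE !eqxx expr1n addr0 sqrtr1 mulr1.
by rewrite mxE (negbTE ji) andbF expr0n.
Qed.

(* The entries of [T ^+ m] are at most [M ^+ m]; take m-th roots in the Leibniz
   formula for its determinant. *)
Lemma det_le_expr n (T : 'M[R]_n) M : 0 <= M ->
  (forall w : 'rV[R]_n, enorm (w *m T) <= M * enorm w) -> \det T <= M ^+ n.
Proof.
case: n T => [|n] T M0 h; first by rewrite det_mx00 expr0.
apply: le_trans (ler_norm _) _.
apply: (@le_of_expr_le _ _ #|{perm 'I_n.+1}|%:R); rewrite ?exprn_ge0// => m.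
have hm (w : 'rV[R]_n.+1) : enorm (w *m (T ^+ m)) <= M ^+ m * enorm w.
  elim: m => [|m IH]; first by rewrite !expr0 mulmx1 mul1r.
  rewrite exprSr exprS -[_ * T]/(_ *m T) mulmxA -mulrA.
  by apply: le_trans (h _) _; rewrite ler_wpM2l.
have ent i j : `|(T ^+ m) i j| <= M ^+ m.
  apply: le_trans (enorm_row_le i hm).
  by rewrite (_ : (T ^+ m) i j = row i (T ^+ m) ord0 j) ?ler_coord_enorm// mxE.
rewrite -normrX (_ : \det T ^+ m = \det (T ^+ m)); last first.
  elim: m {hm ent} => [|m IH]; first by rewrite !expr0 det1.
  by rewrite !exprS IH -det_mulmx.
apply: le_trans (ler_norm_sum _ _ _) _.
rewrite -sum1_card natr_sum mulr_suml; apply: ler_sum => s _.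
rewrite mul1r normrM normrX normrN1 expr1n mul1r normr_prod.
rewrite exprAC (_ : _ ^+ n.+1 = \prod_(i < n.+1) M ^+ m); last first.
  by rewrite prodr_const card_ord.
by apply: ler_prod => i _; rewrite normr_ge0 ent.
Qed.

(* Replacing row k by M times the unit cofactor vector, which is orthogonal to
   the other rows, keeps the norm bound M. *)
Lemma det_le_row n (B : 'M[R]_n) M (k : 'I_n) : 0 <= M ->
  (forall w : 'rV[R]_n, enorm (w *m B) <= M * enorm w) ->
  \det B <= enorm (row k B) * M ^+ n.-1.
Proof.
move=> M0 h; pose c : 'rV[R]_n := \row_j cofactor B k j.
have detE : \det B = \sum_j row k B ord0 j * c ord0 j.
  by rewrite (expand_det_row B k); apply: eq_bigr => j _; rewrite !mxE.
move: M0; rewrite le_eqVlt => /predU1P[M0|M0].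
  have r0 : enorm (row k B) = 0.
    apply/eqP; rewrite eq_le enorm_ge0 andbT.
    by rewrite [leRHS]M0; exact: enorm_row_le.
  by rewrite detE (enorm_eq0 r0) enorm0 mul0r big1// => j _; rewrite mxE mul0r.
have cM : enorm c <= M ^+ n.-1.
  have := enorm_ge0 c; rewrite le_eqVlt => /predU1P[<-|c0].
    by rewrite exprn_ge0// ltW.
  pose T := \matrix_(i, j) if i == k then M / enorm c * c ord0 j else B i j.
  (* Expanding along row k leaves the cofactors of [B] unchanged. The bound M^n for this determinant
     then gives |c| <= M^(n-1). *)
  have detT : \det T = M * enorm c.
    rewrite (expand_det_row T k).
    transitivity (M / enorm c * \sum_j c ord0 j ^+ 2).
      rewrite mulr_sumr; apply: eq_bigr => j _.
      suff cofT : cofactor T k j = c ord0 j.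
        by rewrite [T k j]mxE eqxx cofT expr2 [RHS]mulrA.
      rewrite [RHS]mxE /cofactor; congr (_ * \det _).
      apply/matrixP => a b; rewrite !mxE eq_sym.
      by rewrite (negbTE (neq_lift _ _)).
    by rewrite -enorm_sqr expr2 mulrA divfK// gt_eqF.
  have : \det T <= M ^+ n.
    apply: det_le_expr; first exact: ltW.
    move=> w; pose w' : 'rV[R]_n := \row_i if i == k then 0 else w ord0 i.
    have wT j : (w *m T) ord0 j = (w' *m B) ord0 j + w ord0 k * (M / enorm c) * c ord0 j.
      rewrite !mxE (bigD1 k)//= [in RHS](bigD1 k)//= !mxE eqxx mul0r add0r addrC.
      rewrite mulrA; congr (_ + _); apply: eq_bigr => i ik.
      by rewrite !mxE (negbTE ik).
    (* The vector [c] is column k of the adjugate, so B c^T = det B e_k, and [w'] has k-th entry 0.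
       By Pythagoras the two parts of w T can then be estimated separately. *)
    have orth : \sum_j (w' *m B) ord0 j * c ord0 j = 0.
      have -> : \sum_j (w' *m B) ord0 j * c ord0 j = (w' *m (B *m \adj B)) ord0 k.
        rewrite mulmxA [RHS]mxE; apply: eq_bigr => j _.
        by rewrite [\adj B j k]mxE [c ord0 j]mxE.
      by rewrite mul_mx_adj mul_mx_scalar mxE [w' _ _]mxE eqxx mulr0.
    have ww' : enorm w ^+ 2 = enorm w' ^+ 2 + w ord0 k ^+ 2.
      rewrite !enorm_sqr (bigD1 k)//= [in RHS](bigD1 k)//= mxE eqxx.
      rewrite expr0n add0r addrC; congr (_ + _).
      by apply: eq_bigr => i ik; rewrite mxE (negbTE ik).
    have Mw (x : 'rV[R]_n) : 0 <= M * enorm x := mulr_ge0 (ltW M0) (enorm_ge0 x).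
    rewrite -ler_sqr ?nnegrE ?enorm_ge0 ?Mw//.
    rewrite exprMn ww' [leLHS]enorm_sqr.
    have -> : \sum_i (w *m T) ord0 i ^+ 2 =
        enorm (w' *m B) ^+ 2 + (w ord0 k * M) ^+ 2.
      pose t := w ord0 k * (M / enorm c).
      transitivity (\sum_i (w' *m B) ord0 i ^+ 2 + 2 * t * \sum_i (w' *m B) ord0 i * c ord0 i
         + t ^+ 2 * \sum_i c ord0 i ^+ 2).
        rewrite !mulr_sumr -!big_split/=; apply: eq_bigr => i _.
        by rewrite wT -/t; ring.
      rewrite orth mulr0 addr0 -!enorm_sqr -exprMn; congr (_ + _ ^+ 2).
      by rewrite /t -!mulrA mulVf ?mulr1// gt_eqF.
    rewrite mulrDr exprMn [_ * M ^+ 2]mulrC lerD2r -exprMn.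
    by rewrite ler_sqr ?nnegrE ?enorm_ge0 ?Mw.
  have n0 : (0 < n)%N by exact: leq_ltn_trans (leq0n k) (ltn_ord k).
  rewrite detT (_ : M ^+ n = M * M ^+ n.-1) ?ler_pM2l//.
  by rewrite -exprS prednK.
rewrite detE; apply: le_trans (dot_le_enorm _ _) _.
by rewrite ler_wpM2l// enorm_ge0.
Qed.

(** With y = w A^T, |y|^2 is the scalar product of y A and w, hence at most M |y| |w|; divide by
    |y|. *)
Lemma enorm_mulmx_tr n (A : 'M[R]_n) M :
  (forall w : 'rV[R]_n, enorm (w *m A) <= M * enorm w) ->
  forall w : 'rV[R]_n, enorm (w *m A^T) <= M * enorm w.
Proof.
move=> h w; set y := w *m A^T.
have := enorm_ge0 y; rewrite le_eqVlt => /predU1P[y0|y0].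
  rewrite -y0; apply: le_trans (enorm_ge0 _) (h w).
have : enorm y ^+ 2 <= enorm y * (M * enorm w).
  have -> : enorm y ^+ 2 = \sum_j (y *m A) ord0 j * w ord0 j.
    rewrite enorm_sqr.
    transitivity ((y *m y^T) ord0 ord0).
      rewrite [RHS]mxE; apply: eq_bigr => i _; rewrite expr2; congr (_ * _).
      by rewrite [RHS]mxE.
    rewrite {2}/y trmx_mul trmxK mulmxA [LHS]mxE; apply: eq_bigr => j _.
    by rewrite [w^T _ _]mxE.
  apply: le_trans (dot_le_enorm _ _) _.
  apply: (@le_trans _ _ (M * enorm y * enorm w)).
    by rewrite ler_wpM2r ?enorm_ge0.
  by rewrite mulrA [M * _]mulrC.
by rewrite expr2 ler_pM2l.
Qed.

(** With M the operator norm, M^n <= K det A <= K |column k| M^(n-1), hence M <= K |column k|, while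
    M bounds the norm of every column. Columns, the gradients of the components, are handled as rows
    of the transpose. *)
Lemma quasiconformal_columns n (A : 'M[R]_n) K : (0 < n)%N -> 0 <= K ->
  opnorm A ^+ n <= K * \det A ->
  forall j k, \sum_i A i j ^+ 2 <= K ^+ 2 * \sum_i A i k ^+ 2.
Proof.
move=> n0 K0 AK j k; pose M := opnorm A.
have M0 : 0 <= M := opnorm_ge0 A.
have hT := enorm_mulmx_tr (enorm_mulmx_opnorm A).
have colE i : \sum_l A l i ^+ 2 = enorm (row i A^T) ^+ 2.
  by rewrite enorm_sqr; apply: eq_bigr => l _; rewrite !mxE.
rewrite !colE -exprMn ler_sqr ?nnegrE ?enorm_ge0 ?mulr_ge0 ?enorm_ge0//.
apply: le_trans (enorm_row_le j hT) _; rewrite -/M.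
have : M ^+ n <= K * (enorm (row k A^T) * M ^+ n.-1).
  by apply: le_trans AK _; rewrite ler_wpM2l// -det_tr; exact: det_le_row.
move: M0; rewrite le_eqVlt => /predU1P[<-|M0].
  by rewrite mulr_ge0 ?enorm_ge0.
by rewrite -{1}(prednK n0) exprS mulrA ler_pM2r ?exprn_gt0.
Qed.

End linalg.

(** * Test functions *)

Section bump.
Context {R : realType}.

(** For [flat] at its junction point, where no derivation rule applies. *)
Lemma is_derive0_sqr (f : R -> R) C : (forall t, `|f t| <= C * t ^+ 2) ->
  is_derive (0 : R) 1 f 0.
Proof.
move=> fC; have f0 : f 0 = 0.
  by apply/eqP; rewrite -normr_le0; have := fC 0; rewrite expr0n mulr0.
suff cvgL : h^-1 *: ((f \o shift 0) (h *: 1) - f 0) @[h --> 0^'] --> (0 : R).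
  by split; [apply: cvgP cvgL|exact: cvg_lim cvgL].
apply/cvgrPdist_le => /= e e0.
have C0 : 0 <= C by have := fC 1; rewrite expr1n mulr1; exact: le_trans.
near=> h.
have h0 : 0 < `|h| by rewrite normr_gt0; near: h; exact: nbhs_dnbhs_neq.
rewrite sub0r normrN f0 subr0 /shift/= addr0 [h *: 1]mulr1 normrM normfV.
rewrite ler_pdivrMl//; apply: le_trans (fC h) _.
rewrite -[h ^+ 2]real_normK ?num_real// expr2 mulrCA ler_pM2l//.
have : `|h| < e / (C + 1).
  by near: h; apply: dnbhs0_lt; rewrite divr_gt0//; lra.
rewrite ltr_pdivlMr; last lra.
by move=> h1; have := ltW h0; lra.
Unshelve. all: by end_near. Qed.

Lemma is_derive_pow (V : normedModType R) m (f : V -> R) x v d :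
  is_derive x v f d ->
  is_derive x v (fun y => f y ^+ m) (m%:R * f x ^+ m.-1 * d).
Proof.
move=> fd; elim: m => [|m IH]; first by rewrite !mul0r; exact: is_derive_cst.
rewrite (_ : (fun y => _) = (fun y => f y * f y ^+ m)); last first.
  by apply/funext => y; rewrite exprS.
apply: (is_derive_eq (is_derive_mul fd IH)).
by case: m {IH} => [|m] /=; rewrite ?expr0 -?natr1 ?exprS; ring.
Qed.

(** The functions t^-m exp(-c/t), extended by 0: the span of this family over m is closed under
    differentiation. The parameter c will tend to 0, which makes the case m = 0 converge to the
    indicator of t > 0. *)
Definition flat (m : nat) (c t : R) : R :=
  if 0 < t then t^-1 ^+ m * expR (- (c * t^-1)) else 0.

Lemma flat_ge0 m c t : 0 <= flat m c t.
Proof.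
rewrite /flat; case: ifP => // t0.
by rewrite mulr_ge0 ?expR_ge0// exprn_ge0// invr_ge0 ltW.
Qed.

(** From exp y >= y^(m+2)/(m+2)! with y = c/t. The two powers beyond m leave the factor t^2 that
    gives derivative 0 at the origin. *)
Lemma flat_le m c t : 0 < c ->
  flat m c t <= (m.+2)`!%:R / c ^+ m.+2 * t ^+ 2.
Proof.
move=> c0; have k0 : 0 < (m.+2)`!%:R :> R by rewrite ltr0n fact_gt0.
rewrite /flat; case: ifPn => [t0|_]; last first.
  by rewrite mulr_ge0 ?sqr_ge0// divr_ge0 ?exprn_ge0// ltW.
have z0 : 0 < t^-1 by rewrite invr_gt0.
have y0 : 0 < c * t^-1 by rewrite mulr_gt0.
have h : expR (- (c * t^-1)) <= (m.+2)`!%:R / (c * t^-1) ^+ m.+2.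
  rewrite expRN -[leRHS]invrK lef_pV2 ?posrE ?expR_gt0 ?invr_gt0 ?divr_gt0 ?exprn_gt0//.
  rewrite invf_div.
  by have := expR_ge1Dxn m.+1 (ltW y0); lra.
apply: (@le_trans _ _ (t^-1 ^+ m * ((m.+2)`!%:R / (c * t^-1) ^+ m.+2))).
  by rewrite ler_wpM2l// exprn_ge0// ltW.
rewrite le_eqVlt; apply/orP; left; apply/eqP.
rewrite exprMn -[X in _ / (_ * t^-1 ^+ X)]addn2 exprD.
have zm : t^-1 ^+ m != 0 by rewrite expf_neq0// gt_eqF.
have cm : c ^+ m.+2 != 0 by rewrite expf_neq0// gt_eqF.
have tn : t != 0 by rewrite gt_eqF.
by field; rewrite zm cm tn.
Qed.

Lemma is_derive_flat m (c t : R) : 0 < c ->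
  is_derive t 1 (flat m c) (- m%:R * flat m.+1 c t + c * flat m.+2 c t).
Proof.
move=> c0; have [t0|t0|<-] := ltgtP 0 t.
- have : is_derive t 1 (fun t : R => t^-1 ^+ m * expR (- (c * t^-1)))
      (- m%:R * flat m.+1 c t + c * flat m.+2 c t).
    have tn : t != 0 by rewrite gt_eqF.
    have dV : is_derive t 1 (fun t : R => t^-1) (- t^-1 ^+ 2).
      apply: (is_derive_eq (@is_deriveV R id t 1 1 tn (is_derive_id _ _))).
      by rewrite [_ *: 1]mulr1 exprVn.
    have dX : is_derive t 1 (fun t : R => t^-1 ^+ m) (- m%:R * t^-1 ^+ m.+1).
      apply: (is_derive_eq (is_derive_pow m dV)).
      by case: (m) => [|k]; rewrite ?mul0r ?oppr0 ?mul0r//= !exprS; ring.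
    have dE : is_derive t 1 (fun t : R => expR (- (c * t^-1)))
        (expR (- (c * t^-1)) * (- (c * - t^-1 ^+ 2))).
      apply: (@is_derive_comp1 R _ expR (fun t : R => - (c * t^-1))).
    apply: (is_derive_eq (is_derive_mul dX dE)).
    by rewrite /flat t0 !exprS; ring.
  apply: near_eq_is_derive; near=> s.
  by rewrite /flat ifT//; near: s; apply: open_nbhs_nbhs; split => //; exact: open_gt.
- have -> : - m%:R * flat m.+1 c t + c * flat m.+2 c t = 0.
    by rewrite /flat ltNge ltW//= !mulr0 addr0.
  apply: (near_eq_is_derive (f := fun=> 0)).
  near=> s; rewrite /flat ifF//; apply/negbTE; rewrite -leNgt.
  by apply: ltW; near: s; apply: open_nbhs_nbhs; split => //; exact: open_lt.
- have -> : - m%:R * flat m.+1 c 0 + c * flat m.+2 c 0 = 0.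
    by rewrite /flat ltxx !mulr0 addr0.
  apply: (@is_derive0_sqr _ ((m.+2)`!%:R / c ^+ m.+2)) => t'.
  by rewrite ger0_norm ?flat_ge0// flat_le.
Unshelve. all: by end_near. Qed.

Lemma is_derive_affine (f : R -> R) (u v t d : R) :
  is_derive (u * t + v) 1 f d -> is_derive t 1 (fun t => f (u * t + v)) (u * d).
Proof.
move=> fd; rewrite mulrC.
apply: (@is_derive_comp1 R _ f (fun t => u * t + v)) => //.
rewrite -[X in is_derive _ _ _ X]addr0; apply: is_derive_add.
by rewrite -[X in is_derive _ _ _ X]mulr1; apply: is_derive_scale.
Qed.

(* Closed under differentiation, so that smoothness of the bumps needs no formula for
   their higher derivatives. *)
Inductive bumpy : (R -> R) -> Prop :=
| Bumpy_flat m c u v : 0 < c -> bumpy (fun t => flat m c (u * t + v))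
| Bumpy_add f g : bumpy f -> bumpy g -> bumpy (fun t => f t + g t)
| Bumpy_mul f g : bumpy f -> bumpy g -> bumpy (fun t => f t * g t)
| Bumpy_scale k f : bumpy f -> bumpy (fun t => k * f t).

Lemma bumpy_derive f : bumpy f ->
  exists2 f', bumpy f' & forall t : R, is_derive t 1 f (f' t).
Proof.
elim=> {f} [m c u v c0|f g _ [f' bf' df] _ [g' bg' dg]|f g bf [f' bf' df] bg [g' bg' dg]
    |k f _ [f' bf' df]].
- exists (fun t => u * (- m%:R * flat m.+1 c (u * t + v) + c * flat m.+2 c (u * t + v))).
    by apply: Bumpy_scale; apply: Bumpy_add; apply: Bumpy_scale; exact: Bumpy_flat.
  by move=> t; apply: is_derive_affine; exact: is_derive_flat.
- exists (fun t => f' t + g' t); first exact: Bumpy_add.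
  by move=> t; exact: is_derive_add.
- exists (fun t => f' t * g t + f t * g' t).
    by apply: Bumpy_add; exact: Bumpy_mul.
  by move=> t; exact: is_derive_mul.
- exists (fun t => k * f' t); first exact: Bumpy_scale.
  by move=> t; exact: is_derive_scale.
Qed.

Lemma bumpy_continuous f : bumpy f -> continuous f.
Proof. by move=> /bumpy_derive[f' _ df] t; exact: is_derive_continuous1 (df t). Qed.

Lemma continuous_bigprod (V : normedModType R) (I : Type) (r : seq I)
    (f : I -> V -> R) x : (forall i, {for x, continuous (f i)}) ->
  {for x, continuous (fun y => \prod_(i <- r) f i y)}.
Proof.
move=> h; elim: r => [|i r IH].
  rewrite (_ : (fun y => _) = cst 1); first exact: cst_continuous.
  by apply/funext => y; rewrite big_nil.
rewrite (_ : (fun y => _) = (fun y => f i y * \prod_(j <- r) f j y)).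
  exact: continuousM.
by apply/funext => y; rewrite big_cons.
Qed.

Definition prodfun n (b : 'I_n -> R -> R) (x : 'rV[R]_n) : R :=
  \prod_(i < n) b i (x ord0 i).

Lemma is_derive_prodfun n (b : 'I_n -> R -> R) i b' (x : 'rV[R]_n) :
  is_derive (x ord0 i) 1 (b i) (b' (x ord0 i)) ->
  is_derive x (delta_mx ord0 i : 'rV[R]_n) (prodfun b)
    (prodfun (fun j => if j == i then b' else b j) x).
Proof.
move=> db; have x0 : x = x + 0 *: (delta_mx ord0 i : 'rV[R]_n).
  by rewrite scale0r addr0.
apply/(derivable_line (prodfun b) x0).
pose P := \prod_(j < n | j != i) b j (x ord0 j).
rewrite (_ : (fun t => _) = (fun t : R => P * b i (1 * t + x ord0 i))).
  rewrite (_ : prodfun _ x = P * (1 * b' (x ord0 i))).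
    apply: is_derive_scale; apply: is_derive_affine.
    by rewrite mulr0 add0r.
  rewrite /prodfun (bigD1 i)//= eqxx mul1r mulrC; congr (_ * _).
  by apply: eq_bigr => j /negbTE ->.
apply/funext => t; rewrite /prodfun (bigD1 i)//= mulrC; congr (_ * _).
  by apply: eq_bigr => j ji; rewrite !mxE (negbTE ji) andbF mulr0 addr0.
by rewrite !mxE !eqxx mulr1 mul1r addrC.
Qed.

Lemma class_C_prodfun n k (b : 'I_n -> R -> R) : (forall i, bumpy (b i)) ->
  class_C k setT (prodfun b).
Proof.
elim: k b => [|k IH] b bb; split.
- move=> x _; apply: continuous_bigprod => i.
  apply: (continuous_comp (f := fun y : 'rV[R]_n => y ord0 i)).
    exact: continuous_coord.
  exact: bumpy_continuous.
- by [].
- move=> x _; apply: continuous_bigprod => i.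
  apply: (continuous_comp (f := fun y : 'rV[R]_n => y ord0 i)).
    exact: continuous_coord.
  exact: bumpy_continuous.
- move=> i; have [b' bb' db] := bumpy_derive (bb i).
  have d (x : 'rV[R]_n) := is_derive_prodfun (db (x ord0 i)).
  split=> [x _|]; first by have [] := d x.
  rewrite (_ : partial i _ = prodfun (fun j => if j == i then b' else b j)).
    by apply: IH => j; case: eqP.
  by apply/funext => x; rewrite /partial; have [_ ->] := d x.
Qed.

(** Smooth, with values in [0, 1], positive exactly on the open box, and convergent to its indicator
    as c tends to 0. *)
Definition box_bump n (a b : 'I_n -> R) (c : R) : 'rV[R]_n -> R :=
  prodfun (fun i t => flat 0 c (1 * t + - a i) * flat 0 c (-1 * t + b i)).

Lemma box_bump_out n (a b : 'I_n -> R) c x : ~ rV_box (fun i => `]a i, b i[%classic) x ->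
  box_bump a b c x = 0.
Proof.
move=> /existsNP[i]; rewrite /= in_itv/= => h.
rewrite /box_bump /prodfun (bigD1 i)//= /flat !mul1r mulN1r subr_gt0
  [- _ + _]addrC subr_gt0.
by move: h; case: ltP => //= _; case: ltP => //= _; rewrite ?mulr0 ?mul0r.
Qed.

Lemma test_function_box_bump n (a b : 'I_n -> R) c (Om : set 'rV[R]_n) : 0 < c ->
  rV_box (fun i => `[a i, b i]%classic) `<=` Om ->
  test_function Om (box_bump a b c).
Proof.
move=> c0 abOm.
have cl : closed (rV_box (fun i => `[a i, b i]%classic) : set 'rV[R]_n).
  rewrite (_ : rV_box _ = \bigcap_(i in [set: 'I_n])
     (fun x : 'rV[R]_n => x ord0 i) @^-1` `[a i, b i]%classic).
    apply: closed_bigI => i _; apply: closed_comp; last exact: interval_closed.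
    by move=> x _; exact: continuous_coord.
  by apply/seteqP; split => x h i; [move=> _|]; exact: h.
have sub : closure [set x | box_bump a b c x != 0] `<=` rV_box (fun i => `[a i, b i]%classic).
  rewrite closureE; apply: smallest_sub => // x /= /eqP h i.
  apply: contrapT => hi; apply: h; apply: box_bump_out => /(_ i) h'; apply: hi.
  by apply: subset_itv_oo_cc h'.
split=> [k||].
- apply: class_C_prodfun => i.
  by apply: Bumpy_mul; exact: Bumpy_flat.
- apply: (subclosed_compact _ _ sub); first exact: closed_closure.
  by apply: (@rV_compact _ _ (fun i => `[a i, b i]%classic)) => i; exact: segment_compact.
- exact: subset_trans abOm.
Qed.

Lemma flat0_le1 c t : 0 < c -> 0 <= flat 0 c t <= 1.
Proof.
move=> c0; rewrite flat_ge0/= /flat; case: ifP => // t0.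
by rewrite expr0 mul1r -expR0 ler_expR oppr_le0 mulr_ge0 ?invr_ge0 ?ltW.
Qed.

Lemma box_bump_le1 n (a b : 'I_n -> R) c x : 0 < c -> `|box_bump a b c x| <= 1.
Proof.
move=> c0; rewrite /box_bump /prodfun normr_prod.
apply: (@le_trans _ _ (\prod_(i < n) 1)); last by rewrite big1.
apply: ler_prod => i _; rewrite normr_ge0/= normrM.
have /andP[h1 h2] := flat0_le1 (1 * x ord0 i + - a i) c0.
have /andP[h3 h4] := flat0_le1 (-1 * x ord0 i + b i) c0.
by rewrite !ger0_norm// mulr_ile1.
Qed.

Lemma cvg_box_bump n (a b : 'I_n -> R) (x : 'rV[R]_n) :
  box_bump a b k.+1%:R^-1 x @[k --> \oo] -->
  (\1_(rV_box (fun i => `]a i, b i[%classic)) x : R).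
Proof.
have [xab|xab] := pselect (rV_box (fun i => `]a i, b i[%classic) x); last first.
  rewrite indicE memNset//= (_ : (fun k => _) = cst 0); first exact: cvg_cst.
  by apply/funext => k; rewrite box_bump_out.
rewrite indicE mem_set//=.
have flat1 t : 0 < t -> flat 0 k.+1%:R^-1 t @[k --> \oo] --> (1 : R).
  move=> t0; rewrite /flat t0 -[X in _ --> X]expR0.
  under eq_fun do rewrite expr0 mul1r.
  apply: (@cvg_comp _ _ _ (fun k : nat => - (k.+1%:R^-1 * t^-1)) expR _
    (nbhs (0 : R))); last exact: continuous_expR.
  rewrite -oppr0; apply: cvgN; rewrite -[X in _ --> X](mul0r t^-1).
  by apply: cvgM; [exact: cvg_harmonic|exact: cvg_cst].
rewrite /box_bump /prodfun [X in _ --> X](_ : _ = \prod_(i < n) 1); last by rewrite big1.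
elim: (index_enum _) => [|i r IH].
  rewrite big_nil; under eq_fun do rewrite big_nil; exact: cvg_cst.
rewrite big_cons; under eq_fun do rewrite big_cons.
apply: cvgM => //; rewrite -[X in _ --> X](mul1r 1); apply: cvgM; apply: flat1.
  by have := xab i; rewrite /= in_itv/= => /andP[]; lra.
by have := xab i; rewrite /= in_itv/= => /andP[]; lra.
Qed.

End bump.

(** * Classical derivatives are weak derivatives *)

Section weak.
Context {R : realType} {n : nat}.
Implicit Types (Om S : set 'rV[R]_n) (u v w : 'rV[R]_n -> R).

Lemma compact_bsupp Om S w v : open Om -> compact S -> S `<=` Om ->
  (forall x, Om x -> {for x, continuous w}) ->
  (forall x, {for x, continuous v}) ->
  (forall x, ~ S x -> v x = 0) ->
  exists c M, (forall x, S x -> `|x| <= c) /\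
    bsupp ((fun x => w x * v x) \_ Om) c M.
Proof.
move=> oOm cS SOm cw cv v0.
have [c Sc] : exists c, forall x, S x -> `|x| <= c.
  have [c [_ Sc]] := compact_bounded cS; exists (c + 1) => x Sx.
  by apply: Sc => //; rewrite ltrDl.
have cwv x : Om x -> {for x, continuous (fun x => w x * v x)}.
  by move=> Omx; apply: continuousM; [exact: cw|exact: cv].
have [M SM] : exists M, forall x, S x -> `|w x * v x| <= M.
  have [[x0 Sx0]|S0] := pselect (exists x, S x); last first.
    by exists 0 => x Sx; exfalso; apply: S0; exists x.
  have [|||z _ zP] := @compact_EVT_max _ R (fun x => `|w x * v x|) S.
  - by exists x0.
  - exact: cS.
  - apply: continuous_in_subspaceT => x; rewrite inE/= => Sx.
    apply: (continuous_comp (f := fun x => w x * v x)); last exact: norm_continuous.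
    by apply: cwv; exact: SOm.
  by exists `|w z * v z| => x Sx; apply: zP; rewrite inE.
exists c, (Num.max 0 M); split=> //; split.
- apply/(measurable_restrictT _ (open_measurable_rV oOm)).
  exact: continuous_open_measurable_rV.
- move=> x; rewrite patchE; case: ifPn => [_|_]; last by rewrite normr0 le_max lexx.
  have [Sx|Sx] := pselect (S x); first by rewrite le_max SM ?orbT.
  by rewrite v0// mulr0 normr0 le_max lexx.
- move=> x i cx; rewrite patchE; case: ifP => // _; rewrite v0 ?mulr0// => Sx.
  have := Sc _ Sx; have := ler_coord x i; lra.
Qed.

Lemma near_eq_continuous (V : normedModType R) (f g : V -> R) (x : V) :
  (\near x, f x = g x) -> {for x, continuous f} -> {for x, continuous g}.
Proof.
move=> fg cf A; rewrite -(nbhs_singleton fg) => /cf fA.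
apply: filterS2 fg fA => y /= <-; exact: id.
Qed.

Lemma patch_near Om w x : open Om -> Om x -> \near x, w x = (w \_ Om) x.
Proof.
move=> oOm Omx; near=> y; rewrite patchE mem_set//; near: y.
exact: open_nbhs_nbhs.
Unshelve. all: by end_near. Qed.

Lemma test_fun_partial (Om : set 'rV[R]_n) phi i : test_function Om phi ->
  let S := closure [set x | phi x != 0] in
  [/\ forall x, {for x, continuous phi},
      forall x, is_derive x (delta_mx ord0 i) phi (partial i phi x),
      forall x, {for x, continuous (partial i phi)},
      forall x, ~ S x -> phi x = 0 &
      forall x, ~ S x -> partial i phi x = 0].
Proof.
move=> [cphi cS SOm] S; have [cp /(_ i)[dp [cpp _]]] := cphi 1%N.
have phi0 x : ~ S x -> phi x = 0.
  move=> Sx; apply/eqP; apply: contra_notT Sx => px.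
  exact: subset_closure.
split=> //.
- by move=> x; exact: cp.
- by move=> x; split => //; exact: dp.
- by move=> x; exact: cpp.
move=> x Sx; have oS : open (~` S) by exact/closed_openC/closed_closure.
have : is_derive x (delta_mx ord0 i : 'rV[R]_n) phi 0.
  apply: (near_eq_is_derive (f := fun=> 0)).
  near=> y; apply/esym/phi0; near: y; exact: open_nbhs_nbhs.
by move=> [_ <-].
Unshelve. all: by end_near. Qed.

(** Integration by parts. The product u phi, extended by 0 outside Om, is continuously
    differentiable in direction i on the whole space, since a point outside Om has a neighbourhood
    missing the compact support. Its derivative integrates to 0 on every line. *)
Lemma C1_weak_partial Om i u (Du : 'rV[R]_n -> R) : open Om ->
  (forall x, Om x -> {for x, continuous u}) ->
  (forall x, Om x -> is_derive x (delta_mx ord0 i) u (Du x)) ->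
  (forall x, Om x -> {for x, continuous Du}) ->
  weak_partial Om i u Du.
Proof.
move=> oOm cu du cDu phi tphi.
have [cp dp cdp p0 dp0] := test_fun_partial i tphi.
have [_ cS SOm] := tphi; set S := closure _ in p0 dp0 cS SOm.
have mOm := open_measurable_rV oOm.
have [c1 [M1 [Sc1 b1]]] := compact_bsupp oOm cS SOm cu cdp dp0.
have [c2 [M2 [_ b2]]] := compact_bsupp oOm cS SOm cDu cp p0.
pose g := (fun x => u x * phi x) \_ Om.
pose g1 := (fun x => u x * partial i phi x) \_ Om.
pose g2 := (fun x => Du x * phi x) \_ Om.
pose F x := g1 x + g2 x.
pose c := Num.max 0 (Num.max c1 c2).
have bw f c' M : c' <= c -> bsupp f c' M -> bsupp f c M.
  move=> cc [mf fM f0]; split=> // x j cx; apply: (f0 _ j).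
  exact: le_lt_trans cc cx.
have {}b1 : bsupp g1 c M1 by apply: bw b1; rewrite !le_max lexx !orbT.
have {}b2 : bsupp g2 c M2 by apply: bw b2; rewrite !le_max lexx !orbT.
have bF := bsuppD b1 b2.
have oS : open (~` S) by exact/closed_openC/closed_closure.
have out (f : 'rV[R]_n -> R) x : (forall y, ~ S y -> f y = 0) -> ~ Om x -> \near x, 0 = (f \_ Om) x.
  move=> f0 Omx; near=> y; rewrite patchE; case: ifP => // _; rewrite f0//.
  by near: y; apply: open_nbhs_nbhs; split => // /SOm.
have dg x : is_derive x (delta_mx ord0 i) g (F x).
  have [Omx|Omx] := pselect (Om x).
    apply: (near_eq_is_derive (patch_near _ oOm Omx)).
    rewrite /F /g1 /g2 !patchE mem_set// addrC.
    by apply: is_derive_mul; exact: du.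
  rewrite /F /g1 /g2 !patchE memNset// addr0.
  apply: (near_eq_is_derive (f := fun=> 0)).
  by apply: out => // y Sy; rewrite p0// mulr0.
have cpatch (f : 'rV[R]_n -> R) x : (forall y, Om y -> {for y, continuous f}) ->
    (forall y, ~ S y -> f y = 0) -> {for x, continuous (f \_ Om)}.
  move=> cf f0; have [Omx|Omx] := pselect (Om x).
    by apply: (near_eq_continuous (patch_near f oOm Omx)); exact: cf.
  by apply: (near_eq_continuous (out f x f0 Omx)); exact: cst_continuous.
have cF x : {for x, continuous F}.
  apply: continuousD; apply: cpatch.
  - by move=> y Omy; apply: continuousM; [exact: cu|exact: cdp].
  - by move=> y Sy; rewrite dp0// mulr0.
  - by move=> y Omy; apply: continuousM; [exact: cDu|exact: cp].
  - by move=> y Sy; rewrite p0// mulr0.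
have c0 : 0 <= c by rewrite le_max lexx.
have int0 : (\int[leb n]_x (F x)%:E = 0)%E.
  apply: (integral_slices0 (i := i) bF) => x.
  (* The margin 1 puts both end points strictly outside the support. *)
  transitivity (\int[lebesgue_measure]_(t in `](- (c + 1))%R, (c + 1)%R[)
     (F (setc x i t))%:E)%E.
    rewrite [RHS]integral_mkcond; apply: eq_integral => t _.
    rewrite patchE mem_setE in_itv/= -ltr_norml; case: ltP => // ct.
    have [_ _ F0] := bF; rewrite (F0 _ i)// mxE eqxx.
    by apply: lt_le_trans ct; rewrite ltrDl.
  have gout t : c + 1 <= `|t| -> g (setc x i t) = 0.
    move=> ct; have ct' : c < `|setc x i t ord0 i|.
      by rewrite mxE eqxx; apply: lt_le_trans ct; rewrite ltrDl.
    rewrite /g patchE; case: ifP => // _.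
    rewrite p0 ?mulr0// => /Sc1 Sx; have := ler_coord (setc x i t) i.
    have : c1 <= c by rewrite !le_max lexx !orbT.
    lra.
  rewrite -[RHS](_ : (g (setc x i (c + 1)) - g (setc x i (- (c + 1))))%:E = 0%E); last first.
    by rewrite !gout ?subrr ?normrN// ger0_norm ?addr_ge0.
  apply: (@integral_deriv _ (fun t => g (setc x i t))) => [|t _|t _].
  - lra.
  - exact: is_derive_setc.
  - exact: continuous_setc.
have i1 := bsupp_integrable b1; have i2 := bsupp_integrable b2.
rewrite [LHS]Rintegral_mkcond [in RHS]Rintegral_mkcond -/g1 -/g2.
apply/eqP; rewrite -addr_eq0; apply/eqP.
rewrite -(RintegralD measurableT i1 i2).
by rewrite /Rintegral [X in fine X](_ : _ = 0%E).
Unshelve. all: by end_near. Qed.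

End weak.

(** * Pointwise inequality for the gradients *)

Section density.
Local Open Scope ereal_scope.
Context d (T : measurableType d) (R : realType) (mu : {measure set T -> \bar R}).
Variable F : T -> \bar R.
Hypotheses (mF : measurable_fun setT F) (F0 : forall x, 0 <= F x).

(** The proofs are arguments so that the measure structure can be inferred from the term. *)
Definition density_measure (_ : measurable_fun setT F) (_ : forall x, 0 <= F x)
  (A : set T) : \bar R := \int[mu]_(x in A) F x.

Local Notation dm := (density_measure mF F0).

Let dm0 : dm set0 = 0. Proof. exact: integral_set0. Qed.

Let dm_ge0 A : 0 <= dm A. Proof. exact: integral_ge0. Qed.

Let dm_sigma_additive : semi_sigma_additive dm.
Proof.
move=> A mA tA mUA; rewrite /density_measure ge0_integral_bigcup//.
  by apply: is_cvg_nneseries => k _ _; exact: dm_ge0.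
exact: measurable_funTS.
Qed.

HB.instance Definition _ := isMeasure.Build _ _ _ dm dm0 dm_ge0 dm_sigma_additive.

End density.

Section dubois.
Context {R : realType} {n : nat}.
Implicit Types (a b : 'I_n -> R) (Om : set 'rV[R]_n).

Definition obox a b : set 'rV[R]_n := rV_box (fun i => `]a i, b i[%classic).
Definition cbox a b : set 'rV[R]_n := rV_box (fun i => `[a i, b i]%classic).

Lemma measurable_obox a b : measurable (obox a b).
Proof. exact: measurable_rV_box. Qed.

Lemma measurable_cbox a b : measurable (cbox a b).
Proof. exact: measurable_rV_box. Qed.

Lemma obox_cbox a b : obox a b `<=` cbox a b.
Proof. by move=> x h i; apply: subset_itv_oo_cc; exact: h. Qed.

Lemma compact_cbox a b : compact (cbox a b).
Proof.
by apply: (@rV_compact _ _ (fun i => `[a i, b i]%classic)) => i; exact: segment_compact.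
Qed.

Lemma oboxI a b a' b' : obox a b `&` obox a' b' =
  obox (fun i => Num.max (a i) (a' i)) (fun i => Num.min (b i) (b' i)).
Proof.
apply/seteqP; split=> x.
  move=> [h h'] i; have := h i; have := h' i; rewrite /= !in_itv/= gt_max lt_min.
  by move=> /andP[-> ->] /andP[-> ->].
move=> h; split=> i; have := h i; rewrite /= !in_itv/= gt_max lt_min.
  by move=> /andP[/andP[-> _] /andP[-> _]].
by move=> /andP[/andP[_ ->] /andP[_ ->]].
Qed.

Definition oboxes : set (set 'rV[R]_n) := [set A | exists a b, A = obox a b].

Lemma oboxes_bigcup : \bigcup_k obox (fun=> - k%:R) (fun=> k%:R) = setT.
Proof.
apply/seteqP; split=> // x _; exists (Num.truncn `|x|).+1 => // i /=.
rewrite in_itv/= -ltr_norml; apply: le_lt_trans (ler_coord x i) _.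
exact: truncnS_gt.
Qed.

Lemma measurable_oboxes : @measurable _ 'rV[R]_n = <<s oboxes >>.
Proof.
apply/seteqP; split; last first.
  apply: smallest_sub; first exact: sigma_algebra_measurable.
  by move=> _ [a [b ->]]; exact: measurable_obox.
apply: smallest_sub; first exact: smallest_sigma_algebra.
move=> A; rewrite -bigcup_seq => -[i _ [C mC <-]].
pose f : g_sigma_algebraType oboxes -> R := fun x => (x : 'rV[R]_n) ord0 i.
suff mf : measurable_fun setT f by exact: mf.
apply: (measurability _ (RGenOInfty.measurableE R)) => //.
move=> _ [_ [c ->] <-]; rewrite setTI.
rewrite (_ : f @^-1` _ = \bigcup_k obox (fun j => if j == i then c else - k%:R)
   (fun=> k%:R)).
  by apply: bigcupT_measurable => k; apply: sub_sigma_algebra; do 2 eexists.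
apply/seteqP; split=> x.
  rewrite /f /= in_itv/= andbT => cx.
  exists (Num.truncn `|x|).+1 => // j /=.
  have : `|x ord0 j| < (Num.truncn `|x|).+1%:R.
    by apply: le_lt_trans (ler_coord x j) _; exact: truncnS_gt.
  by rewrite ltr_norml in_itv/=; case: eqP => [-> /andP[_ ->]|_ //]; rewrite cx.
by move=> [k _ /(_ i)]; rewrite /f /= eqxx !in_itv/= andbT => /andP[].
Qed.

(** Uniqueness of measures: open boxes are stable under intersection, generate the sigma-algebra and
    exhaust the space, and the measures with densities F and G are finite on them. *)
Lemma integral_oboxes_eq (F G : 'rV[R]_n -> \bar R) :
  measurable_fun setT F -> measurable_fun setT G ->
  (forall x, 0 <= F x)%E -> (forall x, 0 <= G x)%E ->
  (forall a b, \int[leb n]_(x in obox a b) F x = \int[leb n]_(x in obox a b) G x)%E ->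
  (forall a b, \int[leb n]_(x in obox a b) F x < +oo)%E ->
  forall A, measurable A -> (\int[leb n]_(x in A) F x = \int[leb n]_(x in A) G x)%E.
Proof.
move=> mF mG F0 G0 FG Foo A mA.
apply: (@measure_unique _ R _ oboxes (fun k => obox (fun=> - k%:R) (fun=> k%:R))
   measurable_oboxes _ _ oboxes_bigcup
   (density_measure (leb n) mF F0) (density_measure (leb n) mG G0)) => //.
- move=> _ _ [a [b ->]] [a' [b' ->]]; rewrite oboxI.
  by do 2 eexists.
- by move=> k; do 2 eexists.
- by move=> _ [a [b ->]]; exact: FG.
- by move=> k; exact: Foo.
Qed.

(** The fundamental lemma of the calculus of variations. Bumps show that h has integral 0 over
    boxes; then its positive and negative parts have equal integrals over all measurable sets and
    agree almost everywhere. *)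
Lemma dubois_reymond Om (h : 'rV[R]_n -> R) : open Om ->
  (forall A : set 'rV[R]_n, compact A -> measurable A -> A `<=` Om -> (leb n).-integrable A (EFin \o h)) ->
  (forall phi, test_function Om phi -> \int[leb n]_(x in Om) (h x * phi x) = 0) ->
  forall a b, cbox a b `<=` Om -> {ae leb n, forall x, obox a b x -> h x = 0}.
Proof.
move=> oOm ih hphi a b abOm; have mOm := open_measurable_rV oOm.
(* Dominated convergence, the bumps of the box being at most 1 and tending to its indicator. *)
have claim1 a' b' : cbox a' b' `<=` Om ->
    (\int[leb n]_(x in obox a' b') (h x)%:E = 0)%E.
  move=> Om'; pose D := cbox a' b'.
  have mD : measurable D := measurable_cbox _ _.
  have iD := ih _ (@compact_cbox a' b') mD Om'.
  have mhD : measurable_fun D h.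
    by apply/measurable_EFinP; exact: measurable_int iD.
  pose p k := box_bump a' b' k.+1%:R^-1 : 'rV[R]_n -> R.
  have tp k : test_function Om (p k) by apply: test_function_box_bump.
  have mp k : measurable_fun setT (p k).
    apply: continuous_open_measurable_rV; first exact: openT.
    by have [/(_ 0%N)[]] := tp k.
  have mhp k : measurable_fun D (fun x => h x * p k x).
    by apply: measurable_funM => //; exact: measurable_funTS.
  have [] := @dominated_convergence _ _ _ (leb n) D mD
    (fun k x => (h x * p k x)%:E) (fun x => (h x * \1_(obox a' b') x)%:E)
    (fun x => `|(h x)%:E|%E).
  - by move=> k; exact/measurable_EFinP.
  - apply/measurable_EFinP; apply: measurable_funM => //.
    by apply: measurable_indic; exact: measurable_obox.
  - apply: nearW => x _; apply: cvg_EFin; first exact: nearW.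
    by apply: cvgMr; exact: cvg_box_bump.
  - exact: integrable_abse.
  - apply: nearW => x k _; rewrite lee_fin normrM ler_piMr//.
    exact: box_bump_le1.
  move=> _ _; set I := (X in _ --> X) => cvI.
  have int0 k : (\int[leb n]_(x in D) (h x * p k x)%:E = 0)%E.
    have ihp : (leb n).-integrable D (fun x => (h x * p k x)%:E).
      apply: (le_integrable mD _ _ iD); first exact/measurable_EFinP.
      by move=> x _; rewrite lee_fin normrM ler_piMr// box_bump_le1.
    rewrite -[LHS]fineK; last exact: integrable_fin_num ihp.
    congr EFin; rewrite -[RHS](hphi _ (tp k)) /Rintegral; congr fine.
    rewrite [LHS]integral_mkcond [RHS]integral_mkcond; apply: eq_integral => x _.
    rewrite !patchE; case: ifPn => [|xD].
      by rewrite inE => /Om' /mem_set ->.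
    case: ifPn => // _; rewrite /p box_bump_out ?mulr0// => /obox_cbox xD'.
    by rewrite mem_set in xD.
  have I0 : I = 0%E.
    have := cvI; under eq_fun do rewrite int0.
    by move=> /cvg_lim <-//; rewrite lim_cst.
  rewrite -[RHS]I0 /I [LHS]integral_mkcond [RHS]integral_mkcond.
  apply: eq_integral => x _; rewrite !patchE indicE.
  case: ifPn => [xo|_]; last by rewrite mulr0; case: ifP.
  by rewrite mulr1 mem_set//; apply: obox_cbox; rewrite inE in xo.
(* Restriction to the box makes both parts of h integrable on the whole space, and an integral of
   [H] over a box is one of h over an intersection of boxes, again a box. *)
pose H := (EFin \o h) \_ (obox a b).
have iH : (leb n).-integrable setT H.
  apply/(integrable_mkcond _ (measurable_obox a b)).
  apply: (integrableS (measurable_cbox a b)).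
  - exact: measurable_obox.
  - exact: obox_cbox.
  - by apply: ih => //; [exact: compact_cbox|exact: measurable_cbox].
have mH := measurable_int _ iH.
have mF := measurable_funepos mH; have mG := measurable_funeneg mH.
have iF := integrable_funepos measurableT iH.
have iG := integrable_funeneg measurableT iH.
have FG A : measurable A ->
    (\int[leb n]_(x in A) H^\+ x = \int[leb n]_(x in A) H^\- x)%E.
  apply: integral_oboxes_eq => // a' b'.
    have io f : (leb n).-integrable setT f ->
        (leb n).-integrable (obox a' b') f.
      exact: (integrableS measurableT (measurable_obox _ _)).
    have : (\int[leb n]_(x in obox a' b') H x = 0)%E.
      rewrite -integral_mkcondr oboxI; apply: claim1.
      apply: subset_trans abOm => x hx i; have := hx i; rewrite /= !in_itv/=.
      by rewrite ge_max le_min => /andP[/andP[_ ->] /andP[_ ->]].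
    have mo := measurable_obox a' b'.
    have fF := integrable_fin_num mo (io _ iF).
    have fG := integrable_fin_num mo (io _ iG).
    rewrite integralE => /eqP; rewrite sube_eq ?add0e => [/eqP //|//|].
    exact: fin_num_adde_defr.
  apply: integrable_lty; first exact: measurable_obox.
  exact: (integrableS measurableT (measurable_obox _ _) _ iF).
have : ae_eq (leb n) setT (H^\-)%E (H^\+)%E.
  by apply: integral_ae_eq => // E _ mE; rewrite FG.
apply: filterS => x /(_ I) + xab.
rewrite funeposE funenegE /H patchE mem_set//= => /eqP.
rewrite -!EFin_max eqe => /eqP.
by rewrite !maxEle; case: ifPn; case: ifPn; lra.
Qed.

Lemma compact_measurable_rV (A : set 'rV[R]_n) : compact A -> measurable A.
Proof.
move=> cA; rewrite -[A]setCK; apply: measurableC; apply: open_measurable_rV.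
by apply/closed_openC; apply: compact_closed => //; exact: norm_hausdorff.
Qed.

Lemma compact_leb_lty (A : set 'rV[R]_n) : compact A -> (leb n A < +oo)%E.
Proof.
move=> cA; have [c [_ Ac]] := compact_bounded cA.
apply: le_lt_trans (leb_cube_lty n (c + 1)).
apply: le_measure; rewrite ?inE; [exact: compact_measurable_rV|exact: measurable_cube|].
move=> x Ax i /=; rewrite in_itv/= -ler_norml; apply: le_trans (ler_coord x i) _.
by apply: Ac => //; rewrite ltrDl.
Qed.

(** Because |g| <= 1 + |g|^n, and compact sets have finite measure. *)
Lemma locally_Lp_integrable Om g A : (0 < n)%N -> locally_Lp n%:R Om g ->
  open Om -> compact A -> A `<=` Om -> (leb n).-integrable A (EFin \o g).
Proof.
move=> n0 [mg ig] oOm cA AOm; have mA := compact_measurable_rV cA.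
have i1 : (leb n).-integrable A (EFin \o (fun=> 1 : R)).
  apply: measurable_bounded_integrable => //; first exact: compact_leb_lty.
  by exists 1; split => // y y1 x _; rewrite /= normr1 ltW.
have i2 : (leb n).-integrable A (EFin \o (fun x => `|g x| `^ n%:R)) by exact: ig.
apply: (le_integrable mA _ _ (integrableD mA i1 i2)).
  apply/measurable_EFinP; apply: measurable_funS mg => //.
  exact: open_measurable_rV.
move=> x _ /=; rewrite lee_fin powR_mulrn//.
have p0 : 0 <= `|g x| ^+ n by rewrite exprn_ge0.
rewrite [leRHS]ger0_norm ?addr_ge0//.
have [h|h] := leP `|g x| 1; first lra.
by apply: le_trans (ler_eXnr n0 (ltW h)) _; lra.
Qed.

End dubois.

(** * Uniqueness of weak derivatives and comparison of the gradients of the components *)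

Section quasiregular_grad.
Context {R : realType} {n : nat}.

Lemma harmonic_C1 (Om : set 'rV[R]_n) u : Defs.harmonic Om u ->
  [/\ forall x, Om x -> {for x, continuous u},
      forall i x, Om x -> is_derive x (delta_mx ord0 i) u (partial i u x),
      forall i x, Om x -> {for x, continuous (partial i u)},
      forall i x, Om x ->
        is_derive x (delta_mx ord0 i) (partial i u) (partial i (partial i u) x) &
      forall i x, Om x -> {for x, continuous (partial i (partial i u))}].
Proof.
move=> [[cu du] _]; split=> //.
- by move=> i x Omx; split => //; have [h _] := du i; exact: h.
- by move=> i x Omx; have [_ [h _]] := du i; exact: h.
- move=> i x Omx; split => //; have [_ [_ h]] := du i.
  by have [h' _] := h i; exact: h'.
- move=> i x Omx; have [_ [_ h]] := du i.
  by have [_ [h' _]] := h i; exact: h'.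
Qed.

Lemma continuous_compact_integrable Om (g : 'rV[R]_n -> R) A :
  open Om ->
  (forall x, Om x -> {for x, continuous g}) -> compact A -> A `<=` Om ->
  (leb n).-integrable A (EFin \o g).
Proof.
move=> oOm cg cA AOm; have mA := compact_measurable_rV cA.
apply: measurable_bounded_integrable => //; first exact: compact_leb_lty.
  apply: (measurable_funS (open_measurable_rV oOm) AOm).
  exact: continuous_open_measurable_rV.
have : compact (g @` A).
  apply: continuous_compact => //; apply: continuous_in_subspaceT => x.
  by rewrite inE => /AOm; exact: cg.
move=> /compact_bounded[M [Mr AM]]; exists M; split => // y My x Ax.
by apply: (AM y My); exists x.
Qed.

(** Both g and Du are weak derivatives of u, so their difference is orthogonal to every test
    function. *)
Lemma weak_partial_ae (u g Du : 'rV[R]_n -> R) Om i : (0 < n)%N -> open Om ->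
  (forall x, Om x -> {for x, continuous u}) ->
  (forall x, Om x -> is_derive x (delta_mx ord0 i) u (Du x)) ->
  (forall x, Om x -> {for x, continuous Du}) ->
  locally_Lp n%:R Om g -> weak_partial Om i u g ->
  forall a b, cbox a b `<=` Om -> {ae leb n, forall x, obox a b x -> g x = Du x}.
Proof.
move=> n0 oOm cu du cDu lg wg a b abOm.
have mOm := open_measurable_rV oOm.
have iDu A : compact A -> A `<=` Om -> (leb n).-integrable A (EFin \o Du).
  exact: continuous_compact_integrable.
have wDu := C1_weak_partial oOm cu du cDu.
have := @dubois_reymond R n Om (fun x => g x - Du x) oOm _ _ a b abOm.
move=> /(_ _ _)/wrap[].
- move=> A cA mA AOm.
  have := integrableB mA (locally_Lp_integrable n0 lg oOm cA AOm) (iDu A cA AOm).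
  exact.
- move=> phi tphi; have [_ cS SOm] := tphi.
  set S := closure _ in cS SOm; have mS := compact_measurable_rV cS.
  have cp x : {for x, continuous phi}.
    by have [/(_ 0%N)[h _] _ _] := tphi; exact: h.
  have p0 x : ~ S x -> phi x = 0.
    move=> Sx; apply/eqP; apply: contra_notT Sx => px.
    exact: subset_closure.
  have [M pM] : exists M, forall x, S x -> `|phi x| <= M.
    have : compact (phi @` S).
      apply: continuous_compact => //; apply: continuous_in_subspaceT => x _.
      exact: cp.
    move=> /compact_bounded[M [Mr AM]]; exists (M + 1) => x Sx.
    by apply: (AM (M + 1)); [rewrite ltrDl|exists x].
  have ip f : measurable_fun Om f ->
      (forall A, compact A -> A `<=` Om -> (leb n).-integrable A (EFin \o f)) ->
      (leb n).-integrable Om (EFin \o (fun x => f x * phi x)).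
    move=> mf i_f.
    have iS : (leb n).-integrable S (EFin \o (fun x => f x * phi x)).
      apply: (le_integrable mS _ _ (integrableZl mS M (i_f _ cS SOm))).
        apply/measurable_EFinP; apply: measurable_funM.
          exact: (measurable_funS mOm SOm).
        apply: measurable_funTS; apply: continuous_open_measurable_rV => //.
        exact: openT.
      move=> x Sx /=; rewrite lee_fin !normrM mulrC ler_wpM2r//.
      by apply: le_trans (pM _ Sx) _; exact: ler_norm.
    apply/(integrable_mkcond _ mOm); have := (integrable_mkcond _ mS).1 iS.
    congr (integrable _ _ _); apply/funext => x; rewrite !patchE.
    have [Sx|Sx] := pselect (S x); first by rewrite !mem_set//; exact: SOm.
    by rewrite memNset//=; case: ifP => // _; rewrite p0// mulr0.
  have i1 := ip _ lg.1 (fun A cA AOm => locally_Lp_integrable n0 lg oOm cA AOm).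
  have i2 : (leb n).-integrable Om (EFin \o (fun x => Du x * phi x)).
    by apply: ip => //; exact: continuous_open_measurable_rV.
  under eq_Rintegral do rewrite mulrBl.
  rewrite (RintegralB mOm i1 i2); apply/eqP; rewrite subr_eq0; apply/eqP.
  by apply: oppr_inj; rewrite -[LHS](wg phi tphi) -[RHS](wDu phi tphi).
by apply: filterS => x h /h /eqP; rewrite subr_eq0 => /eqP.
Qed.

(** If the inequality failed at one point, continuity of the classical derivatives would make it
    fail on a box around that point. There weak and classical derivatives agree almost everywhere
    and satisfy the distortion inequality, so the box would be null, against its positive volume. *)
Lemma quasiregular_grad K (f : 'rV[R]_n -> 'rV[R]_n) : (0 < n)%N -> 1 <= K ->
  harmonic_quasiregular K f -> forall x, unit_ball R n x -> forall j k,
  \sum_i partial i (fun x => f x ord0 j) x ^+ 2 <=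
  K ^+ 2 * \sum_i partial i (fun x => f x ord0 k) x ^+ 2.
Proof.
move=> n0 K1 [[_ [Df [wDf aeDf]]] hf] x0 Bx0 j k.
have oB : open (unit_ball R n) by exact: (@open_eball R n 1).
pose D (l i : 'I_n) := partial i (fun x => f x ord0 l).
pose w x := \sum_i D j i x ^+ 2 - K ^+ 2 * \sum_i D k i x ^+ 2.
rewrite -subr_le0 -/(w x0) leNgt; apply/negP => w0.
have cD l i x : unit_ball R n x -> {for x, continuous (D l i)}.
  by have [_ _ h _ _] := harmonic_C1 (hf l); exact: h.
have cw : {for x0, continuous w}.
  have cs l : {for x0, continuous (fun x => \sum_i D l i x ^+ 2)}.
    apply: continuous_bigsum => i.
    apply: (continuous_comp (f := D l i) (g := fun t => t ^+ 2)); first exact: cD.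
    exact: exprn_continuous.
  apply: continuousB; first exact: cs.
  by apply: continuousM; [exact: cst_continuous|exact: cs].
have [d d0 dP] : exists2 d, 0 < d & forall y : 'rV[R]_n,
    (forall i, `|x0 ord0 i - y ord0 i| < d) -> unit_ball R n y /\ 0 < w y.
  apply: box_nbhs; apply: filterI; first exact: open_nbhs_nbhs.
  apply: (cw [set t | 0 < t]); apply: open_nbhs_nbhs; split => //.
pose a i := x0 ord0 i - d / 2; pose b i := x0 ord0 i + d / 2.
have abP y : cbox a b y -> unit_ball R n y /\ 0 < w y.
  move=> yab; apply: dP => i; have := yab i; rewrite /= in_itv/= /a /b.
  by rewrite ltr_norml; lra.
have aeD : {ae leb n, forall x, obox a b x -> forall l i, Df x i l = D l i x}.
  have : {ae leb n, forall x, forall l i, obox a b x -> Df x i l = D l i x}.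
    apply: (@filter_forall _ 'I_n (fun l x => forall i, obox a b x -> Df x i l = D l i x)).
    move=> l; apply: (@filter_forall _ 'I_n (fun i x => obox a b x -> Df x i l = D l i x)).
    move=> i; have [c1 c2 c3 _ _] := harmonic_C1 (hf l).
    have [lD wD] := wDf i l.
    apply: (weak_partial_ae n0 oB c1 (c2 i) (c3 i) lD wD).
    by move=> y /abP[].
  by apply: filterS => x h ox l i; exact: h.
have : {ae leb n, forall x, ~ obox a b x}.
  apply: filterS2 aeD aeDf => x h1 h2 ox.
  have [Bx] := abP _ (obox_cbox ox); apply/negP; rewrite -leNgt /w subr_le0.
  have := quasiconformal_columns n0 (le_trans ler01 K1) (h2 Bx) j k.
  by under eq_bigr do rewrite h1//; under [X in _ <= _ * X]eq_bigr do rewrite h1//.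
move=> [N [mN N0 sN]].
have : (0 < leb n (obox a b))%E.
  rewrite leb_itv_box; first by rewrite lte_fin prodr_gt0// => i _; rewrite /a /b; lra.
  by move=> i; rewrite /a /b; lra.
apply/negP; rewrite -leNgt -N0; apply: le_measure; rewrite ?inE//.
  exact: measurable_obox.
by move=> x ox; apply: sN => /=; apply.
Qed.

End quasiregular_grad.

(** * Powers of two functions *)

Section C2_rules.
Context {R : realType} {n : nat} (Om : set 'rV[R]_n).
Implicit Types (H G : 'rV[R]_n -> R) (DH D2H DG D2G : 'I_n -> 'rV[R]_n -> R).

Lemma C2_cst k : C2 Om (fun=> k) (fun _ _ => 0) (fun _ _ => 0).
Proof. by split=> *; first [exact: cst_continuous|exact: is_derive_cst]. Qed.

Lemma C2_add H DH D2H G DG D2G : C2 Om H DH D2H -> C2 Om G DG D2G ->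
  C2 Om (fun x => H x + G x) (fun i x => DH i x + DG i x)
    (fun i x => D2H i x + D2G i x).
Proof.
move=> [h1 h2 h3 h4 h5] [g1 g2 g3 g4 g5]; split.
- by move=> x Ox; apply: continuousD; [exact: h1|exact: g1].
- by move=> i x Ox; apply: is_derive_add; [exact: h2|exact: g2].
- by move=> i x Ox; apply: continuousD; [exact: h3|exact: g3].
- by move=> i x Ox; apply: is_derive_add; [exact: h4|exact: g4].
- by move=> i x Ox; apply: continuousD; [exact: h5|exact: g5].
Qed.

Lemma C2_scale k H DH D2H : C2 Om H DH D2H ->
  C2 Om (fun x => k * H x) (fun i x => k * DH i x) (fun i x => k * D2H i x).
Proof.
have cs f x : {for x, continuous f} -> {for x, continuous (fun y : 'rV[R]_n => k * f y)}.
  by move=> cf; apply: continuousM => //; exact: cst_continuous.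
move=> [h1 h2 h3 h4 h5]; split.
- by move=> x Ox; apply: cs; exact: h1.
- by move=> i x Ox; apply: is_derive_scale; exact: h2.
- by move=> i x Ox; apply: cs; exact: h3.
- by move=> i x Ox; apply: is_derive_scale; exact: h4.
- by move=> i x Ox; apply: cs; exact: h5.
Qed.

Lemma C2_mul H DH D2H G DG D2G : C2 Om H DH D2H -> C2 Om G DG D2G ->
  C2 Om (fun x => H x * G x) (fun i x => DH i x * G x + H x * DG i x)
    (fun i x => (D2H i x * G x + DH i x * DG i x) +
                (DH i x * DG i x + H x * D2G i x)).
Proof.
have cm (f g : 'rV[R]_n -> R) x : {for x, continuous f} -> {for x, continuous g} ->
    {for x, continuous (fun y : 'rV[R]_n => f y * g y : R)}.
  by move=> cf cg; exact: continuousM.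
move=> [h1 h2 h3 h4 h5] [g1 g2 g3 g4 g5]; split.
- by move=> x Ox; apply: cm; [exact: h1|exact: g1].
- by move=> i x Ox; apply: is_derive_mul; [exact: h2|exact: g2].
- move=> i x Ox; apply: continuousD.
    by apply: cm; [exact: h3|exact: g1].
  by apply: cm; [exact: h1|exact: g3].
- move=> i x Ox; apply: is_derive_add.
    by apply: is_derive_mul; [exact: h4|exact: g2].
  by apply: is_derive_mul; [exact: h2|exact: g4].
- move=> i x Ox; apply: continuousD; apply: continuousD.
  + by apply: cm; [exact: h5|exact: g1].
  + by apply: cm; [exact: h3|exact: g3].
  + by apply: cm; [exact: h3|exact: g3].
  + by apply: cm; [exact: h1|exact: g5].
Qed.

Lemma C2_bigsum (I : Type) (r : seq I) (H : I -> 'rV[R]_n -> R)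
    (DH D2H : I -> 'I_n -> 'rV[R]_n -> R) :
  (forall j, C2 Om (H j) (DH j) (D2H j)) ->
  C2 Om (fun x => \sum_(j <- r) H j x) (fun i x => \sum_(j <- r) DH j i x)
    (fun i x => \sum_(j <- r) D2H j i x).
Proof.
move=> h; split.
- by move=> x Ox; apply: continuous_bigsum => j; have [h1 _ _ _ _] := h j; exact: h1.
- by move=> i x Ox; apply: is_derive_bigsum => j; have [_ h1 _ _ _] := h j; exact: h1.
- by move=> i x Ox; apply: continuous_bigsum => j; have [_ _ h1 _ _] := h j; exact: h1.
- by move=> i x Ox; apply: is_derive_bigsum => j; have [_ _ _ h1 _] := h j; exact: h1.
- by move=> i x Ox; apply: continuous_bigsum => j; have [_ _ _ _ h1] := h j; exact: h1.
Qed.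

Lemma powR_continuous1 (q t : R) : 0 < t -> {for t, continuous (fun t => t `^ q)}.
Proof. by move=> t0; exact: is_derive_continuous1 (is_derive1_powR q t0). Qed.

Lemma C2_powR (q : R) H DH D2H : C2 Om H DH D2H -> (forall x, Om x -> 0 < H x) ->
  C2 Om (fun x => H x `^ q) (fun i x => q * H x `^ (q - 1) * DH i x)
    (fun i x => q * ((q - 1) * H x `^ (q - 2) * DH i x) * DH i x +
                q * H x `^ (q - 1) * D2H i x).
Proof.
move=> [h1 h2 h3 h4 h5] H0.
have cp r x : Om x -> {for x, continuous (fun y : 'rV[R]_n => H y `^ r)}.
  move=> Ox; apply: (continuous_comp (f := H) (g := fun t => t `^ r)).
    exact: h1.
  by apply: powR_continuous1; exact: H0.
have dp r i (x : 'rV[R]_n) : Om x -> is_derive x (delta_mx ord0 i) (fun y => H y `^ r)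
    (r * H x `^ (r - 1) * DH i x).
  move=> Ox; apply: (@is_derive_comp1 R _ (fun t => t `^ r) H).
    by apply: is_derive1_powR; exact: H0.
  exact: h2.
have cm (f g : 'rV[R]_n -> R) x : {for x, continuous f} -> {for x, continuous g} ->
    {for x, continuous (fun y : 'rV[R]_n => f y * g y : R)}.
  by move=> cf cg; exact: continuousM.
have cs (k : R) (f : 'rV[R]_n -> R) x : {for x, continuous f} ->
    {for x, continuous (fun y : 'rV[R]_n => k * f y : R)}.
  by move=> cf; apply: cm => //; exact: cst_continuous.
have q2 : q - 1 - 1 = q - 2 by ring.
split.
- by move=> x Ox; exact: cp.
- by move=> i x Ox; exact: dp.
- by move=> i x Ox; apply: cm; [apply: cs; exact: cp|exact: h3].
- move=> i x Ox; apply: is_derive_mul; last exact: h4.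
  by apply: is_derive_scale; have := dp (q - 1) i x Ox; rewrite q2.
- move=> i x Ox; apply: continuousD; apply: (@cm).
  + by apply: (@cs); apply: (@cm); [apply: cs; exact: cp|exact: h3].
  + exact: h3.
  + by apply: cs; exact: cp.
  + exact: h5.
Qed.

End C2_rules.

(** With t = sqrt(a/s) and W = s^(q-1) G, the Laplacian of a s^(q-1) is at least (2 - c t) W. The
    part 8 (q-1) L comes from the scalar product of the gradients, the part 4 (q-1) |q-2| L from the
    squared gradient of s. *)
Definition coefc (R : realType) (q L : R) := (q - 1) * L * (8 + 4 * `|q - 2|).
(** The Laplacian of s^q is at most 4 q (q-1) L W + 2 q L W, which is [coefB] times W. *)
Definition coefB (R : realType) (q L : R) := 2 * q * (2 * q - 1) * L.
(** Chosen so that, once a >= c^-2 s, the lower bound 2 q a^(q-1) G for the Laplacian of a^q is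
    worth at least B c W after multiplication by A. *)
Definition coefA (R : realType) (q L : R) :=
  coefB q L * coefc q L / (2 * q * (coefc q L ^- 2) `^ (q - 1)).

Ltac nonneg := first
  [ assumption | apply: ltW; assumption | exact: normr_ge0 | exact: powR_ge0
  | by rewrite subr_ge0 | apply: mulr_ge0; nonneg | apply: divr_ge0; nonneg
  | apply: exprn_ge0; nonneg | lra ].

Section laplacian_numeric.
Context {R : realType}.
(** Values at one point. In the application G is |grad f_k|^2, N is the sum of all |grad f_j|^2, and
    a and s are f_k^2 + e and |f|^2 + e; the bound on Sa comes from |grad f_k^2|^2 = 4 f_k^2 |grad
    f_k|^2. *)
Variables (q L a s G N Sa Ss C : R).
Hypotheses (L1 : 1 <= L) (a0 : 0 < a) (as_ : a <= s) (G0 : 0 <= G)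
  (N0 : 0 <= N) (NL : N <= L * G) (Sa0 : 0 <= Sa) (SaG : Sa <= 4 * (a * G))
  (Ss0 : 0 <= Ss) (SsN : Ss <= 4 * (s * N)) (CS : C ^+ 2 <= Sa * Ss).

Let L0 : 0 < L. Proof. exact: lt_le_trans L1. Qed.

Let s0 : 0 < s. Proof. exact: lt_le_trans as_. Qed.

(* The Laplacians of a^q, s^q and a s^(q-1), when a and s have gradients of
   squared norms Sa, Ss and scalar product C, and Laplacians 2G and 2N. *)
Definition lap_pow (t S M : R) :=
  q * ((q - 1) * t `^ (q - 2) * S) + q * t `^ (q - 1) * (2 * M).

Definition lap_mix :=
  2 * G * s `^ (q - 1) + 2 * ((q - 1) * s `^ (q - 2) * C) +
  a * ((q - 1) * ((q - 2) * s `^ (q - 3) * Ss) + (q - 1) * s `^ (q - 2) * (2 * N)).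

Lemma powR_sub1 (t r : R) : 0 < t -> t `^ r = t * t `^ (r - 1).
Proof.
move=> t0; rewrite -{2}(powRr1 (ltW t0)) -powRD ?subrKC//.
by apply/implyP => _; rewrite gt_eqF.
Qed.

(** Since Sa <= 4 a G and q - 1 <= 0, the Laplacian of a^q is at least 2 q (2q-1) a^(q-1) G. That of
    s^q is at most 2 q s^(q-1) N <= 2 q L a^(q-1) G, because its gradient term is nonpositive and s
    >= a. The quotient of the two constants is L/(2q-1), which is where p = 2q > 1 enters. *)
Lemma lap_pow_lt1 : 1 / 2 < q -> q <= 1 ->
  0 <= L / (2 * q - 1) * lap_pow a Sa G - lap_pow s Ss N.
Proof.
move=> q12 q1; rewrite /lap_pow.
have q21 : q - 1 - 1 = q - 2 by ring.
have Ea := powR_sub1 (q - 1) a0; have Es := powR_sub1 (q - 1) s0.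
rewrite q21 in Ea Es; rewrite {}Ea {}Es.
set X := a `^ (q - 2); set Y := s `^ (q - 2).
have X0 : 0 < X by exact: powR_gt0.
have Y0 : 0 < Y by exact: powR_gt0.
have sYaX : s * Y <= a * X.
  rewrite /X /Y -{1}(powRr1 (ltW s0)) -{1}(powRr1 (ltW a0)).
  rewrite -!powRD; try by apply/implyP => _; rewrite gt_eqF.
  rewrite (_ : 1 + (q - 2) = - (1 - q)); last by ring.
  rewrite !powRN lef_pV2 ?posrE ?powR_gt0//.
  by apply: ge0_ler_powR; rewrite ?nnegrE ?(ltW a0) ?(ltW s0)//; lra.
have h1 : 0 <= (1 - q) * (X * (4 * (a * G) - Sa)).
  by apply: mulr_ge0; [lra|apply: mulr_ge0; [exact: ltW|by rewrite subr_ge0]].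
have h2 : 0 <= (1 - q) * (Y * Ss).
  by apply: mulr_ge0; [lra|apply: mulr_ge0; [exact: ltW|exact: Ss0]].
have l1 : 2 * q * (2 * q - 1) * (a * X * G) <=
    q * ((q - 1) * X * Sa) + q * (a * X) * (2 * G).
  have := mulr_ge0 (ltW (lt_trans _ q12 : 0 < q)) h1; lra.
have l2 : q * ((q - 1) * Y * Ss) + q * (s * Y) * (2 * N) <= 2 * q * L * (a * X * G).
  have hN : s * Y * N <= a * X * (L * G).
    by apply: ler_pM => //; rewrite mulr_ge0 ?(ltW s0) ?(ltW Y0).
  have := mulr_ge0 (ltW (lt_trans _ q12 : 0 < q)) h2.
  have : 0 <= q * (a * X * (L * G) - s * Y * N) by rewrite mulr_ge0; lra.
  lra.
rewrite subr_ge0; apply: le_trans l2 _.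
have -> : 2 * q * L * (a * X * G) =
    L / (2 * q - 1) * (2 * q * (2 * q - 1) * (a * X * G)).
  by field; lra.
by apply: ler_wpM2l l1; apply: divr_ge0; [exact: ltW|lra].
Qed.

Lemma lap_pow_gt1 : 1 < q ->
  0 <= coefA q L * lap_pow a Sa G + coefB q L * lap_mix - lap_pow s Ss N.
Proof.
move=> q1; rewrite /coefA; set c := coefc q L; set B := coefB q L.
set A := _ / _.
have c0 : 0 < c.
  rewrite /c /coefc; apply: mulr_gt0; last by have := normr_ge0 (q - 2); lra.
  by apply: mulr_gt0; [rewrite subr_gt0|exact: lt_le_trans L1].
have B0 : 0 < B.
  rewrite /B /coefB; apply: mulr_gt0 => //; apply: mulr_gt0; lra.
have k0 : 0 < (c ^- 2) `^ (q - 1) by rewrite powR_gt0// invr_gt0 exprn_gt0.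
have A0 : 0 <= A by rewrite /A; nonneg.
have q21 : q - 1 - 1 = q - 2 by ring.
have q32 : q - 2 - 1 = q - 3 by ring.
pose X := a `^ (q - 1); pose Y := s `^ (q - 3).
have X0 : 0 < X by exact: powR_gt0.
have Y0 : 0 < Y by exact: powR_gt0.
have Es2 : s `^ (q - 2) = s * Y by rewrite (powR_sub1 (q - 2) s0) q32.
have Es1 : s `^ (q - 1) = s * (s * Y) by rewrite (powR_sub1 (q - 1) s0) q21 Es2.
(* The square root is the natural scale: C, bounded by the geometric mean of Sa and Ss, is of order
   t. *)
pose t := Num.sqrt (a / s).
have t0 : 0 < t by rewrite sqrtr_gt0 divr_gt0.
have t2 : t ^+ 2 = a / s by rewrite sqr_sqrtr// divr_ge0 ?(ltW a0) ?(ltW s0).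
have at2 : a = t ^+ 2 * s by rewrite t2 divfK// gt_eqF.
have t1 : t <= 1.
  by rewrite -(@ler_pXn2r _ 2)// ?nnegrE ?(ltW t0)// expr1n t2 ler_pdivrMr// mul1r.
(* C^2 <= Sa Ss <= 16 a s G N, where a = t^2 s and N <= L G; then L >= 1 allows L to be replaced by
   L^2, so that a square root can be taken. *)
have C_le : `|C| <= 4 * (t * (s * (L * G))).
  have p0 : 0 <= t * (s * (L * G)).
    nonneg.
  rewrite -(@ler_pXn2r _ 2)//; last by rewrite nnegrE; nonneg.
  rewrite real_normK ?num_real//.
  apply: le_trans CS _; apply: (@le_trans _ _ (4 * (a * G) * (4 * (s * N)))).
    by apply: ler_pM.
  have -> : (4 * (t * (s * (L * G)))) ^+ 2 = 16 * (a * s * (L * G * (L * G))).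
    by rewrite at2; ring.
  have -> : 4 * (a * G) * (4 * (s * N)) = 16 * (a * s * (G * N)) by ring.
  rewrite ler_pM2l// ler_pM2l ?mulr_gt0//.
  apply: le_trans (_ : G * (L * G) <= _); first by rewrite ler_wpM2l.
  by apply: ler_wpM2r; [exact: le_trans NL|rewrite -{1}[G]mul1r ler_wpM2r].
have Ss_le : Ss <= 4 * (s * (L * G)).
  by apply: le_trans SsN _; rewrite !ler_pM2l.
pose W := s * s * Y * G.
have W0 : 0 <= W by rewrite /W !mulr_ge0 ?(ltW s0) ?(ltW Y0).
have l1 : 2 * q * (X * G) <= lap_pow a Sa G.
  rewrite /lap_pow -/X -subr_ge0.
  have -> : q * ((q - 1) * a `^ (q - 2) * Sa) + q * X * (2 * G) - 2 * q * (X * G) =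
    q * ((q - 1) * a `^ (q - 2) * Sa) by ring.
  nonneg.
have l2 : (2 - c * t) * W <= lap_mix.
  rewrite /lap_mix Es1 Es2 -/Y.
  have m1 : - (8 * (q - 1) * L * t * W) <= 2 * ((q - 1) * (s * Y) * C).
    have h : 0 <= (2 * (q - 1) * (s * Y)) * (4 * (t * (s * (L * G))) + C).
      apply: mulr_ge0; first nonneg.
      by have := ler_norm (- C); rewrite normrN; lra.
    rewrite -subr_ge0; move: h; congr (0 <= _); rewrite /W; ring.
  (* The factor a gives t^2, weakened to t so that both negative contributions are linear in t. The
     sign of q - 2 is unknown, hence the absolute value. *)
  have m2 : - (4 * (q - 1) * `|q - 2| * L * t * W) <=
      a * ((q - 1) * ((q - 2) * Y * Ss)).
    have n0 := normr_ge0 (q - 2).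
    have h1 : 0 <= a * (q - 1) * Y * Ss * (`|q - 2| + (q - 2)).
      apply: mulr_ge0; first nonneg.
      by have := ler_norm (- (q - 2)); rewrite normrN; lra.
    have h2 : 0 <= a * (q - 1) * Y * `|q - 2| * (4 * (s * (L * G)) - Ss).
      nonneg.
    have h3 : 0 <= (4 * (q - 1) * `|q - 2| * L * W) * (t * (1 - t)).
      nonneg.
    have e3 : a * (q - 1) * Y * `|q - 2| * (4 * (s * (L * G))) =
       4 * (q - 1) * `|q - 2| * L * W * t ^+ 2 by rewrite /W {1}at2; ring.
    have e4 : 4 * (q - 1) * `|q - 2| * L * W * (t * (1 - t)) =
       4 * (q - 1) * `|q - 2| * L * t * W - 4 * (q - 1) * `|q - 2| * L * W * t ^+ 2.
      by ring.
    have e1 : a * (q - 1) * Y * Ss * (`|q - 2| + (q - 2)) =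
      a * (q - 1) * Y * `|q - 2| * Ss + a * ((q - 1) * ((q - 2) * Y * Ss)) by ring.
    have e2 : a * (q - 1) * Y * `|q - 2| * (4 * (s * (L * G)) - Ss) =
      a * (q - 1) * Y * `|q - 2| * (4 * (s * (L * G))) - a * (q - 1) * Y * `|q - 2| * Ss.
      by ring.
    lra.
  have m3 : 0 <= a * ((q - 1) * (s * Y) * (2 * N)).
    nonneg.
  have -> : (2 - c * t) * W = 2 * W - 8 * (q - 1) * L * t * W
      - 4 * (q - 1) * `|q - 2| * L * t * W by rewrite /c /coefc; ring.
  have -> : 2 * G * (s * (s * Y)) = 2 * W by rewrite /W; ring.
  rewrite mulrDr; lra.
have l3 : lap_pow s Ss N <= B * W.
  rewrite /lap_pow Es1 Es2 -/Y.
  have h1 : 0 <= q * (q - 1) * (s * Y) * (4 * (s * (L * G)) - Ss).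
    nonneg.
  have h2 : 0 <= 2 * q * (s * s * Y) * (L * G - N).
    nonneg.
  rewrite -subr_ge0.
  have -> : B * W - (q * ((q - 1) * (s * Y) * Ss) + q * (s * (s * Y)) * (2 * N)) =
    q * (q - 1) * (s * Y) * (4 * (s * (L * G)) - Ss) +
    2 * q * (s * s * Y) * (L * G - N) by rewrite /B /coefB /W; ring.
  exact: addr_ge0.
have BA : 0 <= A * (2 * q * (X * G)) + B * ((2 - c * t) * W) - B * W.
  (* If c t <= 1, the mixed term alone yields B W. Otherwise a >= c^-2 s, and the term with A
     contributes at least B c W, which covers the loss B c t W because t <= 1. *)
  have [ct|ct] := leP (c * t) 1.
    have : 0 <= A * (2 * q * (X * G)).
      nonneg.
    have : 0 <= B * ((1 - c * t) * W).
      nonneg.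
    have -> : B * ((2 - c * t) * W) = B * ((1 - c * t) * W) + B * W by ring.
    lra.
  have XE : (c ^- 2) `^ (q - 1) * (s * s * Y) <= X.
    have -> : s * s * Y = s `^ (q - 1) by rewrite Es1 mulrA.
    rewrite -powRM ?invr_ge0 ?exprn_ge0 ?(ltW c0) ?(ltW s0)// /X.
    apply: ge0_ler_powR; rewrite ?nnegrE ?mulr_ge0 ?invr_ge0 ?exprn_ge0 ?(ltW c0) ?(ltW s0) ?(ltW a0)//.
      lra.
    rewrite at2 ler_pM2r// -[leLHS]mul1r ler_pdivrMr ?exprn_gt0// -exprMn.
    by rewrite -[leLHS](expr1n _ 2) ler_pXn2r ?nnegrE// ?(ltW ct) 1?mulrC//; nonneg.
  have h1 : B * c * W <= A * (2 * q * (X * G)).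
    have -> : B * c * W = A * (2 * q * ((c ^- 2) `^ (q - 1) * (s * s * Y) * G)).
      by rewrite /A /W; field; rewrite !gt_eqF//; lra.
    by rewrite ler_wpM2l// ler_pM2l ?ler_wpM2r//; lra.
  have h2 : 0 <= B * c * W * (1 - t).
    nonneg.
  have h3 : 0 <= B * W by nonneg.
  have -> : B * ((2 - c * t) * W) = 2 * (B * W) - B * c * W + B * c * W * (1 - t) by ring.
  lra.
have := ler_wpM2l A0 l1; have := ler_wpM2l (ltW B0) l2; lra.
Qed.

End laplacian_numeric.

(** * Subharmonic combinations of powers *)

Section power_submean.
Context {R : realType} {n : nat}.
Local Notation B := (unit_ball R n).
Variables (a s G N : 'rV[R]_n -> R) (Da D2a Ds D2s : 'I_n -> 'rV[R]_n -> R).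
Variables (L r : R).
Hypotheses (L1 : 1 <= L) (r01 : 0 <= r < 1).
Hypotheses (C2a : C2 B a Da D2a) (C2s : C2 B s Ds D2s).
Hypotheses (a0 : forall x, B x -> 0 < a x) (as_ : forall x, B x -> a x <= s x).
Hypotheses (G0 : forall x, B x -> 0 <= G x) (N0 : forall x, B x -> 0 <= N x).
Hypotheses (NL : forall x, B x -> N x <= L * G x).
Hypotheses (lapa : forall x, B x -> \sum_i D2a i x = 2 * G x).
Hypotheses (laps : forall x, B x -> \sum_i D2s i x = 2 * N x).
Hypotheses (grada : forall x, B x -> \sum_i Da i x ^+ 2 <= 4 * (a x * G x)).
Hypotheses (grads : forall x, B x -> \sum_i Ds i x ^+ 2 <= 4 * (s x * N x)).

Let s0 x : B x -> 0 < s x.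
Proof. by move=> Bx; apply: lt_le_trans (as_ Bx); exact: a0. Qed.

Lemma sum_lap_pow q t (Dt D2t : 'I_n -> 'rV[R]_n -> R) M x :
  \sum_i D2t i x = 2 * M ->
  \sum_i (q * ((q - 1) * t `^ (q - 2) * Dt i x) * Dt i x +
          q * t `^ (q - 1) * D2t i x) =
  lap_pow q t (\sum_i Dt i x ^+ 2) M.
Proof.
move=> tM; rewrite big_split/= /lap_pow -mulr_sumr tM; congr (_ + _).
by rewrite !mulr_sumr; apply: eq_bigr => i _; ring.
Qed.

Lemma submean_pow_le1 q : 1 / 2 < q -> q <= 1 ->
  L / (2 * q - 1) * a 0 `^ q - s 0 `^ q <=
  smean r (fun x => L / (2 * q - 1) * a x `^ q - s x `^ q).
Proof.
move=> q12 q1.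
have h := C2_add (C2_scale (L / (2 * q - 1)) (C2_powR q C2a a0))
  (C2_scale (-1) (C2_powR q C2s s0)).
have E x : L / (2 * q - 1) * a x `^ q - s x `^ q =
    L / (2 * q - 1) * a x `^ q + -1 * s x `^ q by rewrite mulN1r.
rewrite E (_ : (fun x => _) = (fun x => L / (2 * q - 1) * a x `^ q + -1 * s x `^ q)).
  apply: submean r01 h _ => x Bx; rewrite big_split/= -!mulr_sumr mulN1r.
  rewrite (sum_lap_pow q (a x) Da (lapa Bx)) (sum_lap_pow q (s x) Ds (laps Bx)).
  have [Sa0 Ss0] : 0 <= \sum_i Da i x ^+ 2 /\ 0 <= \sum_i Ds i x ^+ 2.
    by split; exact: sumr_ge0 (fun i _ => sqr_ge0 _).
  apply: lap_pow_lt1 => //; [exact: a0|exact: as_|exact: N0|exact: NL|exact: grada].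
by apply/funext => x.
Qed.

Lemma submean_pow_gt1 q : 1 < q ->
  coefA q L * a 0 `^ q + coefB q L * (a 0 * s 0 `^ (q - 1)) - s 0 `^ q <=
  smean r (fun x => coefA q L * a x `^ q + coefB q L * (a x * s x `^ (q - 1)) - s x `^ q).
Proof.
move=> q1.
have h := C2_add (C2_add (C2_scale (coefA q L) (C2_powR q C2a a0))
  (C2_scale (coefB q L) (C2_mul C2a (C2_powR (q - 1) C2s s0))))
  (C2_scale (-1) (C2_powR q C2s s0)).
have E x : coefA q L * a x `^ q + coefB q L * (a x * s x `^ (q - 1)) - s x `^ q =
    coefA q L * a x `^ q + coefB q L * (a x * s x `^ (q - 1)) + -1 * s x `^ q.
  by rewrite mulN1r.
rewrite E (_ : (fun x => _) = (fun x => coefA q L * a x `^ q +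
    coefB q L * (a x * s x `^ (q - 1)) + -1 * s x `^ q)).
  apply: submean r01 h _ => x Bx; rewrite big_split/= big_split/= -!mulr_sumr mulN1r.
  rewrite (sum_lap_pow q (a x) Da (lapa Bx)) (sum_lap_pow q (s x) Ds (laps Bx)).
  have [Sa0 Ss0] : 0 <= \sum_i Da i x ^+ 2 /\ 0 <= \sum_i Ds i x ^+ 2.
    by split; exact: sumr_ge0 (fun i _ => sqr_ge0 _).
  rewrite (_ : \sum_i (D2a i x * _ + _ + _) = lap_mix q (a x) (s x) (G x) (N x) (\sum_i Ds i x ^+ 2)
      (\sum_i Da i x * Ds i x)); last first.
    rewrite /lap_mix -(lapa Bx) -(laps Bx) mulr_suml !mulr_sumr -!big_split/=.
    rewrite mulr_sumr -!big_split/=; apply: eq_bigr => i _.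
    rewrite (_ : q - 1 - 1 = q - 2); last by ring.
    rewrite (_ : q - 1 - 2 = q - 3); last by ring.
    by ring.
  apply: lap_pow_gt1 => //.
  - exact: a0.
  - exact: as_.
  - exact: G0.
  - exact: N0.
  - exact: NL.
  - exact: grada.
  - exact: grads.
  - exact: cauchy_schwarz.
by apply/funext => x.
Qed.

End power_submean.

Section quasiregular_energy.
Context {R : realType} {n : nat} (K : R) (f : 'rV[R]_n -> 'rV[R]_n) (k : 'I_n).
Hypotheses (n0 : (0 < n)%N) (K1 : 1 <= K) (qf : harmonic_quasiregular K f).
Local Notation B := (unit_ball R n).
Local Notation L := (1 + (n%:R - 1) * K ^+ 2).
Let u (j : 'I_n) x := f x ord0 j.
Let D j i := partial i (u j).
Let DD j i := partial i (partial i (u j)).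
Let G x := \sum_i D k i x ^+ 2.
Let N x := \sum_j \sum_i D j i x ^+ 2.

Let C2u j : C2 B (u j) (D j) (DD j).
Proof. exact: harmonic_C1 (qf.2 j). Qed.

Let lapu j x : B x -> \sum_i DD j i x = 0.
Proof. by have [_] := qf.2 j; exact. Qed.

Lemma quasiregular_energy x : B x -> N x <= L * G x.
Proof.
move=> Bx; rewrite /N (bigD1 k)//= -/(G x) mulrDl mul1r lerD2l.
apply: (@le_trans _ _ (\sum_(j < n | j != k) K ^+ 2 * G x)).
  by apply: ler_sum => j _; exact: (quasiregular_grad n0 K1 qf).
rewrite sumr_const -[leLHS]mulr_natl cardC1 card_ord mulrA.
by rewrite -subn1 natrB.
Qed.

Let g e x := u k x ^+ 2 + e.
Let h e x := enorm (f x) ^+ 2 + e.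
(** These expressions are left in the form produced by [C2_mul] and [C2_add]; the final 0 is the
    derivative of the constant e. *)
Let Dg (i : 'I_n) x := D k i x * u k x + u k x * D k i x + 0.
Let DDg (i : 'I_n) x := (DD k i x * u k x + D k i x * D k i x) +
                (D k i x * D k i x + u k x * DD k i x) + 0.
Let Dh (i : 'I_n) x := \sum_j (D j i x * u j x + u j x * D j i x) + 0.
Let DDh (i : 'I_n) x := \sum_j ((DD j i x * u j x + D j i x * D j i x) +
                (D j i x * D j i x + u j x * DD j i x)) + 0.

Let C2g e : C2 B (g e) Dg DDg.
Proof. exact: C2_add (C2_mul (C2u k) (C2u k)) (C2_cst B e). Qed.

Let C2h e : C2 B (h e) Dh DDh.
Proof.
rewrite (_ : h e = fun x => \sum_j (u j x * u j x) + e).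
  exact: C2_add (C2_bigsum (index_enum _) (fun j => C2_mul (C2u j) (C2u j))) (C2_cst B e).
by apply/funext => x; rewrite /h enorm_sqr.
Qed.

Let lap_sqr j x : B x -> \sum_i ((DD j i x * u j x + D j i x * D j i x) +
   (D j i x * D j i x + u j x * DD j i x)) = 2 * \sum_i D j i x ^+ 2.
Proof.
move=> Bx; transitivity (\sum_i (2 * D j i x ^+ 2 + 2 * u j x * DD j i x)).
  by apply: eq_bigr => i _; ring.
by rewrite big_split/= -!mulr_sumr lapu// mulr0 addr0.
Qed.

Let lapg x : B x -> \sum_i DDg i x = 2 * G x.
Proof.
by move=> Bx; rewrite -(lap_sqr k Bx); apply: eq_bigr => i _; rewrite /DDg addr0.
Qed.

Let laph x : B x -> \sum_i DDh i x = 2 * N x.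
Proof.
move=> Bx; transitivity (\sum_i \sum_j ((DD j i x * u j x + D j i x * D j i x) +
                (D j i x * D j i x + u j x * DD j i x))).
  by apply: eq_bigr => i _; rewrite /DDh addr0.
rewrite exchange_big /N mulr_sumr; apply: eq_bigr => j _; exact: lap_sqr.
Qed.

Let gh e x : g e x <= h e x.
Proof.
rewrite lerD2r enorm_sqr (bigD1 k)//= lerDl.
by apply: sumr_ge0 => j _; exact: sqr_ge0.
Qed.

Let g0 e x : 0 < e -> 0 < g e x.
Proof. by move=> e0; apply: ltr_wpDl => //; exact: sqr_ge0. Qed.

Let G0 x : 0 <= G x. Proof. exact: sumr_ge0 (fun i _ => sqr_ge0 _). Qed.

Let N0 x : 0 <= N x.
Proof. by apply: sumr_ge0 => j _; exact: sumr_ge0 (fun i _ => sqr_ge0 _). Qed.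

Let gradg e x : 0 < e -> \sum_i Dg i x ^+ 2 <= 4 * (g e x * G x).
Proof.
move=> e0; rewrite (_ : \sum_i _ = 4 * (u k x ^+ 2 * G x)).
  by rewrite ler_pM2l// ler_wpM2r// lerDl ltW.
by rewrite /G !mulr_sumr; apply: eq_bigr => i _; rewrite /Dg; ring.
Qed.

Let gradh e x : 0 < e -> \sum_i Dh i x ^+ 2 <= 4 * (h e x * N x).
Proof.
move=> e0; apply: (@le_trans _ _ (4 * (enorm (f x) ^+ 2 * N x))); last first.
  by rewrite ler_pM2l// ler_wpM2r// lerDl ltW.
rewrite /N exchange_big !mulr_sumr; apply: ler_sum => i _.
rewrite (_ : Dh i x = 2 * \sum_j u j x * D j i x); last first.
  by rewrite /Dh addr0 mulr_sumr; apply: eq_bigr => j _; ring.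
rewrite exprMn (_ : 2 ^+ 2 = 4); last by ring.
by rewrite ler_pM2l// enorm_sqr; exact: cauchy_schwarz.
Qed.

Let L1 : 1 <= L.
Proof.
by rewrite lerDl mulr_ge0 ?exprn_ge0 ?(le_trans ler01 K1)// subr_ge0 ler1n.
Qed.

Lemma quasiregular_submean_le1 e q r : 0 < e -> 0 <= r < 1 -> 1 / 2 < q -> q <= 1 ->
  L / (2 * q - 1) * (f 0 ord0 k ^+ 2 + e) `^ q - (enorm (f 0) ^+ 2 + e) `^ q <=
  smean r (fun x => L / (2 * q - 1) * (f x ord0 k ^+ 2 + e) `^ q -
                    (enorm (f x) ^+ 2 + e) `^ q).
Proof.
move=> e0 r01 q12 q1.
apply: (@submean_pow_le1 _ _ (g e) (h e) G N Dg DDg Dh DDh) => //.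
- by move=> x _; exact: g0.
- exact: quasiregular_energy.
- by move=> x _; exact: gradg.
Qed.

Lemma quasiregular_submean_gt1 e q r : 0 < e -> 0 <= r < 1 -> 1 < q ->
  coefA q L * (f 0 ord0 k ^+ 2 + e) `^ q +
    coefB q L * ((f 0 ord0 k ^+ 2 + e) * (enorm (f 0) ^+ 2 + e) `^ (q - 1)) -
    (enorm (f 0) ^+ 2 + e) `^ q <=
  smean r (fun x => coefA q L * (f x ord0 k ^+ 2 + e) `^ q +
    coefB q L * ((f x ord0 k ^+ 2 + e) * (enorm (f x) ^+ 2 + e) `^ (q - 1)) -
    (enorm (f x) ^+ 2 + e) `^ q).
Proof.
move=> e0 r01 q1.
apply: (@submean_pow_gt1 _ _ (g e) (h e) G N Dg DDg Dh DDh) => //.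
- by move=> x _; exact: g0.
- exact: quasiregular_energy.
- by move=> x _; exact: gradg.
- by move=> x _; exact: gradh.
Qed.

End quasiregular_energy.

(** * Inequalities between means *)

Section powR_inequalities.
Context {R : realType}.
Implicit Types q x y e : R.

(** The ratios x/(x+y) and y/(x+y) lie in [0, 1], so each is at most its q-th power, and they add up
    to 1. *)
Lemma powR_subadd q x y : 0 < q -> q <= 1 -> 0 <= x -> 0 <= y ->
  (x + y) `^ q <= x `^ q + y `^ q.
Proof.
move=> q0 q1 x0 y0.
have [->|xy0] := eqVneq (x + y) 0.
  by rewrite powR0 ?gt_eqF// addr_ge0// powR_ge0.
have t0 : 0 < x + y by rewrite lt_neqAle eq_sym xy0 addr_ge0.
have h z : 0 <= z -> z <= x + y -> (x + y) `^ q * (z / (x + y)) <= z `^ q.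
  move=> z0 zt; have [->|zN0] := eqVneq z 0; first by rewrite mul0r mulr0 powR_ge0.
  have z1 : 0 < z / (x + y) by rewrite divr_gt0// lt_neqAle eq_sym zN0.
  rewrite -{2}(divfK xy0 z) [z / _ * _]mulrC powRM ?(ltW t0) ?(ltW z1)//.
  rewrite ler_wpM2l ?powR_ge0//; apply: ger1_powR => //.
  by rewrite z1 ler_pdivrMr// mul1r.
apply: le_trans (lerD (h x x0 _) (h y y0 _)); rewrite ?lerDl ?lerDr//.
by rewrite -mulrDr -mulrDl divff// mulr1.
Qed.

Lemma powR_young q x y : 1 < q -> 0 <= x -> 0 <= y ->
  q * (x * y `^ (q - 1)) <= x `^ q + (q - 1) * y `^ q.
Proof.
move=> q1 x0 y0; have q0 : 0 < q by lra.
have q10 : 0 < q - 1 by lra.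
have := @conjugate_powR R x (y `^ (q - 1)) q (q / (q - 1)) x0 (powR_ge0 _ _) q0
  (divr_gt0 q0 q10).
rewrite -powRrM (_ : (q - 1) * (q / (q - 1)) = q); last by field; lra.
move=> /(_ _)/(ler_wpM2l (ltW q0)); rewrite (_ : _ * (_ / q + _) =
  x `^ q + (q - 1) * y `^ q); last by field; rewrite !gt_eqF.
by apply; field; rewrite !gt_eqF.
Qed.

(** Young's inequality for x/k^(1/q) and y/l^(1/q). With k and l the means of x^q and y^q, averaging
    it gives Hoelder's inequality. *)
Lemma powR_young_scaled q k l x y : 1 < q -> 0 < k -> 0 < l -> 0 <= x -> 0 <= y ->
  q * (x * y `^ (q - 1)) <=
  k `^ q^-1 * (l `^ q^-1) `^ (q - 1) * (k^-1 * x `^ q + (q - 1) / l * y `^ q).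
Proof.
move=> q1 k0 l0 x0 y0; have q0 : q != 0 by rewrite gt_eqF; lra.
have iv (z t : R) : 0 < z -> z^-1 `^ t = (z `^ t)^-1.
  by move=> z0; rewrite -powR_inv1 ?(ltW z0)// -powRrM mulN1r powRN.
have rt (z : R) : 0 < z -> (z `^ q^-1) `^ q = z.
  by move=> z0; rewrite -powRrM mulVf// powRr1// ltW.
have := rt _ k0; have := rt _ l0; have := powR_gt0 q^-1 k0; have := powR_gt0 q^-1 l0.
move: (k `^ q^-1) (l `^ q^-1) => al sg sg0 al0 sgq alq.
have sgq0 := powR_gt0 (q - 1) sg0.
have := @powR_young q (x / al) (y / sg) q1
     (divr_ge0 x0 (ltW al0)) (divr_ge0 y0 (ltW sg0)).
rewrite !powRM ?invr_ge0 ?(ltW al0) ?(ltW sg0)// !iv// alq sgq.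
move: (y `^ (q - 1)) (x `^ q) (y `^ q) sgq0 => Y X Z; move: (sg `^ (q - 1)) => S S0 h.
have -> : q * (x * Y) = al * S * (q * (x / al * (Y / S))).
  by field; rewrite !gt_eqF.
rewrite ler_pM2l ?mulr_gt0//; apply: le_trans h _.
by rewrite [X / k]mulrC mulrA mulrAC.
Qed.

(** Convexity of t^q, read off from Young's inequality for x and x + e. The coefficient of e does
    not involve e, so it can be averaged once and for all. *)
Lemma powR_increment q x e : 1 < q -> 0 <= x -> 0 < e -> e <= 1 ->
  (x + e) `^ q <= x `^ q + e * (q * (x + 1) `^ (q - 1)).
Proof.
move=> q1 x0 e0 e1; have xe : 0 <= x + e by lra.
have := powR_young q1 x0 xe.
have : (x + e) `^ (q - 1) <= (x + 1) `^ (q - 1).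
  by apply: ge0_ler_powR; rewrite ?nnegrE; lra.
have -> : (x + e) `^ q = (x + e) * (x + e) `^ (q - 1).
  by apply: powR_sub1; lra.
set X := (x + e) `^ (q - 1); set Y := (x + 1) `^ (q - 1) => XY.
have : 0 <= e * (q * (Y - X)).
  by apply: mulr_ge0; [lra|apply: mulr_ge0; [lra|rewrite subr_ge0]].
lra.
Qed.

Lemma powR_half q x : 0 <= x -> (x ^+ 2) `^ q = x `^ (2 * q).
Proof. by move=> x0; rewrite -powR_mulrn// -powRrM. Qed.

Lemma continuous_powR_norm q : 0 < q -> continuous (fun t : R => `|t| `^ q).
Proof.
move=> q0 t; have [->|t0] := eqVneq t 0; last first.
  apply: (@continuous_comp _ _ _ (fun t : R => `|t|) (fun t => t `^ q)).
    exact: norm_continuous.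
  by apply: powR_continuous1; rewrite normr_gt0.
apply/cvgrPdist_lt => e e0; rewrite normr0 powR0 ?gt_eqF//.
near=> x; rewrite sub0r normrN ger0_norm ?powR_ge0//.
have -> : e = (e `^ q^-1) `^ q.
  by rewrite -powRrM mulVf ?gt_eqF// powRr1// ltW.
apply: gt0_ltr_powR; rewrite ?nnegrE ?powR_ge0//.
near: x; exists (e `^ q^-1); first exact: powR_gt0.
by move=> z; rewrite /= sub0r normrN.
Unshelve. all: by end_near. Qed.

Lemma continuous_comp_powR n (g : 'rV[R]_n -> R) q (x : 'rV[R]_n) : 0 < q ->
  (forall z, 0 <= g z) -> {for x, continuous g} ->
  {for x, continuous (fun z : 'rV[R]_n => g z `^ q)}.
Proof.
move=> q0 g0 cg; rewrite (_ : (fun z => _) = fun z => `|g z| `^ q).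
  by apply: (continuous_comp (g := fun t => `|t| `^ q) cg); exact: continuous_powR_norm.
by apply/funext => z; rewrite ger0_norm.
Qed.

Lemma ler_small x y c : 0 <= c ->
  (forall d, 0 < d -> d <= 1 -> x <= y + c * d) -> x <= y.
Proof.
move=> c0 h; rewrite -subr_le0 leNgt; apply/negP => xy.
have c1 : 0 < c + 1 by lra.
pose d := Num.min 1 ((x - y) / (2 * (c + 1))).
have d0 : 0 < d by rewrite lt_min ltr01 divr_gt0// mulr_gt0.
have d1 : d <= 1 by rewrite ge_min lexx.
have := h d d0 d1.
have : d * (2 * (c + 1)) <= x - y.
  by rewrite -ler_pdivlMr ?mulr_gt0// ge_min lexx orbT.
have : 0 <= c * d by rewrite mulr_ge0// ltW.
rewrite mulrDr mulrDr; lra.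
Qed.

End powR_inequalities.

Section smean_hoelder.
Context {R : realType} (n : nat) (r q : R) (a s : 'rV[R]_n -> R).
Local Notation contB g := (forall x, unit_ball R n x -> {for x, continuous g}).
Hypotheses (r01 : 0 <= r < 1) (q1 : 1 < q).
Hypotheses (ca : contB a) (cs : contB s).
Hypotheses (a0 : forall x, 0 < a x) (s0 : forall x, 0 < s x).

Let cp (g : 'rV[R]_n -> R) t : contB g -> (forall x, 0 < g x) ->
  contB (fun x => g x `^ t).
Proof.
move=> cg g0 x Bx; apply: (continuous_comp (g := fun t' => t' `^ t) (cg x Bx)).
by apply: powR_continuous1; exact: g0.
Qed.

(** Average [powR_young_scaled] with the two means as k and l: the bracket averages to 1 + (q-1) =
    q, which cancels the q on the left. *)
Lemma smean_hoelder : 0 < smean r (fun x => a x `^ q) ->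
  0 < smean r (fun x => s x `^ q) ->
  smean r (fun x => a x * s x `^ (q - 1)) <=
  smean r (fun x => a x `^ q) `^ q^-1 * (smean r (fun x => s x `^ q) `^ q^-1) `^ (q - 1).
Proof.
move EaE : (smean r (fun x => a x `^ q)) => Ea.
move EsE : (smean r (fun x => s x `^ q)) => Es.
move=> Ea0 Es0; have q0 : 0 < q := lt_trans ltr01 q1.
move kE : (Ea `^ q^-1 * (Es `^ q^-1) `^ (q - 1)) => k.
have cas : contB (fun x => a x * s x `^ (q - 1)).
  by move=> x Bx; apply: continuousM; [exact: ca|exact: cp].
have cM c (g : 'rV[R]_n -> R) : contB g -> contB (fun x => c * g x).
  by move=> cg x Bx; apply: continuousM; [exact: cst_continuous|exact: cg].
have caq : contB (fun x => a x `^ q) by exact: cp.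
have csq : contB (fun x => s x `^ q) by exact: cp.
have : smean r (fun x => q * (a x * s x `^ (q - 1))) <=
    smean r (fun x => k * (Ea^-1 * a x `^ q + (q - 1) / Es * s x `^ q)).
  apply: smean_le => //; first exact: cM.
    by apply: (@cM) => x Bx; apply: continuousD; exact: (@cM).
  by move=> x _; rewrite -kE; apply: powR_young_scaled => //; exact: ltW.
rewrite smeanZ// smeanZ//; last by move=> x Bx; apply: continuousD; exact: (@cM).
rewrite smeanD//; [|exact: (@cM)|exact: (@cM)].
rewrite !smeanZ// EaE EsE mulVf ?gt_eqF// divfK ?gt_eqF// subrKC.
by rewrite [k * q]mulrC ler_pM2l.
Qed.

End smean_hoelder.

(** If sg <= s0 there is nothing to do. Otherwise s0^q, al^q and the mixed mean are at most s0, al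
    and al times sg^(q-1), and the nonnegative values at the centre are dropped. *)
Lemma absorb_power (R : realType) (q A C a0 s0 al sg Ea Es Eas : R) :
  1 < q -> 0 <= A -> 0 <= C -> 0 < a0 -> 0 < s0 ->
  al <= sg -> al `^ q = Ea -> sg `^ q = Es -> 0 < al -> 0 < sg ->
  Eas <= al * sg `^ (q - 1) ->
  A * a0 `^ q + C * (a0 * s0 `^ (q - 1)) - s0 `^ q <= A * Ea + C * Eas - Es ->
  sg <= s0 + (A + C) * al.
Proof.
move=> q1 A0 C0 a00 s00 alsg <- <- al0 sg0 hE h.
have [sgs|sgs] := leP sg s0.
  by apply: le_trans sgs _; rewrite lerDl mulr_ge0 ?addr_ge0// ltW.
have S0 : 0 < sg `^ (q - 1) by exact: powR_gt0.
rewrite -(ler_pM2r S0) mulrDl -(powR_sub1 q sg0).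
have h1 : s0 `^ q <= s0 * sg `^ (q - 1).
  rewrite (powR_sub1 q s00) ler_pM2l//.
  by apply: ge0_ler_powR; rewrite ?nnegrE ?(ltW sgs) ?subr_ge0 ?(ltW s00) ?(ltW sg0) ?(ltW q1).
have h2 : al `^ q <= al * sg `^ (q - 1).
  rewrite (powR_sub1 q al0) ler_pM2l//.
  by apply: ge0_ler_powR; rewrite ?nnegrE ?subr_ge0 ?(ltW al0) ?(ltW sg0) ?(ltW q1).
have h3 : 0 <= A * a0 `^ q + C * (a0 * s0 `^ (q - 1)).
  by rewrite addr_ge0// !mulr_ge0 ?powR_ge0// ltW.
have := ler_wpM2l A0 h2; have := ler_wpM2l C0 hE.
rewrite -mulrA [(A + C) * _]mulrDl; lra.
Qed.

Lemma coefB_gt0 (R : realType) (q L : R) : 1 < q -> 0 < L -> 0 < coefB q L.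
Proof.
by move=> q1 L0; rewrite /coefB; apply: mulr_gt0 => //; apply: mulr_gt0; lra.
Qed.

Lemma coefA_ge0 (R : realType) (q L : R) : 1 < q -> 0 < L -> 0 <= coefA q L.
Proof.
move=> q1 L0; have B0 := ltW (coefB_gt0 q1 L0); rewrite /coefA.
apply: divr_ge0; last by apply: mulr_ge0; [lra|exact: powR_ge0].
apply: mulr_ge0 => //; rewrite /coefc; apply: mulr_ge0; first by nonneg.
by have := normr_ge0 (q - 2); lra.
Qed.

Section quasiregular_means.
Context {R : realType} {n : nat} (K : R) (f : 'rV[R]_n -> 'rV[R]_n) (k : 'I_n).
Hypotheses (n0 : (0 < n)%N) (K1 : 1 <= K) (qf : harmonic_quasiregular K f).
Local Notation B := (unit_ball R n).
Local Notation L := (1 + (n%:R - 1) * K ^+ 2).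
Local Notation contB g := (forall x : 'rV[R]_n, B x -> {for x, continuous g}).
Implicit Types q r e : R.

Let ge1_L : 1 <= L.
Proof.
by rewrite lerDl mulr_ge0 ?exprn_ge0 ?(le_trans ler01 K1)// subr_ge0 ler1n.
Qed.

Let cs (c : R) (g : 'rV[R]_n -> R) : contB g -> contB (fun x => c * g x).
Proof. by move=> cg x Bx; apply: continuousM; [exact: cst_continuous|exact: cg]. Qed.

Let cD (g h : 'rV[R]_n -> R) : contB g -> contB h -> contB (fun x => g x + h x).
Proof. by move=> cg ch x Bx; apply: continuousD; [exact: cg|exact: ch]. Qed.

Let cc (c : R) : contB (fun=> c). Proof. by move=> x _; exact: cst_continuous. Qed.

Let cX (g : 'rV[R]_n -> R) : contB g -> contB (fun x => g x ^+ 2).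
Proof. by move=> cg x Bx; apply: continuousM; exact: cg. Qed.

Let cp q (g : 'rV[R]_n -> R) : 0 < q -> (forall x, 0 <= g x) ->
  contB g -> contB (fun x => g x `^ q).
Proof. by move=> q0 g0 cg x Bx; apply: continuous_comp_powR => //; exact: cg. Qed.

Let cu : contB (fun x => f x ord0 k).
Proof. by have [h _ _ _ _] := harmonic_C1 (qf.2 k); exact: h. Qed.

Let cF : contB (fun x => enorm (f x)).
Proof.
move=> x Bx; apply: (continuous_comp (g := @enorm R n)); last exact: continuous_enorm.
by have [[h _] _] := qf; exact: h.
Qed.

Let u2 x : 0 <= f x ord0 k ^+ 2. Proof. exact: sqr_ge0. Qed.
Let F2 x : 0 <= enorm (f x) ^+ 2. Proof. exact: sqr_ge0. Qed.

Lemma quasiregular_smean_le1 q r : 0 <= r < 1 -> 1 / 2 < q -> q <= 1 ->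
  smean r (fun x => (enorm (f x) ^+ 2) `^ q) <= (enorm (f 0) ^+ 2) `^ q +
    L / (2 * q - 1) * (smean r (fun x => (f x ord0 k ^+ 2) `^ q) -
                       (f 0 ord0 k ^+ 2) `^ q).
Proof.
move=> r01 q12 q1; have q0 : 0 < q by apply: lt_trans q12; lra.
have c0 : 0 <= L / (2 * q - 1).
  by apply: divr_ge0; [exact: le_trans ler01 ge1_L|lra].
move cE : (L / (2 * q - 1)) c0 => c c0.
(* Regularising costs c d in the mean of f_k and d in the value of |f|^2 at the centre. *)
apply: (@ler_small _ _ _ (c + 1)) => [|d d0 d1]; first exact: addr_ge0.
(* Then e^q = d, and subadditivity of t^q bounds the effect of adding e by d. *)
pose e := d `^ q^-1.
have e0 : 0 < e by exact: powR_gt0.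
have eq : e `^ q = d by rewrite -powRrM mulVf ?gt_eqF// powRr1// ltW.
clearbody e.
have := quasiregular_submean_le1 k n0 K1 qf e0 r01 q12 q1; rewrite cE => h.
have up x : 0 <= x -> (x + e) `^ q <= x `^ q + d.
  by move=> x0; rewrite -eq; apply: powR_subadd => //; exact: ltW.
have lo x : 0 <= x -> x `^ q <= (x + e) `^ q.
  move=> x0; apply: ge0_ler_powR; rewrite ?nnegrE ?addr_ge0 ?(ltW e0) ?(ltW q0)//.
  by rewrite lerDl ltW.
have cuq : contB (fun x => (f x ord0 k ^+ 2) `^ q) by apply: cp => //; exact: cX.
have cFq : contB (fun x => (enorm (f x) ^+ 2) `^ q) by apply: cp => //; exact: cX.
have {h} : c * (f 0 ord0 k ^+ 2) `^ q - ((enorm (f 0) ^+ 2) `^ q + d) <=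
    smean r (fun x => c * (f x ord0 k ^+ 2) `^ q + c * d + -1 * (enorm (f x) ^+ 2) `^ q).
  apply: (@le_trans _ _ (c * (f 0 ord0 k ^+ 2 + e) `^ q - (enorm (f 0) ^+ 2 + e) `^ q)).
    by apply: lerB; [rewrite ler_wpM2l// lo|exact: up].
  apply: le_trans h _; apply: smean_le => //.
  - rewrite (_ : (fun x => _) = fun x => c * (f x ord0 k ^+ 2 + e) `^ q +
        -1 * (enorm (f x) ^+ 2 + e) `^ q); last by apply/funext => x; rewrite mulN1r.
    apply: cD; apply: cs; apply: cp => //.
    + by move=> x; rewrite addr_ge0 ?(ltW e0).
    + exact: (cD (cX cu) (@cc e)).
    + by move=> x; rewrite addr_ge0 ?(ltW e0).
    + exact: (cD (cX cF) (@cc e)).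
  - by apply: cD; [apply: cD; [exact: cs|exact: cc]|exact: cs].
  - move=> x _; rewrite -mulrDr mulN1r; apply: lerB; last exact: lo.
    by rewrite ler_wpM2l// up.
rewrite smeanD//; [|by apply: cD; [exact: cs|exact: cc]|exact: cs].
rewrite smeanD//; [|exact: cs|exact: cc].
rewrite smean_cst// !smeanZ// mulrBr mulrDl mul1r mulN1r.
set U := smean _ _; set V := smean _ _; set u := _ `^ q; set v := _ `^ q; lra.
Qed.

Lemma quasiregular_smean_gt1 q r : 0 <= r < 1 -> 1 < q ->
  smean r (fun x => (enorm (f x) ^+ 2) `^ q) `^ q^-1 <= enorm (f 0) ^+ 2 +
    (coefA q L + coefB q L) * smean r (fun x => (f x ord0 k ^+ 2) `^ q) `^ q^-1.
Proof.
move=> r01 q1; have q0 : 0 < q := lt_trans ltr01 q1.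
have q10 : 0 < q - 1 by rewrite subr_gt0.
have L0 : 0 < L := lt_le_trans ltr01 ge1_L.
have A0 : 0 <= coefA q L by exact: coefA_ge0.
have B0 : 0 <= coefB q L by apply: ltW; exact: coefB_gt0.
move: (coefA q L) (coefB q L) A0 B0
  (fun (e : R) (e0 : 0 < e) => @quasiregular_submean_gt1 R n K f k n0 K1 qf e q r e0 r01 q1)
  => A C A0 C0 sub.
pose a e x := f x ord0 k ^+ 2 + e; pose s e x := enorm (f x) ^+ 2 + e.
have ca e : contB (a e) by exact: (cD (cX cu) (@cc e)).
have cS e : contB (s e) by exact: (cD (cX cF) (@cc e)).
have a0 e x : 0 < e -> 0 < a e x by move=> e0; rewrite ltr_wpDl.
have s0 e x : 0 < e -> 0 < s e x by move=> e0; rewrite ltr_wpDl.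
have cpos t (g : 'rV[R]_n -> R) : contB g -> (forall x, 0 < g x) ->
    contB (fun x => g x `^ t).
  move=> cg g0 x Bx; apply: (continuous_comp (g := fun z => z `^ t) (cg x Bx)).
  exact: powR_continuous1.
have as_ e x : a e x <= s e x.
  rewrite lerD2r enorm_sqr (bigD1 k)//= lerDl.
  by apply: sumr_ge0 => j _; exact: sqr_ge0.
(* Positivity of the means, by which Hoelder's inequality divides; it is a benefit of e > 0. *)
have Epos e (g : 'rV[R]_n -> R) : 0 < e -> contB g -> (forall x, e <= g x) ->
    0 < smean r (fun x => g x `^ q).
  move=> e0 cg ge; apply: (@lt_le_trans _ _ (e `^ q)); first exact: powR_gt0.
  rewrite -[leLHS](@smean_cst R n r); apply: smean_le => //.
    exact: cc.
    by apply: cpos => // x; exact: lt_le_trans (ge x).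
  move=> x _; apply: ge0_ler_powR; rewrite ?nnegrE ?(ltW q0) ?(ltW e0)//.
  by apply: le_trans (ge x); exact: ltW.
have step e : 0 < e -> smean r (fun x => s e x `^ q) `^ q^-1 <= s e 0 +
    (A + C) * smean r (fun x => a e x `^ q) `^ q^-1.
  move=> e0.
  have Ea0 : 0 < smean r (fun x => a e x `^ q).
    by apply: (Epos e (a e)) => // [|x]; [exact: ca|rewrite /a lerDr].
  have Es0 : 0 < smean r (fun x => s e x `^ q).
    by apply: (Epos e (s e)) => // [|x]; [exact: cS|rewrite /s lerDr].
  have caq : contB (fun x => a e x `^ q) by apply: cpos => [|x]; [exact: ca|exact: a0].
  have csq : contB (fun x => s e x `^ q) by apply: cpos => [|x]; [exact: cS|exact: s0].
  have cas : contB (fun x => a e x * s e x `^ (q - 1)).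
    move=> x Bx; apply: continuousM; first exact: ca.
    by apply: cpos => [|y|]; [exact: cS|exact: s0|].
  have hold := @smean_hoelder R n r q (a e) (s e) r01 q1 (ca e) (cS e)
    (fun x => a0 e x e0) (fun x => s0 e x e0) Ea0 Es0.
  have Eas : smean r (fun x => a e x `^ q) <= smean r (fun x => s e x `^ q).
    apply: smean_le => // x _.
    by apply: ge0_ler_powR; rewrite ?nnegrE ?(ltW (a0 _ _ e0)) ?(ltW (s0 _ _ e0)) ?(ltW q0).
  have := sub e e0; rewrite -/(a e 0) -/(s e 0).
  rewrite (_ : (fun x => _) = fun x => A * a e x `^ q +
      C * (a e x * s e x `^ (q - 1)) + -1 * s e x `^ q); last first.
    by apply/funext => x; rewrite mulN1r.
  rewrite smeanD//; [|by apply: cD; exact: cs|exact: cs].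
  rewrite smeanD//; [|exact: cs|exact: cs].
  rewrite !smeanZ// mulN1r.
  have rt (z : R) : 0 < z -> (z `^ q^-1) `^ q = z.
    by move=> z0; rewrite -powRrM mulVf ?gt_eqF// powRr1// ltW.
  move: (rt _ Ea0) (rt _ Es0) (powR_gt0 q^-1 Ea0) (powR_gt0 q^-1 Es0) hold.
  have : smean r (fun x => a e x `^ q) `^ q^-1 <= smean r (fun x => s e x `^ q) `^ q^-1.
    by apply: ge0_ler_powR; rewrite ?nnegrE ?invr_ge0 ?(ltW Ea0) ?(ltW Es0) ?(ltW q0).
  move: (smean r (fun x => a e x `^ q)) (smean r (fun x => s e x `^ q))
     (smean r (fun x => a e x * s e x `^ (q - 1))) => Ea Es Eas'.
  move: (Ea `^ q^-1) (Es `^ q^-1) => al sg.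
  move=> h1 h2 h3 h4 h5 h6 h7.
  exact: (absorb_power q1 A0 C0 (a0 e 0 e0) (s0 e 0 e0) h1 h2 h3 h4 h5 h6 h7).
apply: (@ler_small _ _ _ (A + C + 1)) => [|d d0 d1]; first by rewrite !addr_ge0.
(* The mean of (f_k^2 + e)^q exceeds that of f_k^(2q) by at most e M. The choice of e below makes
   this at most d^q, so that the q-th root grows by at most d, and e <= d handles the value at the
   centre. *)
pose M := smean r (fun x => q * a 1 x `^ (q - 1)).
have M0 : 0 <= M.
  by apply: (smean_ge0 r01) => x _; rewrite mulr_ge0 ?powR_ge0// ltW.
pose e := Num.min d (d `^ q / (M + 1)).
have M1 : 0 < M + 1 by rewrite ltr_wpDl.
have e0 : 0 < e by rewrite lt_min d0 divr_gt0// powR_gt0.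
have ed : e <= d by rewrite ge_min lexx.
have eM : e * M <= d `^ q.
  apply: (@le_trans _ _ (e * (M + 1))); first by rewrite ler_wpM2l ?(ltW e0)// lerDl.
  by rewrite -ler_pdivlMr// ge_min lexx orbT.
have e1 : e <= 1 := le_trans ed d1.
clearbody e.
have cuq : contB (fun x => (f x ord0 k ^+ 2) `^ q) by apply: cp => //; exact: cX.
have cFq : contB (fun x => (enorm (f x) ^+ 2) `^ q) by apply: cp => //; exact: cX.
have ca1 : contB (fun x => q * a 1 x `^ (q - 1)).
  by apply: cs; apply: cpos => [|x]; [exact: ca|exact: a0].
have U0 : 0 <= smean r (fun x => (f x ord0 k ^+ 2) `^ q).
  by apply: (smean_ge0 r01) => x _; exact: powR_ge0.
have h1 : smean r (fun x => a e x `^ q) `^ q^-1 <=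
    smean r (fun x => (f x ord0 k ^+ 2) `^ q) `^ q^-1 + d.
  apply: (@le_trans _ _ ((smean r (fun x => (f x ord0 k ^+ 2) `^ q) + d `^ q) `^ q^-1)).
    apply: ge0_ler_powR; rewrite ?nnegrE ?invr_ge0 ?(ltW q0) ?addr_ge0 ?powR_ge0//.
      by apply: (smean_ge0 r01) => x _; exact: powR_ge0.
    apply: (@le_trans _ _ (smean r (fun x => (f x ord0 k ^+ 2) `^ q +
        e * (q * a 1 x `^ (q - 1))))).
      apply: smean_le => //; first by apply: cpos => [|x]; [exact: ca|exact: a0].
        by apply: cD => //; exact: cs.
      by move=> x _; exact: powR_increment.
    by rewrite smeanD//; [rewrite smeanZ// lerD2l|exact: cs].
  have {2}-> : d = (d `^ q) `^ q^-1.
    by rewrite -powRrM mulfV ?gt_eqF// powRr1// ltW.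
  apply: powR_subadd; rewrite ?invr_gt0 ?powR_ge0 ?invf_le1//.
  exact: ltW.
have h2 : smean r (fun x => (enorm (f x) ^+ 2) `^ q) `^ q^-1 <=
    smean r (fun x => s e x `^ q) `^ q^-1.
  apply: ge0_ler_powR; [by rewrite invr_ge0 ltW|rewrite nnegrE|rewrite nnegrE|].
  - by apply: (smean_ge0 r01) => x _; exact: powR_ge0.
  - by apply: (smean_ge0 r01) => x _; exact: powR_ge0.
  apply: smean_le => //; first by apply: cpos => [|x]; [exact: cS|exact: s0].
  move=> x _; apply: ge0_ler_powR; rewrite ?nnegrE ?(ltW q0) ?(ltW (s0 _ _ e0))//.
  by rewrite lerDl ltW.
apply: le_trans h2 _; apply: le_trans (step e e0) _; move: h1; rewrite /s.
move: (smean r (fun x => a e x `^ q) `^ q^-1)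
  (smean r (fun x => (f x ord0 k ^+ 2) `^ q) `^ q^-1) => X Y XY.
have := ler_wpM2l (addr_ge0 A0 C0) XY.
rewrite mulrDr [(A + C + 1) * d]mulrDl mul1r; lra.
Qed.

End quasiregular_means.

(** * Hardy norms *)

Section hardy_smean.
Context {R : realType} {n m : nat}.
Hypothesis n0 : (0 < n)%N.
Local Notation B := (unit_ball R n).
Implicit Types (g : 'rV[R]_n -> 'rV[R]_m) (p r : R).

Lemma continuous_enorm_powR g p : 0 < p -> (forall x, B x -> {for x, continuous g}) ->
  forall x, B x -> {for x, continuous (fun x => enorm (g x) `^ p)}.
Proof.
move=> p0 cg x Bx; apply: continuous_comp_powR => //.
  by move=> z; exact: enorm_ge0.
by apply: (continuous_comp (cg x Bx)); exact: continuous_enorm.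
Qed.

Lemma Mp_smean g p r : 0 < p -> 0 <= r < 1 -> (forall x, B x -> {for x, continuous g}) ->
  Mp p r g = (smean r (fun x => enorm (g x) `^ p) `^ p^-1)%:E.
Proof.
move=> p0 r01 cg; rewrite /Mp -poweR_EFin; congr (_ `^ _)%E.
apply: (@integral_surface_smean R n r r01 (fun x => enorm (g x) `^ p)) => //.
  exact: continuous_enorm_powR.
by move=> x _; exact: powR_ge0.
Qed.

Lemma smean_powR_ge0 g p r : 0 <= r < 1 -> 0 <= smean r (fun x => enorm (g x) `^ p).
Proof. by move=> r01; apply: (smean_ge0 r01) => x _; exact: powR_ge0. Qed.

Lemma smean_powRK g p r : 0 < p -> 0 <= r < 1 ->
  (smean r (fun x => enorm (g x) `^ p) `^ p^-1) `^ p = smean r (fun x => enorm (g x) `^ p).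
Proof.
move=> p0 r01; rewrite -powRrM mulVf ?gt_eqF// powRr1//.
exact: smean_powR_ge0.
Qed.

Lemma powR_Mp g p r : 0 < p -> 0 <= r < 1 -> (forall x, B x -> {for x, continuous g}) ->
  (Mp p r g `^ p)%E = (smean r (fun x => enorm (g x) `^ p))%:E.
Proof.
move=> p0 r01 cg; rewrite Mp_smean// -[in RHS](smean_powRK g p0 r01).
exact: poweR_EFin.
Qed.

Lemma continuous_measurable_ball g : (forall x, B x -> {for x, continuous g}) ->
  measurable_fun B g.
Proof.
move=> cg; pose h x := if enorm x < 1 then g x else 0.
have mh : measurable_fun setT h.
  apply/measurable_fun_rVP => i.
  rewrite (_ : (fun t => _) = fun x => if enorm x < 1 then g x ord0 i else 0).
    apply: measurable_cutoff => x Bx.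
    apply: (continuous_comp (g := fun y : 'rV[R]_m => y ord0 i) (cg x Bx)).
    exact: continuous_coord.
  by apply/funext => x; rewrite /h; case: ifP => // _; rewrite mxE.
apply: (eq_measurable_fun h); last exact: measurable_funTS.
by move=> x; rewrite inE => Bx; rewrite /h Bx.
Qed.

Lemma hardy_norm_ge0 p g : (0 <= hardy_norm p g)%E.
Proof.
apply: (@le_trans _ _ (Mp p (1 / 2) g)); first exact: poweR_ge0.
by apply: ereal_sup_ubound; exists (1 / 2) => //=; rewrite in_itv/=; lra.
Qed.

Lemma Mp_le_hardy_norm p r g : 0 < r -> r < 1 -> (Mp p r g <= hardy_norm p g)%E.
Proof.
by move=> r0 r1; apply: ereal_sup_ubound; exists r => //=; rewrite in_itv/= r0.
Qed.

Lemma hardy_norm_le p g (M : R) : 0 < p -> (forall x, B x -> {for x, continuous g}) ->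
  (forall r, 0 < r -> r < 1 -> smean r (fun x => enorm (g x) `^ p) `^ p^-1 <= M) ->
  (hardy_norm p g <= M%:E)%E.
Proof.
move=> p0 cg h; apply: ge_ereal_sup => y [r /=]; rewrite in_itv/= => /andP[r0 r1] <-.
by rewrite Mp_smean ?lee_fin ?(ltW r0)//; exact: h.
Qed.

Lemma hardyI p g (M : R) : 0 < p -> (forall x, B x -> {for x, continuous g}) ->
  (forall r, 0 < r -> r < 1 -> smean r (fun x => enorm (g x) `^ p) `^ p^-1 <= M) ->
  hardy p g.
Proof.
move=> p0 cg h; split; first exact: continuous_measurable_ball.
  move=> r r01; apply: (integrable_surface r01 (g := fun x => enorm (g x) `^ p)) => //.
    exact: continuous_enorm_powR.
  by move=> x _; exact: powR_ge0.
by apply: le_lt_trans (hardy_norm_le p0 cg h) _; exact: ltry.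
Qed.

Lemma hardy_smean_le p g : 0 < p -> (forall x, B x -> {for x, continuous g}) ->
  hardy p g -> forall r, 0 < r -> r < 1 ->
  smean r (fun x => enorm (g x) `^ p) `^ p^-1 <= fine (hardy_norm p g).
Proof.
move=> p0 cg [_ _ hy] r r0 r1.
have fN : hardy_norm p g \is a fin_num by rewrite ge0_fin_numE// hardy_norm_ge0.
by rewrite -lee_fin fineK// -Mp_smean ?(ltW r0)//; exact: Mp_le_hardy_norm.
Qed.

End hardy_smean.

(** * The estimates in terms of p = 2q and of Hardy norms *)

Section hardy_bounds.
Context {R : realType} {n : nat} (K : R) (f : 'rV[R]_n -> 'rV[R]_n) (k : 'I_n).
Hypotheses (n2 : (2 <= n)%N) (K1 : 1 <= K) (qf : harmonic_quasiregular K f).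
Local Notation B := (unit_ball R n).
Local Notation L := (1 + (n%:R - 1) * K ^+ 2).
Let n0 : (0 < n)%N. Proof. exact: ltnW. Qed.

Lemma enorm_coord_fun (x : 'rV[R]_n) : enorm (coord_fun f k x) = `|f x ord0 k|.
Proof. by rewrite /enorm big_ord1 /coord_fun mxE eqxx mulr1n sqrtr_sqr. Qed.

Let powF p : (fun x => (enorm (f x) ^+ 2) `^ (p / 2)) = (fun x => enorm (f x) `^ p).
Proof.
by apply/funext => x; rewrite powR_half ?enorm_ge0// mulrC divfK.
Qed.

Let pow_u p : (fun x => (f x ord0 k ^+ 2) `^ (p / 2)) =
  (fun x => enorm (coord_fun f k x) `^ p).
Proof.
apply/funext => x; rewrite enorm_coord_fun -real_normK ?num_real// powR_half//.
by rewrite mulrC divfK.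
Qed.

Lemma hardy_bound_le2 p r : 1 < p -> p <= 2 -> 0 <= r < 1 ->
  smean r (fun x => enorm (f x) `^ p) <= enorm (f 0) `^ p + L / (p - 1) *
    (smean r (fun x => enorm (coord_fun f k x) `^ p) - `|f 0 ord0 k| `^ p).
Proof.
move=> p1 p2 r01; have h1 : 1 / 2 < p / 2 by lra.
have h2 : p / 2 <= 1 by lra.
have := quasiregular_smean_le1 k n0 K1 qf r01 h1 h2.
have F0 := congr1 (@^~ 0) (powF p); have u0 := congr1 (@^~ 0) (pow_u p).
rewrite /= in F0 u0; rewrite powF pow_u F0 u0 enorm_coord_fun [2 * _]mulrC divfK//.
Qed.

Lemma hardy_bound_gt2 p r : 2 < p -> 0 <= r < 1 ->
  (smean r (fun x => enorm (f x) `^ p) `^ p^-1) ^+ 2 <= enorm (f 0) ^+ 2 +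
  (coefA (p / 2) L + coefB (p / 2) L) *
    (smean r (fun x => enorm (coord_fun f k x) `^ p) `^ p^-1) ^+ 2.
Proof.
move=> p2 r01; have h1 : 1 < p / 2 by lra.
have := quasiregular_smean_gt1 k n0 K1 qf r01 h1; rewrite powF pow_u.
have E (z : R) : z `^ (p / 2)^-1 = (z `^ p^-1) ^+ 2.
  by rewrite -powR_mulrn ?powR_ge0// -powRrM invf_div mulrC.
by move: (smean _ _) (smean _ _) => X Y; rewrite !E.
Qed.

End hardy_bounds.

Section main_parts.
Context {R : realType}.

Lemma continuous_coord_fun n K (f : 'rV[R]_n -> 'rV[R]_n) k :
  harmonic_quasiregular K f ->
  forall x, unit_ball R n x -> {for x, continuous (coord_fun f k)}.
Proof.
move=> qf x Bx; have [h _ _ _ _] := harmonic_C1 (qf.2 k).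
have /cvgrPdist_lt cu := h x Bx.
apply/(@cvgrPdist_lt _ _ _ (nbhs x)) => e e0; have := cu e e0; apply: filterS => t.
apply: le_lt_trans; apply: le_trans (ler_norm_enorm _) _.
by rewrite /coord_fun -raddfB /enorm big_ord1 mxE eqxx mulr1n sqrtr_sqr.
Qed.

Let cf n K (f : 'rV[R]_n -> 'rV[R]_n) : harmonic_quasiregular K f ->
  forall x, unit_ball R n x -> {for x, continuous f}.
Proof. by case=> -[h _] _. Qed.

Lemma quasiregular_Mp_le2 n K (f : 'rV[R]_n -> 'rV[R]_n) k p r :
  (2 <= n)%N -> 1 <= K -> harmonic_quasiregular K f -> 1 < p -> p <= 2 -> 0 <= r < 1 ->
  (Mp p r f `^ p <=
          (enorm (f 0) `^ p)%:E +
          ((1 + (n%:R - 1) * K ^+ 2) / (p - 1))%:E *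
          (Mp p r (coord_fun f k) `^ p - (`|f 0%R ord0 k| `^ p)%:E))%E.
Proof.
move=> n2 K1 qf p1 p2 r01; have n0 : (0 < n)%N by exact: ltnW.
have p0 : 0 < p := lt_trans ltr01 p1.
rewrite [X in (X <= _)%E](powR_Mp n0 p0 r01 (cf qf)).
rewrite [X in (_ <= _ + _ * (X - _))%E](powR_Mp n0 p0 r01 (continuous_coord_fun (k := k) qf)).
have := hardy_bound_le2 k n2 K1 qf p1 p2 r01.
by move: (smean _ _) (smean _ _) => X Y; rewrite -EFinB -EFinM -EFinD lee_fin.
Qed.

Lemma quasiregular_hardy_gt2 n K p (f : 'rV[R]_n -> 'rV[R]_n) k :
  (2 <= n)%N -> 1 <= K -> 2 < p -> harmonic_quasiregular K f -> hardy p (coord_fun f k) ->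
  let L := 1 + (n%:R - 1) * K ^+ 2 in
  hardy p f /\
  (hardy_norm p f ^+ 2 <= (enorm (f 0) ^+ 2)%:E +
    (coefA (p / 2) L + coefB (p / 2) L)%:E * hardy_norm p (coord_fun f k) ^+ 2)%E.
Proof.
move=> n2 K1 p2 qf hk L; have n0 : (0 < n)%N by exact: ltnW.
have p0 : 0 < p := lt_trans (ltr0n _ 2) p2.
have L0 : 0 < L.
  by rewrite ltr_wpDr// mulr_ge0 ?exprn_ge0 ?(le_trans ler01 K1)// subr_ge0 ler1n.
have q1 : 1 < p / 2 by rewrite ltr_pdivlMr// mul1r.
have A0 := coefA_ge0 q1 L0; have B0 := ltW (coefB_gt0 q1 L0).
have S0 := hardy_norm_ge0 p (coord_fun f k).
have hS := hardy_smean_le n0 p0 (continuous_coord_fun (k := k) qf) hk.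
have fS : hardy_norm p (coord_fun f k) \is a fin_num.
  by case: hk => _ _ hy; rewrite ge0_fin_numE.
rewrite -(fineK fS).
move: (fine (hardy_norm p (coord_fun f k))) (fine_ge0 S0) hS => S S0' hS.
pose c := enorm (f 0) ^+ 2 + (coefA (p / 2) L + coefB (p / 2) L) * S ^+ 2.
have c0 : 0 <= c by rewrite addr_ge0 ?sqr_ge0// mulr_ge0 ?sqr_ge0// addr_ge0.
have hM r : 0 < r -> r < 1 ->
    smean r (fun x => enorm (f x) `^ p) `^ p^-1 <= Num.sqrt c.
  move=> r0 r1; have r01 : 0 <= r < 1 by rewrite (ltW r0).
  rewrite -[leLHS]ger0_norm ?powR_ge0// -sqrtr_sqr ler_sqrt//.
  apply: le_trans (hardy_bound_gt2 k n2 K1 qf p2 r01) _; rewrite lerD2l.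
  rewrite ler_wpM2l ?addr_ge0// ler_pXn2r ?nnegrE ?powR_ge0//; exact: hS.
split; first exact: (hardyI n0 p0 (cf qf) hM).
have N0 := hardy_norm_ge0 p f; have Nc := hardy_norm_le n0 p0 (cf qf) hM.
have fN : hardy_norm p f \is a fin_num.
  by rewrite ge0_fin_numE//; apply: le_lt_trans Nc (ltry _).
move: Nc; rewrite -(fineK fN); move: (fine_ge0 N0); move: (fine (hardy_norm p f)) => N.
move=> N0'; rewrite lee_fin => Nc.
rewrite -!EFin_expe -EFinM -EFinD lee_fin -/c -(sqr_sqrtr c0).
by rewrite ler_pXn2r// nnegrE sqrtr_ge0.
Qed.

Lemma hardy_transfer1 : hardy_transfer (1 : R).
Proof.
move=> n K f k p n2 K1 qf p0 p1 hk; have n0 : (0 < n)%N by exact: ltnW.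
have [p2|p2] := ltP 2 p; first by have [] := quasiregular_hardy_gt2 n2 K1 p2 qf hk.
have hS := hardy_smean_le n0 p0 (continuous_coord_fun (k := k) qf) hk.
pose c := (1 + (n%:R - 1) * K ^+ 2) / (p - 1).
have c0 : 0 <= c.
  rewrite divr_ge0 ?subr_ge0 ?(ltW p1)// addr_ge0//.
  by rewrite mulr_ge0 ?exprn_ge0 ?(le_trans ler01 K1)// subr_ge0 ler1n.
pose M := enorm (f 0) `^ p + c * fine (hardy_norm p (coord_fun f k)) `^ p.
apply: (@hardyI _ _ _ n0 p f (M `^ p^-1) p0 (cf qf)) => r r0 r1.
have r01 : 0 <= r < 1 by rewrite (ltW r0).
have M0 := smean_powR_ge0 f p r01; have P0 := smean_powR_ge0 (coord_fun f k) p r01.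
have h : smean r (fun x => enorm (f x) `^ p) <= M.
  apply: le_trans (hardy_bound_le2 k n2 K1 qf p1 p2 r01) _.
  rewrite lerD2l ler_wpM2l//; apply: le_trans (_ : smean r (fun x => enorm (coord_fun f k x) `^ p) <= _).
    by rewrite lerBlDr lerDl powR_ge0.
  rewrite -(smean_powRK (coord_fun f k) p0 r01).
  apply: ge0_ler_powR; [exact: ltW|exact: powR_ge0| |exact: hS].
  by rewrite nnegrE; apply: le_trans (hS r r0 r1); exact: powR_ge0.
move: M0 h; move: (smean r (fun x => enorm (f x) `^ p)) => X X0 h.
by apply: ge0_ler_powR; rewrite // ?nnegrE ?invr_ge0 ?(ltW p0)//; exact: le_trans h.
Qed.

End main_parts.

(** * The example (1+z)/(1-z) *)

Section smooth_on_open.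
Context {R : realType} {n : nat} (Om : set 'rV[R]_n).
Hypothesis oOm : open Om.
Local Notation e_ i := (delta_mx ord0 i : 'rV[R]_n).

Lemma continuous_locally_Lp (g : 'rV[R]_n -> R) m :
  (forall x, Om x -> {for x, continuous g}) -> locally_Lp m%:R Om g.
Proof.
move=> cg; split; first exact: continuous_open_measurable_rV.
move=> A cA AOm; rewrite (_ : (fun x => _) = EFin \o (fun x => `|g x| ^+ m)).
  apply: (continuous_compact_integrable oOm) => // x Omx.
  apply: (continuous_comp (f := fun y => `|g y|) (g := fun t => t ^+ m)).
    by apply: (continuous_comp (cg x Omx)); exact: norm_continuous.
  exact: exprn_continuous.
by apply/funext => x; rewrite /= powR_mulrn.
Qed.

Lemma near_open_eq (g h : 'rV[R]_n -> R) x : (forall y, Om y -> g y = h y) ->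
  Om x -> \near x, g x = h x.
Proof.
by move=> gh Omx; near=> y; apply: gh; near: y; exact: open_nbhs_nbhs.
Unshelve. all: by end_near. Qed.

(** [partial i H] agrees with [DH i] on Om only, so second derivatives and continuity are
    transferred through equality near each point of the open set. *)
Lemma harmonicI (H : 'rV[R]_n -> R) (DH : 'I_n -> 'rV[R]_n -> R)
    (D2H : 'I_n -> 'I_n -> 'rV[R]_n -> R) :
  (forall x, Om x -> {for x, continuous H}) ->
  (forall i x, Om x -> is_derive x (e_ i) H (DH i x)) ->
  (forall i x, Om x -> {for x, continuous (DH i)}) ->
  (forall i j x, Om x -> is_derive x (e_ j) (DH i) (D2H i j x)) ->
  (forall i j x, Om x -> {for x, continuous (D2H i j)}) ->
  (forall x, Om x -> \sum_i D2H i i x = 0) -> Defs.harmonic Om H.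
Proof.
move=> cH dH cD dD cD2 lap.
have pE i x : Om x -> DH i x = partial i H x.
  by move=> Omx; have [_ <-] := dH i x Omx.
have dp i j x : Om x -> is_derive x (e_ j) (partial i H) (D2H i j x).
  move=> Omx; apply: near_eq_is_derive (dD i j x Omx).
  by apply: near_open_eq => // y; exact: pE.
have ppE i j x : Om x -> D2H i j x = partial j (partial i H) x.
  by move=> Omx; have [_ <-] := dp i j x Omx.
split; last first.
  by move=> x Omx; rewrite -[RHS](lap x Omx); apply: eq_bigr => i _; rewrite ppE.
split=> // i; split; first by move=> x Omx; have [] := dH i x Omx.
split=> [x Omx|j].
  apply: near_eq_continuous (cD i x Omx).
  by apply: near_open_eq => // y; exact: pE.
split; first by move=> x Omx; have [] := dp i j x Omx.
split=> // x Omx; apply: near_eq_continuous (cD2 i j x Omx).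
by apply: near_open_eq => // y; exact: ppE.
Qed.

End smooth_on_open.

Lemma continuous_rowP (R : realType) m n (h : 'rV[R]_m -> 'rV[R]_n) (y : 'rV[R]_m) :
  (forall j, {for y, continuous (fun x : 'rV[R]_m => h x ord0 j)}) ->
  {for y, continuous h}.
Proof.
move=> ch A [P PP PA].
have : \forall x \near y, forall j, P ord0 j (h x ord0 j).
  by apply: (@filter_forall _ _ (fun j x => P ord0 j (h x ord0 j)) (nbhs y) _) => j;
    apply: ch; exact: PP.
by apply: filterS => x xP; apply: PA => i j; rewrite (ord1 i); exact: xP.
Qed.

Section counterexample.
Context {R : realType}.
Local Notation B := (unit_ball R 2).
Local Notation i0 := (ord0 : 'I_2).
Local Notation i1 := (ord_max : 'I_2).
Local Notation e_ i := (delta_mx ord0 i : 'rV[R]_2).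
Implicit Types x : 'rV[R]_2.

Lemma sum_ord2 (F : 'I_2 -> R) : \sum_i F i = F i0 + F i1.
Proof. by rewrite big_ord_recl big_ord1; congr (_ + F _); exact: val_inj. Qed.

Lemma ord2_ind (P : 'I_2 -> Prop) : P i0 -> P i1 -> forall i, P i.
Proof.
move=> P0 P1 [[|[|//]] ih].
  by rewrite (_ : Ordinal ih = i0)//; exact: val_inj.
by rewrite (_ : Ordinal ih = i1)//; exact: val_inj.
Qed.

Let a x := 1 - x ord0 i0.
Let b x := x ord0 i1.
Let den x := a x ^+ 2 + b x ^+ 2.

(* The real and imaginary parts of 1/(1-z). *)
Definition inv_re x := a x * (den x)^-1.
Definition inv_im x := b x * (den x)^-1.

Let a_gt0 x : B x -> 0 < a x.
Proof.
move=> Bx; rewrite subr_gt0; apply: le_lt_trans Bx.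
by apply: le_trans (ler_norm _) _; exact: ler_coord_enorm.
Qed.

Let den_gt0 x : B x -> 0 < den x.
Proof. by move=> Bx; rewrite ltr_wpDr ?sqr_ge0// exprn_gt0// a_gt0. Qed.

Let is_derive_a i x : is_derive x (e_ i) a (if i == i0 then -1 else 0).
Proof.
have h := is_derive_add (is_derive_cst (1 : R) x (e_ i))
  (is_derive_opp (is_derive_coord i0 (e_ i) x)).
apply: (is_derive_eq h); rewrite add0r mxE eqxx/=.
by move: i {h}; apply: ord2_ind; rewrite ?oppr0.
Qed.

Let is_derive_b i x : is_derive x (e_ i) b (if i == i0 then 0 else 1).
Proof.
apply: (is_derive_eq (is_derive_coord i1 (e_ i) x)); rewrite mxE eqxx/=.
by move: i; apply: ord2_ind.
Qed.

Let continuous_a x : {for x, continuous a}.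
Proof. by apply: continuousB; [exact: cst_continuous|exact: continuous_coord]. Qed.

Let continuous_den x : {for x, continuous den}.
Proof.
apply: continuousD; apply: continuousM;
  by [exact: continuous_a|exact: continuous_coord].
Qed.

Lemma continuous_inv_re x : B x -> {for x, continuous inv_re}.
Proof.
move=> Bx; apply: continuousM; first exact: continuous_a.
by apply: continuousV; [rewrite gt_eqF// den_gt0|exact: continuous_den].
Qed.

Lemma continuous_inv_im x : B x -> {for x, continuous inv_im}.
Proof.
move=> Bx; apply: continuousM; first exact: continuous_coord.
by apply: continuousV; [rewrite gt_eqF// den_gt0|exact: continuous_den].
Qed.

(* The real and imaginary parts of 1/(1-z)^2, the derivative of 1/(1-z). *)
Definition sqr_re x := inv_re x * inv_re x - inv_im x * inv_im x.
Definition sqr_im x := 2 * (inv_re x * inv_im x).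

(** Cauchy-Riemann: the partial derivatives of 1/(1-z) are g and i g, where g = 1/(1-z)^2. *)
Let Dre i x := if i == i0 then sqr_re x else - sqr_im x.
Let Dim i x := if i == i0 then sqr_im x else sqr_re x.

Let is_derive_den i x : is_derive x (e_ i) den (if i == i0 then - (2 * a x) else 2 * b x).
Proof.
have h := is_derive_add (is_derive_mul (is_derive_a i x) (is_derive_a i x))
  (is_derive_mul (is_derive_b i x) (is_derive_b i x)).
apply: (is_derive_eq h); case: ifP => _; ring.
Qed.

Let is_derive_denV i x : B x -> is_derive x (e_ i) (fun y => (den y)^-1)
  (- ((if i == i0 then - (2 * a x) else 2 * b x) * (den x) ^- 2)).
Proof.
move=> Bx; have d0 : den x != 0 by rewrite gt_eqF// den_gt0.
have h := is_deriveV (f := id) d0 (is_derive_id (den x) (1 : R)).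
apply: (is_derive_eq (is_derive_comp1 (h := fun t => t^-1) h (is_derive_den i x))).
by rewrite /GRing.scale/=; ring.
Qed.

Lemma is_derive_inv_re i x : B x -> is_derive x (e_ i) inv_re (Dre i x).
Proof.
move=> Bx; have d0 : den x != 0 by rewrite gt_eqF// den_gt0.
apply: (is_derive_eq (is_derive_mul (is_derive_a i x) (is_derive_denV i Bx))).
rewrite /Dre /sqr_re /sqr_im /inv_re /inv_im.
by rewrite /den in d0 *; case: ifP => _; field.
Qed.

Lemma is_derive_inv_im i x : B x -> is_derive x (e_ i) inv_im (Dim i x).
Proof.
move=> Bx; have d0 : den x != 0 by rewrite gt_eqF// den_gt0.
apply: (is_derive_eq (is_derive_mul (is_derive_b i x) (is_derive_denV i Bx))).
rewrite /Dim /sqr_re /sqr_im /inv_re /inv_im.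
by rewrite /den in d0 *; case: ifP => _; field.
Qed.

(** The map (1+z)/(1-z), written as 2/(1-z) - 1. *)
Let f x : 'rV[R]_2 := \row_j (if j == i0 then 2 * inv_re x - 1 else 2 * inv_im x).

Let cM (g h : 'rV[R]_2 -> R) : (forall x, B x -> {for x, continuous g}) ->
  (forall x, B x -> {for x, continuous h}) ->
  forall x, B x -> {for x, continuous (fun y => g y * h y)}.
Proof. by move=> cg ch x Bx; apply: continuousM; [exact: cg|exact: ch]. Qed.

Let cZ k (g : 'rV[R]_2 -> R) : (forall x, B x -> {for x, continuous g}) ->
  forall x, B x -> {for x, continuous (fun y => k * g y)}.
Proof. by move=> cg; apply: cM => // x _; exact: cst_continuous. Qed.

Let cD (g h : 'rV[R]_2 -> R) : (forall x, B x -> {for x, continuous g}) ->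
  (forall x, B x -> {for x, continuous h}) ->
  forall x, B x -> {for x, continuous (fun y => g y + h y)}.
Proof. by move=> cg ch x Bx; apply: continuousD; [exact: cg|exact: ch]. Qed.

Let cN (g : 'rV[R]_2 -> R) : (forall x, B x -> {for x, continuous g}) ->
  forall x, B x -> {for x, continuous (fun y => - g y)}.
Proof. by move=> cg x Bx; apply: continuousN; exact: cg. Qed.

Let c_re := continuous_inv_re.
Let c_im := continuous_inv_im.

Let c_sqr_re x : B x -> {for x, continuous sqr_re}.
Proof. by move: x; exact: cD (cM c_re c_re) (cN (cM c_im c_im)). Qed.

Let c_sqr_im x : B x -> {for x, continuous sqr_im}.
Proof. by move: x; exact: cZ (cM c_re c_im). Qed.

Let cDre i x : B x -> {for x, continuous (Dre i)}.
Proof.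
by move: i x; apply: ord2_ind; [exact: c_sqr_re|exact: cN c_sqr_im].
Qed.

Let cDim i x : B x -> {for x, continuous (Dim i)}.
Proof.
by move: i x; apply: ord2_ind; [exact: c_sqr_im|exact: c_sqr_re].
Qed.

Let D2sqr_re j x := (Dre j x * inv_re x + inv_re x * Dre j x) -
  (Dim j x * inv_im x + inv_im x * Dim j x).
Let D2sqr_im j x := 2 * (Dre j x * inv_im x + inv_re x * Dim j x).

Let d_sqr_re j x : B x -> is_derive x (e_ j) sqr_re (D2sqr_re j x).
Proof.
move=> Bx; apply: is_derive_add.
  by apply: is_derive_mul; exact: is_derive_inv_re.
by apply: is_derive_opp; apply: is_derive_mul; exact: is_derive_inv_im.
Qed.

Let d_sqr_im j x : B x -> is_derive x (e_ j) sqr_im (D2sqr_im j x).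
Proof.
move=> Bx; apply: is_derive_scale.
by apply: is_derive_mul; [exact: is_derive_inv_re|exact: is_derive_inv_im].
Qed.

Let cD2sqr_re j x : B x -> {for x, continuous (D2sqr_re j)}.
Proof.
move: x; exact: cD (cD (cM (@cDre j) c_re) (cM c_re (@cDre j)))
  (cN (cD (cM (@cDim j) c_im) (cM c_im (@cDim j)))).
Qed.

Let cD2sqr_im j x : B x -> {for x, continuous (D2sqr_im j)}.
Proof. by move: x; exact: cZ (cD (cM (@cDre j) c_im) (cM c_re (@cDim j))). Qed.

Let oB : open B. Proof. exact: (@open_eball R 2 1). Qed.

Let u x := 2 * inv_re x - 1.
Let v x := 2 * inv_im x.

Let cu x : B x -> {for x, continuous u}.
Proof. by move: x; apply: cD (cZ c_re) _ => x _; exact: cst_continuous. Qed.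

Let cv x : B x -> {for x, continuous v}.
Proof. by move: x; exact: cZ c_im. Qed.

Let du i x : B x -> is_derive x (e_ i) u (2 * Dre i x).
Proof.
move=> Bx; have h := is_derive_add (is_derive_scale 2 (is_derive_inv_re i Bx))
  (is_derive_cst (-1 : R) x (e_ i)).
by apply: (is_derive_eq h); rewrite addr0.
Qed.

Let dv i x : B x -> is_derive x (e_ i) v (2 * Dim i x).
Proof. by move=> Bx; apply: is_derive_scale; exact: is_derive_inv_im. Qed.

Let D2re i j x := if i == i0 then D2sqr_re j x else - D2sqr_im j x.
Let D2im i j x := if i == i0 then D2sqr_im j x else D2sqr_re j x.

Let dDre i j x : B x -> is_derive x (e_ j) (Dre i) (D2re i j x).
Proof.
move=> Bx; move: i; apply: ord2_ind; first exact: d_sqr_re.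
by apply: is_derive_opp; exact: d_sqr_im.
Qed.

Let dDim i j x : B x -> is_derive x (e_ j) (Dim i) (D2im i j x).
Proof. by move=> Bx; move: i; apply: ord2_ind; [exact: d_sqr_im|exact: d_sqr_re]. Qed.

Let cD2re i j x : B x -> {for x, continuous (D2re i j)}.
Proof.
by move: i x; apply: ord2_ind; [exact: cD2sqr_re|exact: cN (@cD2sqr_im j)].
Qed.

Let cD2im i j x : B x -> {for x, continuous (D2im i j)}.
Proof. by move: i x; apply: ord2_ind; [exact: cD2sqr_im|exact: cD2sqr_re]. Qed.

Let harmonic_u : Defs.harmonic B u.
Proof.
apply: (@harmonicI _ _ _ oB u (fun i x => 2 * Dre i x) (fun i j x => 2 * D2re i j x)).
- exact: cu.
- exact: du.
- by move=> i; exact: cZ (@cDre i).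
- by move=> i j x Bx; apply: is_derive_scale; exact: dDre.
- by move=> i j; exact: cZ (@cD2re i j).
- by move=> x _; rewrite sum_ord2 /D2re/= /D2sqr_re /D2sqr_im /Dre /Dim/=; ring.
Qed.

Let harmonic_v : Defs.harmonic B v.
Proof.
apply: (@harmonicI _ _ _ oB v (fun i x => 2 * Dim i x) (fun i j x => 2 * D2im i j x)).
- exact: cv.
- exact: dv.
- by move=> i; exact: cZ (@cDim i).
- by move=> i j x Bx; apply: is_derive_scale; exact: dDim.
- by move=> i j; exact: cZ (@cD2im i j).
- by move=> x _; rewrite sum_ord2 /D2im/= /D2sqr_re /D2sqr_im /Dre /Dim/=; ring.
Qed.

Let fu x : f x ord0 i0 = u x. Proof. by rewrite mxE. Qed.
Let fv x : f x ord0 i1 = v x. Proof. by rewrite mxE. Qed.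

Let Df x : 'M[R]_2 := \matrix_(i, j) (2 * (if j == i0 then Dre i x else Dim i x)).

Let Df_det x : \det (Df x) = 4 * (sqr_re x ^+ 2 + sqr_im x ^+ 2).
Proof.
rewrite (expand_det_row _ i0) sum_ord2 /cofactor !det_mx11 !mxE/= /Dre /Dim/=.
rewrite expr0 expr1; ring.
Qed.

(** By Cauchy-Riemann the matrix is a multiple of a rotation, so |w A|^2 = det A |w|^2 for all w,
    and K = 1 is allowed. *)
Let Df_opnorm x : opnorm (Df x) ^+ 2 <= \det (Df x).
Proof.
have D0 : 0 <= \det (Df x) by rewrite Df_det mulr_ge0// addr_ge0// sqr_ge0.
rewrite -[leRHS]sqr_sqrtr// ler_pXn2r ?nnegrE ?sqrtr_ge0 ?opnorm_ge0//.
apply: opnorm_le => [|w]; first exact: sqrtr_ge0.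
rewrite -sqrtrM// ler_sqrt; last by rewrite mulr_ge0// sumsq_ge0.
rewrite !sum_ord2 Df_det !mxE !sum_ord2 !mxE/= /Dre /Dim/= le_eqVlt; apply/orP; left.
by apply/eqP; ring.
Qed.

Lemma harmonic_quasiregular_inv : harmonic_quasiregular 1 f.
Proof.
have hf j : Defs.harmonic B (fun x => f x ord0 j).
  move: j; apply: ord2_ind.
    by rewrite (_ : (fun x => _) = u)//; apply/funext => x; exact: fu.
  by rewrite (_ : (fun x => _) = v)//; apply/funext => x; exact: fv.
split=> //; split.
  by move=> x Bx; apply: continuous_rowP => j; have [[h _] _] := hf j; exact: h.
exists Df; split; last first.
  by apply: aeW => x _; rewrite mul1r; exact: Df_opnorm.
move=> i j; have cDf x : B x -> {for x, continuous (fun y => Df y i j)}.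
  rewrite (_ : (fun y => _) = fun y => 2 * (if j == i0 then Dre i y else Dim i y)).
    by case: (j == i0) x; [exact: cZ (@cDre i)|exact: cZ (@cDim i)].
  by apply/funext => y; rewrite mxE.
split; first exact: continuous_locally_Lp.
have [ch dh _ _ _] := harmonic_C1 (hf j).
apply: C1_weak_partial => // x Bx.
rewrite mxE; move: j {cDf ch dh}; apply: ord2_ind => /=.
  by rewrite (_ : (fun y => _) = u); [exact: du|apply/funext => y; exact: fu].
by rewrite (_ : (fun y => _) = v); [exact: dv|apply/funext => y; exact: fv].
Qed.

Let vE x : v x = 2 * b x / den x.
Proof. by rewrite /v /inv_im mulrA. Qed.

(** The function u is the Poisson kernel (1 - |z|^2)/|1-z|^2. *)
Let u_gt0 x : B x -> 0 < u x.
Proof.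
move=> Bx; have d0 := den_gt0 Bx.
have -> : u x = (1 - enorm x ^+ 2) / den x.
  transitivity ((2 * a x - den x) / den x).
    by rewrite /u /inv_re; field; exact: lt0r_neq0.
  by rewrite enorm_sqr sum_ord2; congr (_ / _); rewrite /den /a /b; ring.
by rewrite divr_gt0// subr_gt0 expr_lt1// enorm_ge0.
Qed.

(** As u is positive, the mean of |u| is the mean of u, which is at most u(0) = 1 by the sub-mean
    value property of the harmonic function -u. *)
Lemma hardy1_re_inv : hardy 1 (coord_fun f i0).
Proof.
have qf := harmonic_quasiregular_inv.
apply: (@hardyI _ _ _ _ 1 _ 1) => //.
  exact: (continuous_coord_fun (k := i0) qf).
move=> r r0 r1; have r01 : 0 <= r < 1 by rewrite (ltW r0).
rewrite invr1 powRr1; last exact: smean_powR_ge0.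
have C2u : C2 B u (fun i x => 2 * Dre i x) (fun i x => 2 * D2re i i x).
  split; [exact: cu|exact: du| | |].
  - by move=> i; exact: cZ (@cDre i).
  - by move=> i x Bx; apply: is_derive_scale; exact: dDre.
  - by move=> i; exact: cZ (@cD2re i i).
have h : -1 * u 0 <= smean r (fun x => -1 * u x).
  apply: submean r01 (C2_scale (-1) C2u) _ => x Bx.
  rewrite sum_ord2 /D2re/= /D2sqr_re /D2sqr_im /Dre /Dim/=.
  by rewrite le_eqVlt; apply/orP; left; apply/eqP; ring.
rewrite smeanZ// in h.
have u0 : u 0 = 1.
  rewrite /u /inv_re /den /a /b !mxE subr0 !expr2 !mul1r mulr0 addr0 invr1; ring.
apply: (@le_trans _ _ (smean r u)); last by move: h; rewrite !mulN1r lerN2 u0.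
apply: smean_le => //.
  by apply: continuous_enorm_powR => //; exact: (continuous_coord_fun (k := i0) qf).
move=> x Bx; rewrite enorm_coord_fun fu powRr1//.
by rewrite ger0_norm// ltW// u_gt0.
Qed.

(* On the annular sector over this rectangle, |1-z| is comparable to w as soon
   as 1-r <= w. *)
Let rect (w : R) : set 'rV[R]_2 := rV_box (fun i : 'I_2 =>
  if i == i0 then `]1/4, 1/2[%classic else `]w / 2, w[%classic).

Let rectE w x : rect w x <->
  [/\ 1/4 < x ord0 i0, x ord0 i0 < 1/2, w / 2 < x ord0 i1 & x ord0 i1 < w].
Proof.
split=> [xw|[x1 x2 x3 x4] i].
  have := xw i0; have := xw i1; rewrite /= !in_itv/=.
  by move=> /andP[-> ->] /andP[-> ->].
by move: i; apply: ord2_ind; rewrite /= in_itv/= ?x1 ?x2 ?x3 ?x4.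
Qed.

Let measurable_rect w : measurable (rect w).
Proof. by apply: measurable_rV_box => i; case: ifP => _; exact: measurable_itv. Qed.

Let leb_rect w : 0 < w -> leb 2 (rect w) = (w / 8)%:E.
Proof.
move=> w0; rewrite /rect.
rewrite (_ : (fun i : 'I_2 => _) = fun i : 'I_2 =>
  `](if i == i0 then 1/4 else w / 2), (if i == i0 then 1/2 else w)[%classic).
  rewrite leb_itv_box.
    rewrite big_ord_recl big_ord1/=; congr (_%:E); lra.
  by move=> i; case: ifP => _; lra.
by apply/funext => i; case: ifP.
Qed.

Let rect_ball w x : 0 < w -> w <= 1/8 -> rect w x ->
  x ord0 i0 < enorm x /\ enorm x < 1.
Proof.
move=> w0 w8 /rectE[x1 x2 x3 x4].
set R' := enorm x.
have E : R' ^+ 2 = x ord0 i0 ^+ 2 + x ord0 i1 ^+ 2 by rewrite /R' enorm_sqr sum_ord2.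
have R0 : 0 <= R' by exact: enorm_ge0.
split.
  rewrite -(@ltr_pXn2r _ 2)// ?nnegrE; [|lra].
  by rewrite E ltrDl exprn_gt0//; lra.
rewrite -(@ltr_pXn2r _ 2)// ?nnegrE// E expr1n.
have h1 : x ord0 i0 ^+ 2 <= (1/2) ^+ 2 by rewrite ler_pXn2r// ?nnegrE; lra.
have h2 : x ord0 i1 ^+ 2 <= (1/8) ^+ 2 by rewrite ler_pXn2r// ?nnegrE; lra.
by apply: le_lt_trans (lerD h1 h2) _; lra.
Qed.

Let v_rect w r x : 0 < w -> w <= 1/8 -> 1/2 <= r -> r < 1 -> 1 - r <= w ->
  rect w x -> (40 * w)^-1 <= v (r *: radial_proj x).
Proof.
move=> w0 w8 r2 r1 rw wx; have [xR R1] := rect_ball w0 w8 wx.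
have [x1 x2 x3 x4] := (rectE _ _).1 wx.
have E : enorm x ^+ 2 = x ord0 i0 ^+ 2 + x ord0 i1 ^+ 2 by rewrite enorm_sqr sum_ord2.
rewrite vE /den /a /b !mxE; move: (x ord0 i0) (x ord0 i1) (enorm x) x1 x2 x3 x4 xR R1 E.
move=> s t m s1 s2 t1 t2 sm m1 E.
have m0 : 0 < m by lra.
have mN0 : m != 0 by rewrite gt_eqF.
have st : t * t = (m - s) * (m + s).
  by move: E; rewrite !expr2 => E; rewrite mulrDr !mulrBl; lra.
(* With z = r x/|x|, 1 - z has real part A and imaginary part -C. The bounds C >= w/4 and A^2 + C^2
   <= 20 w^2 give v = 2C/(A^2 + C^2) >= 1/(40 w). *)
set A := 1 - r * (m^-1 * s); set C := r * (m^-1 * t).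
have tt : t * t <= w / 8.
  apply: (@le_trans _ _ (w * (1/8))); last by lra.
  by apply: ler_pM; lra.
(* The deviation m - s = t^2/(m+s) is quadratic in t, and t^2 <= w/8 while m + s >= 1/2. *)
have ms : (m - s) <= w / 4.
  have : (m - s) * (1/2) <= (m - s) * (m + s) by rewrite ler_wpM2l//; lra.
  rewrite -st; lra.
have A0 : 0 <= A.
  rewrite subr_ge0 -[leRHS]mulr1; apply: ler_pM; [lra| |lra|].
    by apply: mulr_ge0; [rewrite invr_ge0; exact: ltW|lra].
  by rewrite mulrC ler_pdivrMr// mul1r ltW.
have AE : A = (1 - r) + r * (m^-1 * (m - s)).
  by rewrite mulrBr mulVf// mulrBr mulr1 /A; ring.
have A2 : A <= 2 * w.
  have : r * (m^-1 * (m - s)) <= 1 * (4 * (w / 4)).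
    apply: ler_pM; [lra| |lra|].
      by rewrite mulr_ge0 ?invr_ge0//; lra.
    apply: ler_pM; [by rewrite invr_ge0; lra|lra| |exact: ms].
    by rewrite -[leRHS]invrK lef_pV2 ?posrE ?invr_gt0//; lra.
  rewrite AE; lra.
have C1 : w / 4 <= C.
  apply: (@le_trans _ _ (1/2 * (1 * (w / 2)))); first lra.
  apply: ler_pM; [lra|lra|lra|apply: ler_pM; [lra|lra| |lra]].
  by rewrite invf_ge1// ltW.
have C2 : C <= 4 * w.
  apply: (@le_trans _ _ (1 * (4 * w))); last lra.
  apply: ler_pM; [lra| |lra|].
    by rewrite mulr_ge0 ?invr_ge0//; lra.
  apply: ler_pM; [by rewrite invr_ge0; lra|lra| |lra].
  by rewrite -[leRHS]invrK lef_pV2 ?posrE ?invr_gt0//; lra.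
have C0 : 0 < C by lra.
have D0 : 0 < A ^+ 2 + C ^+ 2 by rewrite ltr_wpDl ?sqr_ge0// exprn_gt0.
have D1 : A ^+ 2 + C ^+ 2 <= 20 * (w * w).
  have h1 : A * A <= (2 * w) * (2 * w) by apply: ler_pM.
  have h2 : C * C <= (4 * w) * (4 * w) by apply: ler_pM; lra.
  rewrite !expr2; lra.
rewrite ler_pdivlMr// ler_pdivrMl; last by rewrite mulr_gt0.
apply: le_trans D1 _.
have : w * (w / 4) <= w * C by rewrite ler_wpM2l// ltW.
lra.
Qed.

(** Dyadic scales make the rectangles disjoint; the shift by 3 gives w <= 1/8, which keeps them
    inside the ball. *)
Let w_ (k : nat) : R := (2 ^- (k + 3)).

Let w_gt0 k : 0 < w_ k. Proof. by rewrite invr_gt0 exprn_gt0. Qed.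

Let w_le k : w_ k <= 1/8.
Proof.
rewrite /w_ div1r lef_pV2 ?posrE ?exprn_gt0// (_ : 8 = 2 ^+ 3); last by ring.
by rewrite ler_weXn2l ?ler1n// leq_addl.
Qed.

Let w_mono j k : (j < k)%N -> w_ k <= w_ j / 2.
Proof.
move=> jk; rewrite -invfM -exprSr lef_pV2 ?posrE ?exprn_gt0//.
by rewrite ler_weXn2l ?ler1n// -addSn leq_add2r.
Qed.

Let triv_rect N : trivIset [set` iota 0 N] (fun k => rect (w_ k)).
Proof.
have H j k x : (j < k)%N -> rect (w_ j) x -> rect (w_ k) x -> False.
  move=> /w_mono jk /rectE[_ _ j3 _] /rectE[_ _ _ k4]; lra.
move=> j k _ _ [x [jx kx]]; apply/eqP; rewrite -[_ == _]negbK; apply/negP.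
by rewrite neq_ltn => /orP[jk|jk]; [exact: H jk jx kx|exact: H jk kx jx].
Qed.

(** Each of N disjoint rectangles has area w/8 and carries values at least 1/(40 w), so it
    contributes 1/320 whatever its scale. This is the logarithmic divergence. *)
Let smean_lower (N : nat) : exists2 r : R, 0 < r < 1 &
  (vol_ball 2)^-1 * (N%:R / 320) <= smean r (fun x => enorm (f x) `^ 1).
Proof.
(* Then 1 - r = [w_ N] is below every scale [w_ k] with k < N, as [v_rect] requires. *)
pose r := 1 - w_ N; have wN := w_le N; have wN0 := w_gt0 N.
exists r; first by rewrite /r; apply/andP; split; lra.
have r01 : 0 <= r < 1 by rewrite /r; apply/andP; split; lra.
have qf := harmonic_quasiregular_inv.
have cf x : B x -> {for x, continuous f} by case: qf => -[h _] _; exact: h.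
have cg : forall x, B x -> {for x, continuous (fun x => enorm (f x) `^ 1)}.
  exact: continuous_enorm_powR.
rewrite /smean ler_wpM2l ?vol_ballV_ge0//.
have iB := integrable_scale_radial r01 cg.
have mB : measurable B by exact: measurable_unit_ball.
rewrite -lee_fin /Rintegral fineK; last exact: (integrable_fin_num mB iB).
pose g x : \bar R := (enorm (f (r *: radial_proj x)) `^ 1)%:E.
have g0 x : (0 <= g x)%E by rewrite lee_fin powR_ge0.
have mg : measurable_fun B g by exact: measurable_int iB.
pose T := \big[setU/set0]_(k <- iota 0 N) rect (w_ k).
have TB : T `<=` B.
  rewrite /T -bigcup_seq => x [k _ /= kx].
  by have [] := rect_ball (w_gt0 k) (w_le k) kx.
have mT : measurable T by apply: bigsetU_measurable => k _; exact: measurable_rect.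
apply: (@le_trans _ _ (\int[leb 2]_(x in T) g x)%E); last first.
  by apply: ge0_subset_integral.
rewrite (@ge0_integral_bigsetU _ _ _ (leb 2) _ (fun k => rect (w_ k)) g (iota 0 N) _ (iota_uniq 0 N) (triv_rect (N:=N)))//.
  apply: (@le_trans _ _ (\sum_(k <- iota 0 N) (1 / 320)%:E)%E).
    rewrite sumEFin lee_fin big_const_seq count_predT size_iota iter_addr_0.
    by rewrite -[leRHS]mulr_natl mul1r.
  rewrite !big_seq; apply: lee_sum => k; rewrite mem_iota add0n => /andP[_ kN].
  have wk0 := w_gt0 k.
  apply: (@le_trans _ _ (\int[leb 2]_(x in rect (w_ k)) (40 * w_ k)^-1%:E)%E).
    rewrite integral_cst// [X in (_ * X)%E](leb_rect wk0) -EFinM lee_fin.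
    rewrite le_eqVlt; apply/orP; left; apply/eqP; field; exact: lt0r_neq0.
  apply: ge0_le_integral => //.
  - by move=> x _; rewrite lee_fin invr_ge0 mulr_ge0// ltW.
  - apply: (measurable_funS mB _ mg) => x kx.
    by have [] := rect_ball wk0 (w_le k) kx.
  move=> x kx; rewrite lee_fin powRr1 ?enorm_ge0//.
  have wk := w_le k; have kN' : w_ N <= w_ k.
    by apply: le_trans (w_mono kN) _; rewrite ler_pdivrMr// ler_peMr ?ler1n// ltW.
  apply: (@le_trans _ _ (v (r *: radial_proj x))).
    by apply: (v_rect wk0 wk _ _ _ kx); rewrite /r; lra.
  rewrite -fv; apply: le_trans (ler_norm _) _; exact: ler_coord_enorm.
exact: measurable_funS TB mg.
Qed.

(** The exponent p = 1 exceeds every p0 < 1, so the same map refutes all of them. *)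
Lemma hardy_transfer_sharp (p0 : R) : p0 < 1 -> ~ hardy_transfer p0.
Proof.
move=> p01 /(_ 2%N 1 f i0 1 isT (lexx _) harmonic_quasiregular_inv ltr01 p01
  hardy1_re_inv) hf.
have cf x : B x -> {for x, continuous f}.
  by case: harmonic_quasiregular_inv => -[h _] _; exact: h.
have hS := hardy_smean_le (isT : (0 < 2)%N) ltr01 cf hf.
move: (fine (hardy_norm 1 f)) hS => S hS.
have V0 : 0 < vol_ball 2 :> R by exact: vol_ball_gt0.
have S0 : 0 <= S by apply: le_trans (hS (1/2) _ _); [exact: powR_ge0|lra|lra].
have VS0 : 0 <= (vol_ball 2 : R) * S * 320 by rewrite !mulr_ge0// ltW.
have [r /andP[r0 r1] hN] := smean_lower (Num.bound (vol_ball 2 * S * 320)).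
have r01 : 0 <= r < 1 by rewrite (ltW r0).
have := hS r r0 r1; rewrite invr1 powRr1; last exact: smean_powR_ge0.
move=> /(le_trans hN); rewrite ler_pdivrMl// ler_pdivrMr// leNgt => /negP; apply.
exact: archi_boundP.
Qed.

End counterexample.

Theorem corollary1p5 (R : realType) :
  [/\ hardy_transfer (1 : R),
      (forall p0 : R, p0 < 1 -> ~ hardy_transfer p0),
      (forall (n : nat) (K : R) (f : 'rV[R]_n -> 'rV[R]_n) (k : 'I_n) (p r : R),
         (2 <= n)%N -> 1 <= K -> harmonic_quasiregular K f ->
         1 < p <= 2 -> hardy p (coord_fun f k) ->
         0 <= r < 1 ->
         (Mp p r f `^ p <=
          (enorm (f 0) `^ p)%:E +
          ((1 + (n%:R - 1) * K ^+ 2) / (p - 1))%:E *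
          (Mp p r (coord_fun f k) `^ p - (`|f 0%R ord0 k| `^ p)%:E))%E) &
      (forall (n : nat) (K p : R), (2 <= n)%N -> 1 <= K -> 2 < p ->
         exists2 tau1 : R, 0 < tau1 &
           forall (f : 'rV[R]_n -> 'rV[R]_n) (k : 'I_n),
             harmonic_quasiregular K f -> hardy p (coord_fun f k) ->
             (hardy_norm p f ^+ 2 <=
              (enorm (f 0) ^+ 2)%:E + tau1%:E * hardy_norm p (coord_fun f k) ^+ 2)%E)].
Proof.
split.
- exact: hardy_transfer1.
- exact: hardy_transfer_sharp.
- by move=> n K f k p r n2 K1 qf /andP[p1 p2] _; exact: quasiregular_Mp_le2.
move=> n K p n2 K1 p2.
have L0 : 0 < 1 + (n%:R - 1) * K ^+ 2.
  rewrite ltr_wpDr// mulr_ge0 ?exprn_ge0 ?(le_trans ler01 K1)//.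
  by rewrite subr_ge0 ler1n; exact: ltnW.
have q1 : 1 < p / 2 by rewrite ltr_pdivlMr// mul1r.
exists (coefA (p / 2) (1 + (n%:R - 1) * K ^+ 2) +
        coefB (p / 2) (1 + (n%:R - 1) * K ^+ 2)).
  by rewrite ltr_wpDl ?coefA_ge0// coefB_gt0.
by move=> f k qf hk; have [] := quasiregular_hardy_gt2 n2 K1 p2 qf hk.
Qed.
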